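(* Under the setting described in the context, there exists a probability measure $\nu$ on $\mathbb{R}$, symmetric about $0$, such that \[ \lim_{N\to\infty}\mathrm{ESD}\big((N\varepsilon_N)^{-1/2}(\Delta_N-D_N)\big)=\nu\quad\text{weakly in probability}, \] where $D_N=\mathrm{diag}\big(\mathrm{E}[\Delta_N(1,1)],\dots,\mathrm{E}[\Delta_N(N,N)]\big)$. Furthermore, if $f$ is not identically $0$, then the support of $\nu$ is unbounded.
   Context: Let $f\colon[0,1]\times[0,1]\to[0,\infty)$ be continuous with $f(x,y)=f(y,x)$ for all $x,y\in[0,1]$. Let $(\varepsilon_N)_{N\ge1}$ be positive reals with $\lim_{N\to\infty}\varepsilon_N=0$ and $\lim_{N\to\infty}N\varepsilon_N=\infty$. For each $N$ (large enough that $\varepsilon_N\max f\le1$), let $\mathbb{G}_N$ be the random simple graph on vertex set $\{1,\dots,N\}$ in which, for every pair $1\le i<j\le N$, the edge $\{i,j\}$ is present with probability $\varepsilon_N f(i/N,j/N)$, independently over pairs; $A_N$ is its adjacency matrix (symmetric, zero diagonal, $0/1$ entries). The Laplacian $\Delta_N$ is the $N\times N$ matrix with $\Delta_N(i,i)=-\sum_{k=1}^NA_N(i,k)$ and $\Delta_N(i,j)=A_N(i,j)$ for $i\ne j$. For a real symmetric $N\times N$ matrix $M$ with eigenvalues $\lambda_1,\dots,\lambda_N$ (with multiplicity), $\mathrm{ESD}(M)=\frac1N\sum_{i=1}^N\delta_{\lambda_i}$. Random probability measures $\eta_N$ converge weakly in probability to a deterministic $\eta$ if $\int g\,d\eta_N\to\int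 g\,d\eta$ in probability for every bounded continuous $g$. *)

(* Defs.v *)
From HB Require Import structures.
From mathcomp Require Import all_boot all_order all_algebra.
From mathcomp Require Import all_classical all_reals all_analysis.
Set Implicit Arguments. Unset Strict Implicit. Unset Printing Implicit Defensive.
Import Order.TTheory GRing.Theory Num.Theory.
Import numFieldNormedType.Exports.
Local Open Scope classical_set_scope.
Local Open Scope ring_scope.

Section RandomGraph.
Variable R : realType.

(* vertex i : 'I_N stands for the vertex i+1 of {1,...,N}; its position is (i+1)/N *)
Definition vpos (N : nat) (i : 'I_N) : R := (i.+1)%:R / N%:R.

Definition edge_prob (f : R -> R -> R) (eps : nat -> R) (N : nat) (i j : 'I_N) : R :=
  eps N * f (vpos i) (vpos j).

Definition upper (N : nat) : {set 'I_N * 'I_N} := [set ij : 'I_N * 'I_N | (nat_of_ord ij.1 < nat_of_ord ij.2)%N].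

(* A graph on {1..N} is encoded by its edge set E, a subset of [upper N].
   Law of G_N: independent edges, edge {i,j} present with prob eps_N f(i/N,j/N). *)
Definition graph_weight f eps (N : nat) (E : {set 'I_N * 'I_N}) : R :=
  if E \subset upper N then
    \prod_(ij in upper N)
       (if ij \in E then edge_prob f eps ij.1 ij.2 else 1 - edge_prob f eps ij.1 ij.2)
  else 0.

Definition gprob f eps (N : nat) (P : pred {set 'I_N * 'I_N}) : R :=
  \sum_(E | P E) graph_weight f eps E.

Definition gexpect f eps (N : nat) (X : {set 'I_N * 'I_N} -> R) : R :=
  \sum_E graph_weight f eps E * X E.

Definition adj (N : nat) (E : {set 'I_N * 'I_N}) : 'M[R]_N :=
  \matrix_(i, j) (if ((i, j) \in E) || ((j, i) \in E) then 1 else 0).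

Definition laplacian (N : nat) (E : {set 'I_N * 'I_N}) : 'M[R]_N :=
  \matrix_(i, j) (if i == j then - \sum_k adj E i k else adj E i j).

Definition Dmat f eps (N : nat) : 'M[R]_N :=
  \matrix_(i, j) (if i == j then gexpect f eps (fun E => laplacian E i i) else 0).

Definition scaled_centered f eps (N : nat) (E : {set 'I_N * 'I_N}) : 'M[R]_N :=
  (Num.sqrt (N%:R * eps N))^-1 *: (laplacian E - Dmat f eps N).

Definition is_eigseq (N : nat) (M : 'M[R]_N) (s : seq R) : Prop :=
  char_poly M = \prod_(x <- s) ('X - x%:P).

(* eigenvalues with multiplicity (exists for real symmetric matrices) *)
Definition eigs (N : nat) (M : 'M[R]_N) : seq R :=
  match pselect (exists s, is_eigseq M s) with
  | left h => projT1 (cid h)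
  | right _ => [::]
  end.

Definition esd_int (N : nat) (M : 'M[R]_N) (g : R -> R) : R :=
  N%:R^-1 * \sum_(x <- eigs M) g x.

Definition msupport (nu : probability R R) : set R :=
  [set x | forall e : R, 0 < e -> (0 < nu (ball x e))%E].

End RandomGraph.

(* Main.v *)
(** The graph is a product Bernoulli measure on sets of pairs, with expectation [bexp].
    Write X(e) for the centred edge indicators and s = sqrt(N eps N). Up to a matrix of
    vanishing normalised Frobenius norm, the scaled centred Laplacian is
    s^-1 * sum over ordered pairs (i, l) of X({i,l}) e_i (e_l - e_i)^T  ([lapmx]).

    Expanding the trace of its k-th power over walks and grouping the walks by their
    equality pattern turns the expected moments into Riemann sums of products of f. An
    edge used once contributes 0, so a pattern with v vertices and e edges has
    v <= e + 1 and 2 e <= k; the moments converge, the odd ones to 0, and counting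
    patterns shows that the 2J-th one is at most C^J (J+1)^J. Hence the expected
    integrals of cos (t x) and sin (t x) converge (to 0 for the sine), and the
    Efron-Stein inequality, with the fact that one edge is a rank-one perturbation,
    upgrades this to convergence in L^1. Weierstrass approximation by polynomials in
    sin (w x) and the bounded second moment give L^1 convergence for all bounded
    continuous functions; a Riesz representation argument yields nu, which is symmetric
    since the sines have limit 0.

    For the support: by Jensen's inequality the spectral integral of the convex
    function max (x - T) 0 dominates its average over the diagonal entries, and the
    exponential moments of these sums of independent variables bound that average away
    from 0 for every T. *)

Require Import Defs.
From HB Require Import structures.
From mathcomp Require Import all_boot all_order all_algebra.
From mathcomp Require Import all_classical all_reals all_analysis.
From mathcomp Require Import real_closed.complex.
From mathcomp Require Import ring lra zify finset.
Import Order.TTheory GRing.Theory Num.Theory.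
Import numFieldNormedType.Exports.
Set Implicit Arguments. Unset Strict Implicit. Unset Printing Implicit Defensive.
Local Open Scope ring_scope.

(** Moments determine the limit, but Efron-Stein needs a function whose spectral integral reacts
    little to one edge. Sines and cosines serve both ends: they have bounded derivatives, and their
    Taylor remainders are even monomials, whose limiting moments C^J (J+1)^J divided by (2J)! are at
    most C^J / J!.

    Writing the matrix as a sum over ordered pairs (i, l) treats diagonal and off-diagonal entries
    at once, so their dependence never has to be untangled. [Dmat] centres the diagonal only; the
    off-diagonal means are what has to be discarded, at a cost of order [eps N] in normalised
    Frobenius norm.

    Each walk pattern is weighted by N^(v-1) eps^e (N eps)^(-k/2) = N^(v-1-e) (N eps)^(e-k/2). Hence
    only v = e + 1, 2 e = k survives, and this is where N eps -> oo enters.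

    For the support, the exponential moment of order t of a diagonal entry is on average at least
    exp (c t^2) for some c > 0, whereas entries below T + 1 account for at most exp (t (T + 1)). A
    large t therefore forces a contribution from beyond T that does not vanish with N. *)

(** * Product Bernoulli measures and the Efron-Stein inequality *)

Section Bernoulli.
Variables (R : realFieldType) (T : finType) (q : T -> R).

Definition bweight (E : {set T}) : R :=
  \prod_t (if t \in E then q t else 1 - q t).

Definition bexp (F : {set T} -> R) : R := \sum_E bweight E * F E.

(** Independence: distributing the product of two-term sums yields one term per set [E]. *)
Lemma bexp_prod (g : T -> bool -> R) :
  bexp (fun E => \prod_t g t (t \in E)) =
  \prod_t (q t * g t true + (1 - q t) * g t false).
Proof.
rewrite bigA_distr; apply: eq_bigr => E _; rewrite -big_split /=.
by apply: eq_bigr => t _; case: ifP.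
Qed.

Lemma bexp_cst c : bexp (fun=> c) = c.
Proof.
rewrite /bexp -big_distrl /= -[RHS]mul1r; congr (_ * _).
transitivity (\prod_t (q t + (1 - q t))).
  by rewrite bigA_distr; apply: eq_bigr.
by apply: big1 => t _; ring.
Qed.

Lemma bexpD F G : bexp (fun E => F E + G E) = bexp F + bexp G.
Proof. by rewrite /bexp -big_split; apply: eq_bigr => E _; rewrite mulrDr. Qed.

Lemma bexpZ c F : bexp (fun E => c * F E) = c * bexp F.
Proof. by rewrite /bexp big_distrr /=; apply: eq_bigr => E _; rewrite mulrCA. Qed.

Lemma bexpN F : bexp (fun E => - F E) = - bexp F.
Proof. by rewrite /bexp -sumrN; apply: eq_bigr => E _; rewrite mulrN. Qed.

Lemma bexpB F G : bexp (fun E => F E - G E) = bexp F - bexp G.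
Proof. by rewrite bexpD bexpN. Qed.

Lemma bexp_sum (I : Type) (r : seq I) (P : pred I) (F : I -> {set T} -> R) :
  bexp (fun E => \sum_(i <- r | P i) F i E) = \sum_(i <- r | P i) bexp (F i).
Proof.
by rewrite /bexp exchange_big /=; apply: eq_bigr => E _; rewrite big_distrr.
Qed.

Lemma eq_bexp F G : F =1 G -> bexp F = bexp G.
Proof. by move=> FG; apply: eq_bigr => E _; rewrite FG. Qed.

(* [flip_avg t F] integrates the edge [t] out; Efron-Stein follows by removing the edges one by one. *)
Definition flip_avg (t : T) (F : {set T} -> R) (E : {set T}) : R :=
  q t * F (t |: E) + (1 - q t) * F (E :\ t).

(** Conditioning on all indicators except that of [t]: sets are paired as [E] and [t |: E], which
    share the remaining weight. *)
Lemma bexp_split (t : T) F : bexp F =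
  \sum_(E : {set T} | t \notin E)
    (\prod_(u | u != t) (if u \in E then q u else 1 - q u)) *
    (q t * F (t |: E) + (1 - q t) * F E).
Proof.
rewrite /bexp (bigID (fun E : {set T} => t \in E)) /=.
rewrite (reindex_onto (fun E => t |: E) (fun E => E :\ t)) /=; last first.
  by move=> E tE; rewrite setD1K.
rewrite [X in X + _](eq_bigl (fun E : {set T} => t \notin E)); last first.
  move=> E; rewrite setU11 /=; apply/eqP/idP => [<-|tE]; first by rewrite !inE eqxx.
  by rewrite setU1K.
rewrite -big_split /=; apply: eq_bigr => E tE.
rewrite /bweight (bigD1 t) //= setU11 [in X in _ + X](bigD1 t) //= (negbTE tE).
have -> : \prod_(i | i != t) (if i \in t |: E then q i else 1 - q i) =
          \prod_(i | i != t) (if i \in E then q i else 1 - q i).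
  by apply: eq_bigr => u ut; rewrite in_setU1 (negbTE ut).
ring.
Qed.

Lemma flip_avgU t F E : flip_avg t F (t |: E) = flip_avg t F E.
Proof.
rewrite /flip_avg setUA setUid; congr (_ + _ * F _).
by apply/setP => u; rewrite !inE; case: (u == t).
Qed.

Lemma bexp_flip_avg t F : bexp (flip_avg t F) = bexp F.
Proof.
rewrite !(bexp_split t); apply: eq_bigr => E tE; congr (_ * _).
rewrite flip_avgU /flip_avg (_ : E :\ t = E); first by ring.
by apply/setDidPl; rewrite disjoint_sym disjoints1.
Qed.

Hypothesis q01 : forall t, 0 <= q t <= 1.

Lemma bweight_ge0 E : 0 <= bweight E.
Proof.
by apply: prodr_ge0 => t _; have /andP[q0 q1] := q01 t; case: ifP; rewrite ?subr_ge0.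
Qed.

Lemma ler_bexp F G : (forall E, F E <= G E) -> bexp F <= bexp G.
Proof. by move=> FG; apply: ler_sum => E _; rewrite ler_wpM2l ?bweight_ge0. Qed.

Lemma bexp_ge0 F : (forall E, 0 <= F E) -> 0 <= bexp F.
Proof. by move=> F0; rewrite -(bexp_cst 0); exact: ler_bexp. Qed.

Lemma ler_norm_bexp F : `|bexp F| <= bexp (fun E => `|F E|).
Proof.
rewrite ler_norml -bexpN; apply/andP; split; apply: ler_bexp => E.
  by rewrite lerNl -normrN ler_norm.
exact: ler_norm.
Qed.

(** The left side is the mean conditional variance, and a two-point variable has variance q (1 - q)
    (a - b)^2. The factor [q t] is kept, because it is small for sparse graphs. *)
Lemma flip_avg_sqr t F d : (forall E, `|F (t |: E) - F (E :\ t)| <= d) ->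
  bexp (fun E => F E ^+ 2) - bexp (fun E => flip_avg t F E ^+ 2) <= q t * d ^+ 2.
Proof.
move=> Fd; have /andP[q0 q1] := q01 t.
rewrite -(bexp_flip_avg t (fun E => F E ^+ 2)) -bexpB -[leRHS]bexp_cst.
apply: ler_bexp => E; rewrite /flip_avg.
set a := F (t |: E); set b := F (E :\ t).
have -> : q t * a ^+ 2 + (1 - q t) * b ^+ 2 - (q t * a + (1 - q t) * b) ^+ 2 =
  q t * ((1 - q t) * (a - b) ^+ 2) by ring.
rewrite ler_wpM2l // -[leRHS]mul1r.
have ab : (a - b) ^+ 2 <= d ^+ 2.
  by rewrite -real_normK ?num_real // ler_pXn2r ?nnegrE // (le_trans _ (Fd E)).
by rewrite (le_trans (ler_wpM2l _ ab)) ?subr_ge0 // ler_wpM2r ?sqr_ge0 // gerBl.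
Qed.

Lemma flip_avg_diff s t F (d : R) :
  (forall E, `|F (s |: E) - F (E :\ s)| <= d) -> s != t ->
  forall E, `|flip_avg t F (s |: E) - flip_avg t F (E :\ s)| <= d.
Proof.
move=> Fd st E; have /andP[q0 q1] := q01 t.
rewrite /flip_avg setUCA.
have -> : (s |: E) :\ t = s |: (E :\ t).
  by apply/setP => u; rewrite !inE; case: eqVneq => [->|]; rewrite // eq_sym (negbTE st).
have -> : t |: (E :\ s) = (t |: E) :\ s.
  by apply/setP => u; rewrite !inE; case: eqVneq => [->|]; rewrite // eq_sym (negbTE st).
have -> : E :\ s :\ t = E :\ t :\ s by rewrite !setDDl setUC.
set a := F _; set b := F _; set a' := F _; set b' := F _.
have -> : q t * a + (1 - q t) * b - (q t * a' + (1 - q t) * b') =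
   q t * (a - a') + (1 - q t) * (b - b') by ring.
rewrite (le_trans (ler_normD _ _)) // !normrM (ger0_norm q0).
rewrite (@ger0_norm _ (1 - q t)) ?subr_ge0 //.
have -> : d = q t * d + (1 - q t) * d by ring.
by rewrite lerD // ler_wpM2l ?subr_ge0 ?Fd.
Qed.

Lemma flip_avg_diff0 t F E :
  flip_avg t F (t |: E) - flip_avg t F (E :\ t) = 0.
Proof.
rewrite flip_avgU /flip_avg (_ : E :\ t :\ t = E :\ t).
  rewrite (_ : t |: (E :\ t) = t |: E) ?subrr //.
  by apply/setP => u; rewrite !inE; case: (u == t).
by rewrite setDDl setUid.
Qed.

Lemma bexp_var F (d : T -> R) :
  (forall t E, `|F (t |: E) - F (E :\ t)| <= d t) ->
  bexp (fun E => (F E - bexp F) ^+ 2) <= \sum_t q t * d t ^+ 2.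
Proof.
move=> Fd.
have -> : bexp (fun E => (F E - bexp F) ^+ 2) = bexp (fun E => F E ^+ 2) - bexp F ^+ 2.
  have -> : bexp (fun E => (F E - bexp F) ^+ 2) =
    bexp (fun E => F E ^+ 2 + ((- 2 * bexp F) * F E + bexp F ^+ 2)).
    by apply: eq_bexp => E; ring.
  by rewrite !bexpD bexpZ bexp_cst; ring.
(* The list [s] holds the coordinates on which [G] may still depend; averaging one of them out
   shortens [s] and preserves the bounds for the others. *)
suff H (s : seq T) : forall G : {set T} -> R, uniq s ->
    (forall t E, t \in s -> `|G (t |: E) - G (E :\ t)| <= d t) ->
    (forall t E, t \notin s -> G (t |: E) - G (E :\ t) = 0) ->
    bexp (fun E => G E ^+ 2) - bexp G ^+ 2 <= \sum_(t <- s) q t * d t ^+ 2.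
  rewrite -[X in _ <= X]big_enum /=; apply: H => //; first exact: enum_uniq.
  by move=> t E; rewrite mem_enum.
elim: s => [|t s IH] G /=.
  move=> _ _ G0; rewrite big_nil.
  (* With no coordinate left, [G] is constant and has variance 0. *)
  have Gc E : G E = G set0.
    have [n] := ubnP #|E|; elim: n E => // n IHn E.
    have [->//|[t tE]] := set_0Vmem E; rewrite ltnS (cardsD1 t) tE => En.
    have /eqP := G0 t E isT; rewrite subr_eq0 (_ : t |: E = E).
      by move=> /eqP ->; apply: IHn.
    by apply/setUidPr; rewrite sub1set.
  have -> : bexp (fun E => G E ^+ 2) = G set0 ^+ 2.
    by rewrite -(bexp_cst (G set0 ^+ 2)); apply: eq_bexp => E; rewrite Gc.
  have -> : bexp G = G set0.
    by rewrite -(bexp_cst (G set0)); apply: eq_bexp => E; rewrite Gc.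
  by rewrite subrr.
move=> /andP[ts us] Gd G0; rewrite big_cons.
have -> : bexp (fun E => G E ^+ 2) - bexp G ^+ 2 =
  (bexp (fun E => G E ^+ 2) - bexp (fun E => flip_avg t G E ^+ 2)) +
  (bexp (fun E => flip_avg t G E ^+ 2) - bexp (flip_avg t G) ^+ 2).
  rewrite bexp_flip_avg; ring.
apply: lerD.
  by apply: flip_avg_sqr => E; apply: Gd; rewrite mem_head.
apply: IH => // u E us'.
  apply: flip_avg_diff; last by apply: contraNneq ts => <-.
  by move=> E'; apply: Gd; rewrite in_cons us' orbT.
have [->|ut] := eqVneq u t; first exact: flip_avg_diff0.
apply/eqP; rewrite -normr_le0; apply: flip_avg_diff => // E'.
by rewrite G0 ?normr0 // in_cons negb_or ut.
Qed.

End Bernoulli.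

(** * Equality patterns of walks *)

Section Patterns.
Variable k : nat.

(* A closed walk of length k is encoded by k ordered pairs: the slot [(t, false)] is the
   row index and [(t, true)] the column index [l] of the t-th factor e_i (e_l - e_i)^T. *)
Definition slot := ('I_k * bool)%type.
Implicit Types (a b : slot) (t : 'I_k) (r : {ffun slot -> slot}).

(** The order in which the walk visits the slots: factor by factor, row slot before column slot. The
    representative of a vertex is thus the slot of its first visit. *)
Definition key a : nat := (a.1.*2 + a.2)%N.

Lemma key_inj : injective key.
Proof.
move=> [[t Ht] x] [[u Hu] y]; rewrite /key /= => e.
have -> : x = y by move: x y e => [] [] //=; lia.
by congr (_, _); apply/val_inj => /=; move: x y e => [] [] /=; lia.
Qed.

(* The equality pattern of [x], encoded by sending each slot to the first slot with the same value. *)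
Definition pat (V : eqType) (x : slot -> V) : {ffun slot -> slot} :=
  [ffun a => [arg min_(b < a | x b == x a) key b]].

Section Pat.
Variables (V : eqType) (x : slot -> V).

Lemma pat_val a : x (pat x a) = x a.
Proof. by rewrite ffunE; case: arg_minnP => // b /eqP. Qed.

Lemma pat_min a b : x b = x a -> (key (pat x a) <= key b)%N.
Proof. by rewrite ffunE; case: arg_minnP => // c _ H /eqP; exact: H. Qed.

Lemma pat_le a : (key (pat x a) <= key a)%N. Proof. exact: pat_min. Qed.

Lemma eq_pat a b : (pat x a == pat x b) = (x a == x b).
Proof.
apply/eqP/eqP => [e|e]; first by rewrite -pat_val e pat_val.
by apply/key_inj/eqP; rewrite eqn_leq !pat_min ?pat_val.
Qed.

Lemma pat_idem a : pat x (pat x a) = pat x a.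
Proof. by apply/eqP; rewrite eq_pat pat_val. Qed.

End Pat.

Lemma pat_eqfun (V W : eqType) (x : slot -> V) (y : slot -> W) :
  (forall a b, (x a == x b) = (y a == y b)) -> pat x = pat y.
Proof.
move=> e; apply/ffunP => a; apply/key_inj/eqP.
rewrite eqn_leq; apply/andP; split; apply: pat_min; apply/eqP.
  by rewrite e pat_val.
by rewrite -e pat_val.
Qed.

Lemma pat_pat (V : eqType) (x : slot -> V) : pat (pat x) = pat x.
Proof. by apply: pat_eqfun => a b; rewrite eq_pat. Qed.

Definition reps r := [set a | r a == a].

Definition inj_on_reps r (V : eqType) (y : slot -> V) :=
  [forall a, forall b, (y (r a) == y (r b)) ==> (r a == r b)].

Lemma pat_comp r (V : eqType) (y : slot -> V) : pat r = r ->
  inj_on_reps r y -> pat (fun a => y (r a)) = r.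
Proof.
move=> rE /forallP yi; rewrite -[RHS]rE; apply: pat_eqfun => a b.
apply/idP/idP => [|/eqP -> //]; exact: (implyP (forallP (yi a) b)).
Qed.

(** A tuple of pattern [r] is fixed by its values on the representatives, so every other coordinate
    of [y] is free; this accounts for the power of [N]. All patterns then become sums over the same
    index set, ready for Riemann sums. *)
Lemma sum_pat (R : comNzRingType) (N : nat) r (G : {ffun slot -> 'I_N} -> R) :
  pat r = r ->
  N%:R ^+ #|~: reps r| * (\sum_(x : {ffun slot -> 'I_N} | pat x == r) G x) =
  \sum_(y : {ffun slot -> 'I_N} | inj_on_reps r y) G [ffun a => y (r a)].
Proof.
move=> rE.
rewrite [RHS](partition_big (fun y : {ffun slot -> 'I_N} => [ffun a => y (r a)])
  (fun x : {ffun slot -> 'I_N} => pat x == r)) /=; last first.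
  move=> y yi; rewrite (@pat_eqfun _ _ _ (fun a => y (r a))).
    by rewrite pat_comp.
  by move=> a b; rewrite !ffunE.
rewrite big_distrr; apply: eq_bigr => x /eqP xr.
transitivity (\sum_(i : {ffun slot -> 'I_N} | inj_on_reps r i && ([ffun a => i (r a)] == x)) G x).
  rewrite sumr_const -[RHS]mulr_natl; congr (_ * _).
  (* The fibre over [x] is a product: forced on representatives, arbitrary elsewhere. *)
  pose F a := if a \in reps r then pred1 (x a) else predT.
  rewrite -natrX; congr (_%:R).
  transitivity #|family F|.
    rewrite card_family foldrE big_map big_enum /=.
    rewrite (bigID (fun a => a \in reps r)) /= big1 ?mul1n; last first.
      by move=> a ar; rewrite /F ar card1.
    rewrite (eq_bigr (fun=> N)) => [|a /negbTE ar]; last by rewrite /F ar card_ord.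
    rewrite prod_nat_const; congr expn; apply: eq_card => a.
    exact: in_setC.
  apply: eq_card => y; rewrite !unfold_in; apply/familyP/andP => [yF|[yi /eqP yx] a].
    have yr a : y (r a) = x (r a).
      have := pat_idem r a; rewrite rE => rr.
      by have := yF (r a); rewrite /F !inE rr eqxx => /eqP.
    have yx a : y (r a) = x a by rewrite yr -xr pat_val.
    split; last by apply/eqP/ffunP => a; rewrite ffunE.
    apply/forallP => a; apply/forallP => b; apply/implyP.
    by rewrite !yx -xr eq_pat.
  rewrite /F inE; case: ifP => // /eqP ra.
  by rewrite inE -yx ffunE ra.
by apply: eq_bigr => y /andP[_ /eqP ->].
Qed.

End Patterns.

(** * Traces of powers as sums over closed walks *)

Section TracePower.
Variables (R : comNzRingType) (N : nat).

Lemma mx_pow_sum (M : 'M[R]_N) n i j : (M ^+ n) i j =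
  \sum_(a : {ffun 'I_n.+1 -> 'I_N} | (a ord0 == i) && (a ord_max == j))
    \prod_(t < n) M (a (widen_ord (leqnSn n) t)) (a (lift ord0 t)).
Proof.
elim: n i => [|n IH] i.
  rewrite expr0 mxE; under eq_bigr do rewrite big_ord0.
  have -> : @ord_max 0 = ord0 by apply/val_inj.
  have [<-|ij] := eqVneq i j.
    rewrite (big_pred1 [ffun=> i]) // => a; rewrite andbb.
    apply/eqP/eqP => [ai|->]; last by rewrite ffunE.
    by apply/ffunP => t; rewrite ffunE ord1.
  by rewrite big1 // => a /andP[/eqP -> /eqP]; move/eqP: ij.
rewrite exprS mxE.
pose cons_ffun (p : 'I_N * {ffun 'I_n.+1 -> 'I_N}) : {ffun 'I_n.+2 -> 'I_N} :=
  [ffun t => if unlift ord0 t is Some u then p.2 u else p.1].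
pose uncons_ffun (a : {ffun 'I_n.+2 -> 'I_N}) := (a ord0, [ffun t => a (lift ord0 t)]).
have consK : cancel cons_ffun uncons_ffun.
  move=> [c b]; rewrite /uncons_ffun /cons_ffun ffunE unlift_none; congr (_, _).
  by apply/ffunP => t; rewrite !ffunE liftK.
have unconsK : cancel uncons_ffun cons_ffun.
  move=> a; apply/ffunP => t; rewrite ffunE.
  by case: unliftP => [u ->|->] //=; rewrite ffunE.
rewrite (reindex cons_ffun) /=; last by exists uncons_ffun => ? _.
transitivity (\sum_(p : 'I_N * {ffun 'I_n.+1 -> 'I_N} | (p.1 == i) && (p.2 ord_max == j))
    M i (p.2 ord0) * \prod_(t < n) M (p.2 (widen_ord (leqnSn n) t)) (p.2 (lift ord0 t))).
  rewrite -(pair_big_dep (pred1 i) (fun _ (b : {ffun 'I_n.+1 -> 'I_N}) => b ord_max == j)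
    (fun _ b => M i (b ord0) * \prod_(t < n) M (b (widen_ord (leqnSn n) t)) (b (lift ord0 t)))).
  rewrite big_pred1_eq (partition_big (fun b : {ffun 'I_n.+1 -> 'I_N} => b ord0) predT) //=.
  apply: eq_bigr => c _; rewrite IH big_distrr /=.
  by under eq_bigl do rewrite andbC; apply: eq_bigr => b /andP[_ /eqP ->].
apply: eq_big => [[c b]|[c b] /andP[/= /eqP -> _]] /=.
  rewrite !ffunE unlift_none /=.
  have -> : @ord_max n.+1 = lift ord0 ord_max by apply/val_inj.
  by rewrite liftK.
rewrite big_ord_recl; congr (_ * _).
  rewrite !ffunE liftK /=.
  have -> : widen_ord (leqnSn n.+1) ord0 = ord0 by apply/val_inj.
  by rewrite unlift_none.
apply: eq_bigr => t _; rewrite !ffunE liftK.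
have -> : widen_ord (leqnSn n.+1) (lift ord0 t) = lift ord0 (widen_ord (leqnSn n) t).
  by apply/val_inj.
by rewrite liftK.
Qed.

(** [ordS] is the cyclic successor, so the last factor returns to the starting vertex. *)
Lemma mxtrace_pow (M : 'M[R]_N) n : \tr (M ^+ n.+1) =
  \sum_(a : {ffun 'I_n.+1 -> 'I_N}) \prod_(t < n.+1) M (a t) (a (ordS t)).
Proof.
rewrite /mxtrace.
transitivity (\sum_i \sum_j (M ^+ n) i j * M j i).
  by apply: eq_bigr => i _; rewrite exprSr mxE.
rewrite pair_big /=.
rewrite [RHS](partition_big (fun a : {ffun 'I_n.+1 -> 'I_N} => (a ord0, a ord_max)) predT) //=.
apply: eq_bigr => [[i j]] _ /=; rewrite mx_pow_sum big_distrl /=.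
apply: eq_big => [a|a /andP[/eqP <- /eqP <-]]; first by rewrite xpair_eqE.
rewrite big_ord_recr /=; congr (_ * _).
  apply: eq_bigr => t _; congr (M _ (a _)); apply/val_inj => /=.
  by rewrite /bump /= modn_small // ltnS ltn_ord.
by congr (M _ (a _)); apply/val_inj; rewrite /= modnn.
Qed.

End TracePower.

(** * Expected traces, edge by edge *)

Section EdgeWalks.
Variables (R : realFieldType) (n N : nat).
Local Notation k := n.+1.
Local Notation slot := (slot k).
Implicit Types (t u : 'I_k) (r : {ffun slot -> slot}).

(** Stated through equalities alone, so that it depends only on the pattern and can be applied to
    [r] itself. *)
Definition same_edge (V : eqType) (x : slot -> V) t u :=
  ((x (t, false) == x (u, false)) && (x (t, true) == x (u, true))) ||
  ((x (t, false) == x (u, true)) && (x (t, true) == x (u, false))).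

Definition first_edges (V : eqType) (x : slot -> V) :=
  [set t : 'I_k | [forall u : 'I_k, (u < t)%N ==> ~~ same_edge x u t]].

Definition mult (V : eqType) (x : slot -> V) t := #|[set u : 'I_k | same_edge x u t]|.

(** The entry of (e_l - e_i)^T at the row index of the next factor. *)
Definition link (V : eqType) (x : slot -> V) t : R :=
  (x (t, true) == x (ordS t, false))%:R - (x (t, false) == x (ordS t, false))%:R.

Definition links (V : eqType) (x : slot -> V) : R := \prod_t link x t.

Lemma same_edge_eq (V W : eqType) (x : slot -> V) (y : slot -> W) :
  (forall a b, (x a == x b) = (y a == y b)) -> same_edge x =2 same_edge y.
Proof. by move=> e t u; rewrite /same_edge !e. Qed.

Lemma first_edges_eq (V W : eqType) (x : slot -> V) (y : slot -> W) :
  (forall a b, (x a == x b) = (y a == y b)) -> first_edges x = first_edges y.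
Proof.
move=> e; apply/setP => t; rewrite !inE; apply: eq_forallb => u.
by rewrite (same_edge_eq e).
Qed.

Lemma mult_eq (V W : eqType) (x : slot -> V) (y : slot -> W) :
  (forall a b, (x a == x b) = (y a == y b)) -> mult x =1 mult y.
Proof.
by move=> e t; apply: eq_card => u; rewrite !inE (same_edge_eq e).
Qed.

Lemma links_eq (V W : eqType) (x : slot -> V) (y : slot -> W) :
  (forall a b, (x a == x b) = (y a == y b)) -> links x = links y.
Proof. by move=> e; apply: eq_bigr => t _; rewrite /link !e. Qed.

(** Smaller end first, as in [upper]; a loop becomes (i, i), which lies outside [upper]. *)
Definition ed (i l : 'I_N) : 'I_N * 'I_N := if (i < l)%N then (i, l) else (l, i).

Lemma edC i l : ed i l = ed l i.
Proof. by rewrite /ed; case: ltngtP => // /val_inj ->. Qed.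

Lemma same_edgeE (x : slot -> 'I_N) t u : same_edge x t u =
  (ed (x (t, false)) (x (t, true)) == ed (x (u, false)) (x (u, true))).
Proof.
rewrite /same_edge; move: (x _) (x _) (x _) (x _) => a b c d.
rewrite /ed; case: ltnP => ab; case: ltnP => cd; rewrite xpair_eqE -!val_eqE /= ; lia.
Qed.

(* The m-th moment of a centred Bernoulli(q) variable. *)
Definition bmoment (q : R) (m : nat) : R := q * (1 - q) ^+ m + (1 - q) * (- q) ^+ m.

Variable q : 'I_N * 'I_N -> R.

Lemma bexp_edges (x : slot -> 'I_N) :
  bexp q (fun E => \prod_t
    let u := ed (x (t, false)) (x (t, true)) in ((u \in E)%:R - q u)) =
  \prod_(t in first_edges x) bmoment (q (ed (x (t, false)) (x (t, true)))) (mult x t).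
Proof.
pose e t := ed (x (t, false)) (x (t, true)).
transitivity (bexp q (fun E => \prod_w
    (((w \in E)%:R - q w) ^+ #|[set t : 'I_k | e t == w]|))).
  apply: eq_bexp => E; rewrite (partition_big e predT) //=; apply: eq_bigr => u _.
  rewrite -prodr_const; apply: eq_big => [t|t /eqP <- //]; by rewrite inE.
rewrite (bexp_prod q (fun w b => (b%:R - q w) ^+ #|[set t : 'I_k | e t == w]|)).
(* Edges off the walk occur with exponent 0 and contribute 1; each edge of the walk is named once,
   by the time of its first use. *)
rewrite (bigID (fun w => w \in e @: first_edges x)) /= [X in _ * X]big1 ?mulr1.
  rewrite big_imset => [|t u /= tf uf etu].
    apply: eq_bigr => t _; rewrite /bmoment sub0r.
    suff -> : #|[set u | e u == e t]| = mult x t by [].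
    by apply: eq_card => u; rewrite !inE same_edgeE.
  have firstP (v w : 'I_k) : v \in first_edges x -> e w = e v -> (v <= w)%N.
    rewrite inE => /forallP/(_ w)/implyP H wv; rewrite leqNgt; apply/negP => /H.
    by rewrite same_edgeE -/(e w) -/(e v) wv eqxx.
  by apply/val_inj/anti_leq; rewrite !firstP.
move=> u /imsetP uf; have -> : [set t | e t == u] = set0.
  apply/setP => t; rewrite !inE; apply/eqP => tu; apply: uf.
  case: (arg_minnP (fun t' => val t') (P := fun t' => e t' == u) (i0 := t)) => [|t' /eqP t'u H].
    exact/eqP.
  exists t' => //; rewrite inE; apply/forallP => s; apply/implyP => st.
  rewrite same_edgeE -/(e s) -/(e t') t'u; apply/negP => su.
  by have := H _ su; rewrite leqNgt st.
by rewrite cards0 !expr0; ring.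
Qed.

Variable s : R.

Definition lapmx (E : {set 'I_N * 'I_N}) : 'M[R]_N :=
  \matrix_(i, j) (s^-1 * \sum_l
     ((ed i l \in E)%:R - q (ed i l)) * ((l == j)%:R - (i == j)%:R)).

Lemma tr_lapmx E : \tr (lapmx E ^+ k) = s^-1 ^+ k *
  \sum_(x : {ffun slot -> 'I_N}) links x *
     \prod_t let u := ed (x (t, false)) (x (t, true)) in ((u \in E)%:R - q u).
Proof.
rewrite mxtrace_pow.
under eq_bigr => a _ do under eq_bigr => t _ do rewrite mxE.
under eq_bigr => a _ do rewrite big_split /= prodr_const card_ord bigA_distr_bigA /=.
rewrite -big_distrr /= pair_big /=; congr (_ * _).
pose fst_ffun (x : {ffun slot -> 'I_N}) : {ffun 'I_k -> 'I_N} := [ffun t => x (t, false)].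
pose snd_ffun (x : {ffun slot -> 'I_N}) : {ffun 'I_k -> 'I_N} := [ffun t => x (t, true)].
rewrite (reindex (fun x => (fst_ffun x, snd_ffun x))) /=.
  apply: eq_bigr => x _; rewrite /links -big_split; apply: eq_bigr => t _ /=.
  by rewrite /link !ffunE mulrC.
exists (fun p : {ffun 'I_k -> 'I_N} * {ffun 'I_k -> 'I_N} => [ffun a : slot => if a.2 then p.2 a.1 else p.1 a.1]) => [x _|[a l] _].
  by apply/ffunP => [[t []]]; rewrite !ffunE.
by congr (_, _); apply/ffunP => t; rewrite !ffunE.
Qed.

Lemma bexp_tr_lapmx : bexp q (fun E => \tr (lapmx E ^+ k)) = s^-1 ^+ k *
  \sum_(x : {ffun slot -> 'I_N}) links x *
    \prod_(t in first_edges x) bmoment (q (ed (x (t, false)) (x (t, true)))) (mult x t).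
Proof.
rewrite (eq_bexp _ (tr_lapmx)) bexpZ bexp_sum; congr (_ * _).
by apply: eq_bigr => x _; rewrite bexpZ bexp_edges.
Qed.

Definition pattern_sum r : R :=
  \sum_(y : {ffun slot -> 'I_N} | inj_on_reps r y)
   \prod_(t in first_edges r)
     bmoment (q (ed (y (r (t, false))) (y (r (t, true))))) (mult r t).

Lemma bexp_tr_pattern : bexp q (fun E => \tr (lapmx E ^+ k)) = s^-1 ^+ k *
  \sum_(r : {ffun slot -> slot} | pat r == r) links r *
   (\sum_(x : {ffun slot -> 'I_N} | pat x == r) \prod_(t in first_edges r)
       bmoment (q (ed (x (t, false)) (x (t, true)))) (mult r t)).
Proof.
rewrite bexp_tr_lapmx; congr (_ * _).
rewrite (partition_big (fun x : {ffun slot -> 'I_N} => pat x) (fun r : {ffun slot -> slot} => pat r == r)) /=.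
  apply: eq_bigr => r _; rewrite big_distrr; apply: eq_bigr => x /eqP xr.
  have e a b : (x a == x b) = (r a == r b) by rewrite -xr eq_pat.
  rewrite (links_eq e) (first_edges_eq e); congr (_ * _).
  by apply: eq_bigr => t _; rewrite (mult_eq e).
by move=> x _; rewrite pat_pat.
Qed.

Lemma pattern_sumE r : pat r = r ->
  N%:R ^+ #|~: reps r| *
   (\sum_(x : {ffun slot -> 'I_N} | pat x == r) \prod_(t in first_edges r)
       bmoment (q (ed (x (t, false)) (x (t, true)))) (mult r t)) = pattern_sum r.
Proof.
move=> rE; rewrite (sum_pat _ rE); apply: eq_bigr => y _.
by apply: eq_bigr => t _; rewrite !ffunE.
Qed.

End EdgeWalks.

(** * Bounds on vertices, edges and the number of patterns *)

Section PatternCounting.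
Variables (R : realFieldType) (n : nat).
Local Notation k := n.+1.
Local Notation slot := (slot k).
Implicit Types (t u : 'I_k) (r : {ffun slot -> slot}).

(* If all links are nonzero, a vertex can only be discovered at a column slot; [news] are
   the times of discovery. *)
Definition news r := [set t : 'I_k | r (t, true) == (t, true)].

Lemma first_edges_le (V : eqType) (x : slot -> V) t u :
  t \in first_edges x -> same_edge x u t -> (t <= u)%N.
Proof.
rewrite inE => /forallP/(_ u)/implyP H ut.
by rewrite leqNgt; apply/negP => /H; rewrite ut.
Qed.

Section OnePattern.
Variable r : {ffun slot -> slot}.
Hypothesis rE : pat r = r.

Lemma pattern_idem a : r (r a) = r a.
Proof. by have := pat_idem r a; rewrite rE. Qed.

Lemma pattern_le a : (key (r a) <= key a)%N.
Proof. by have := pat_le r a; rewrite rE. Qed.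

Lemma pattern0 : r (ord0, false) = (ord0, false).
Proof. by apply/key_inj/eqP; rewrite eqn_leq pattern_le /key. Qed.

(** An edge used before has shown both its ends already, so a discovery uses a new edge. With
    [card_reps] this gives v <= e + 1. *)
Lemma news_first_edges : news r \subset first_edges r.
Proof.
apply/fintype.subsetP => t; rewrite !inE => /eqP rt.
apply/forallP => u; apply/implyP => ut; apply/negP => /orP[] /andP[/eqP e1 /eqP e2].
  have := pattern_le (u, true); rewrite e2 rt /key /=; lia.
have := pattern_le (u, false); rewrite e1 rt /key /=; lia.
Qed.

Lemma same_edge_sym (V : eqType) (x : slot -> V) t u :
  same_edge x t u -> same_edge x u t.
Proof.
by rewrite /same_edge => /orP[] /andP[/eqP -> /eqP ->]; rewrite !eqxx ?orbT.
Qed.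

Lemma same_edge_trans (V : eqType) (x : slot -> V) t u w :
  same_edge x t u -> same_edge x u w -> same_edge x t w.
Proof.
rewrite /same_edge => /orP[] /andP[/eqP -> /eqP ->] //.
by rewrite orbC [X in X || _]andbC [X in _ || X]andbC.
Qed.

(** Double counting: each time repeats at most one first edge, and every first edge is used at least
    twice. *)
Lemma card_first_edges : (forall t, t \in first_edges r -> 1 < mult r t)%N ->
  (#|first_edges r|.*2 <= k)%N.
Proof.
move=> m2.
have : (\sum_(t in first_edges r) mult r t <= k)%N.
  have -> : (\sum_(t in first_edges r) mult r t =
     \sum_(t in first_edges r) \sum_(u | same_edge r u t) 1)%N.
    by apply: eq_bigr => t _; rewrite sum1_card /mult cardsE.
  rewrite (exchange_big_dep predT) //= -[X in (_ <= X)%N]card_ord -sum1_card.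
  apply: leq_sum => u _; rewrite sum1_card.
  apply/card_le1_eqP => t w.
  rewrite -!topredE /= => /andP[tf ut] /andP[wf uw].
  have tw : same_edge r t w by apply: same_edge_trans uw; exact: same_edge_sym.
  apply/val_inj/anti_leq.
  by rewrite !(first_edges_le (x := r)) //; exact: same_edge_sym.
apply: leq_trans; rewrite -muln2 -sum_nat_const.
by apply: leq_sum => t; exact: m2.
Qed.

Hypothesis rl : links R r != 0.

(** A nonzero link means that the next row vertex is exactly one of the two ends of the current
    edge, so one bit per time recovers the row slots. *)
Lemma pattern_link t : r (ordS t, false) =
  if r (ordS t, false) == r (t, true) then r (t, true) else r (t, false).
Proof.
case: eqP => [//|/eqP ne].
have : link R r t != 0.
  by apply: contraNneq rl => l0; rewrite /links (bigD1 t) //= l0 mul0r.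
rewrite /link [r (t, true) == _]eq_sym (negbTE ne).
by case: (r (t, false) =P r (ordS t, false)) => [->|_] //; rewrite subrr eqxx.
Qed.

(** By [pattern_link], every row slot after the first repeats an earlier slot and cannot be a
    representative. *)
Lemma reps_news : reps r = (ord0, false) |: [set (t, true) | t in news r].
Proof.
  apply/setP => [[t b]]; rewrite !inE; apply/eqP/orP => [rt|[/eqP ->|]].
  - case: b rt => rt.
      by right; apply/imsetP; exists t => //; rewrite inE rt.
    left; case: t rt => [[|t] Ht] rt; first by apply/eqP; congr (_, _); apply/val_inj.
    have Ht' : (t < k)%N by lia.
    have tS : Ordinal Ht = ordS (Ordinal Ht').
      by apply/val_inj; rewrite /= modn_small.
    have := pattern_link (Ordinal Ht'); rewrite -tS rt.
    case: ifP => _ e; have := f_equal (@key _) e.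
      have := pattern_le (Ordinal Ht', true); rewrite /key /=; lia.
    have := pattern_le (Ordinal Ht', false); rewrite /key /=; lia.
  - exact: pattern0.
  - by move=> /imsetP[u]; rewrite inE => /eqP ru [-> ->].
Qed.

Lemma card_reps : #|reps r| = #|news r|.+1.
Proof.
rewrite reps_news cardsU1 card_imset ?add1n //; last by move=> t u [].
by case: imsetP => // [[u _]].
Qed.

End OnePattern.

(** With [K] half of [k], this contains every pattern that survives in the limit, since those have v
    = e + 1 and 2 e = k. *)
Definition cyclic_patterns (K : nat) :=
  [set r : {ffun slot -> slot} | [&& pat r == r, links R r != 0 & #|news r| == K]].

(* Such a pattern is determined by the set [news], the bits selecting which end of an edge
   the walk continues from, and the K.+1 possible values at each of the other times. *)
Lemma card_cyclic_patterns K : k = K.*2 ->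
  (#|cyclic_patterns K| <= 2 ^ k * (2 ^ k * K.+1 ^ K))%N.
Proof.
move=> kK; pose pats A := [set r in cyclic_patterns K | news r == A].
have -> : #|cyclic_patterns K| = (\sum_(A : {set 'I_k}) #|pats A|)%N.
  rewrite -sum1_card (partition_big news predT) //=.
  by apply: eq_bigr => A _; rewrite -sum1_card; apply: eq_bigl => r; rewrite !inE.
apply: (@leq_trans (\sum_(A : {set 'I_k}) 2 ^ k * K.+1 ^ K)%N); last first.
  by rewrite sum_nat_const -cardsT -powersetT card_powerset cardsT card_ord.
apply: leq_sum => A _.
have [AK|AK] := eqVneq #|A| K; last first.
  rewrite (_ : pats A = set0) ?cards0 //; apply/setP => r; rewrite !inE.
  by apply/negP => /andP[/and3P[_ _ /eqP rK] /eqP rA]; rewrite -rA rK eqxx in AK.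
pose old := (ord0, false) |: [set (t, true) | t in A].
pose F (t : 'I_k) := if t \in A then [set (t, true)] else old.
pose code (r : {ffun slot -> slot}) : {ffun 'I_k -> bool} * {ffun 'I_k -> slot} :=
  ([ffun t => r (ordS t, false) == r (t, true)], [ffun t => r (t, true)]).
have oldK : #|old| = K.+1.
  rewrite cardsU1 card_imset ?AK; last by move=> t u [].
  by case: imsetP => // [[u _]].
have cardF : #|family F| = (K.+1 ^ K)%N.
  rewrite card_family foldrE big_map big_enum /= (bigID (fun t => t \in A)) /=.
  rewrite big1 ?mul1n => [|t tA]; last by rewrite /F tA cards1.
  rewrite (eq_bigr (fun=> K.+1)) => [|t /negbTE tA]; last by rewrite /F tA oldK.
  rewrite prod_nat_const; congr expn.
  transitivity #|~: A|; first by apply: eq_card => t; rewrite inE.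
  by apply: (@addnI K); rewrite -{1}AK cardsC card_ord addnn.
rewrite -cardF.
have -> : (2 ^ k)%N = #|{ffun 'I_k -> bool}| by rewrite card_ffun card_bool card_ord.
rewrite -cardX; apply: (@leq_trans #|code @: pats A|).
  rewrite card_in_imset // => r r'; rewrite !inE.
  move=> /andP[/and3P[/eqP rE rl _] _] /andP[/and3P[/eqP r'E r'l _] _] [eb eg].
  have e1 t : r (t, true) = r' (t, true) by move/ffunP/(_ t): eg; rewrite !ffunE.
  (* The row slots are recovered by induction on time from the bits and the column slots. *)
  have e0 m (Hm : (m < k)%N) : r (Ordinal Hm, false) = r' (Ordinal Hm, false).
    elim: m Hm => [|m IHm] Hm.
      have -> : Ordinal Hm = ord0 by apply/val_inj.
      by rewrite !pattern0.
    have Hm' : (m < k)%N by lia.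
    have -> : Ordinal Hm = ordS (Ordinal Hm') by apply/val_inj; rewrite /= modn_small.
    rewrite (pattern_link rl) (pattern_link r'l) IHm e1.
    by move/ffunP/(_ (Ordinal Hm')): eb; rewrite !ffunE e1 => ->.
  by apply/ffunP => [[[t Ht] []]]; rewrite ?e1 ?e0.
apply/subset_leq_card/fintype.subsetP => p /imsetP[r].
rewrite !inE => /andP[/and3P[/eqP rE rl _] /eqP rA] -> /=.
apply/forallP => t; rewrite ffunE /F; case: ifP => [|tA].
  by rewrite -rA inE => /eqP ->; rewrite inE.
have : r (r (t, true)) = r (t, true) by exact: pattern_idem.
move=> /eqP rr; have : r (t, true) \in reps r by rewrite inE.
have -> // : reps r = old.
by rewrite (reps_news rE rl) rA.
Qed.

End PatternCounting.

(** * Estimates for products, Bernoulli moments and collisions *)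

Section ProductEstimates.
Variable R : realFieldType.

(** The factors are exchanged one at a time; [1 <= C] allows the same power of [C] for every
    term. *)
Lemma ler_norm_prod_diff (I : Type) (s : seq I) (P : pred I) (a b : I -> R) C :
  1 <= C -> (forall i, P i -> `|a i| <= C) -> (forall i, P i -> `|b i| <= C) ->
  `|\prod_(i <- s | P i) a i - \prod_(i <- s | P i) b i| <=
    C ^+ count P s * \sum_(i <- s | P i) `|a i - b i|.
Proof.
move=> C1 aC bC; have C0 : 0 <= C by rewrite (le_trans ler01).
elim: s => [|i s IH]; first by rewrite !big_nil subrr normr0 mulr0.
rewrite !big_cons /=; case: ifP => Pi; last by rewrite add0n.
rewrite add1n exprS.
set pa := \prod_(j <- s | P j) a j; set pb := \prod_(j <- s | P j) b j.
have -> : a i * pa - b i * pb = (a i - b i) * pa + b i * (pa - pb) by ring.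
rewrite (le_trans (ler_normD _ _)) // !normrM.
have pC : `|pa| <= C ^+ count P s.
  rewrite normr_prod -big_filter -size_filter.
  have : all P (seq.filter P s) by exact: filter_all.
  elim: (seq.filter P s) => [|j l IHl] /=; first by rewrite big_nil expr0.
  by move=> /andP[Pj Pl]; rewrite big_cons exprS ler_pM ?prodr_ge0 ?aC ?IHl.
have S0 : 0 <= \sum_(j <- s | P j) `|a j - b j| by exact: sumr_ge0.
rewrite mulrDr lerD //.
  rewrite mulrC ler_wpM2r // (le_trans pC) // ler_peMl // exprn_ge0 //.
by rewrite -mulrA ler_pM // bC.
Qed.

(** The quotient of [bmoment] by [q], free of division. For m >= 2 it tends to 1 with q -> 0: a
    repeated edge costs a single factor [q], however often it is used. *)
Definition bfactor (q : R) (m : nat) : R := (1 - q) ^+ m - (1 - q) * (- q) ^+ m.-1.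

Lemma bmomentE q m : (0 < m)%N -> bmoment q m = q * bfactor q m.
Proof. by case: m => // m _; rewrite /bmoment /bfactor !exprS /=; ring. Qed.

Lemma bmoment0 m : (0 < m)%N -> bmoment 0 m = 0 :> R.
Proof. by move=> m0; rewrite bmomentE // mul0r. Qed.

Lemma bmoment1 (q : R) : bmoment q 1 = 0.
Proof. by rewrite /bmoment !expr1; ring. Qed.

Lemma bfactor_tail m (q : R) : 0 <= q <= 1 -> `|(1 - q) * (- q) ^+ m.+1| <= q.
Proof.
move=> /andP[q0 q1]; rewrite normrM normrX normrN (ger0_norm q0) ger0_norm ?subr_ge0 //.
rewrite exprS mulrCA -[leRHS]mulr1 ler_wpM2l //.
by rewrite mulr_ile1 ?exprn_ge0 ?subr_ge0 ?exprn_ile1 // gerBl.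
Qed.

Lemma bfactor_le1 (q : R) m : 0 <= q <= 1 -> (1 < m)%N -> `|bfactor q m| <= 1.
Proof.
move=> q01; case: m => [|[|m]] // _; have /andP[q0 q1] := q01.
rewrite /bfactor (le_trans (ler_normB _ _)) //.
rewrite (le_trans (lerD (_ : _ <= 1 - q) (bfactor_tail m q01))) ?subrK //.
rewrite normrX ger0_norm ?subr_ge0 //.
rewrite exprS ler_piMr ?exprn_ile1 //; lra.
Qed.

Lemma bfactor_near1 (q : R) m : 0 <= q <= 1 -> (1 < m)%N -> `|bfactor q m - 1| <= m.+1%:R * q.
Proof.
move=> q01; case: m => [|[|m]] // _; have /andP[q0 q1] := q01.
have -> : bfactor q m.+2 - 1 = ((1 - q) ^+ m.+2 - 1) - (1 - q) * (- q) ^+ m.+1.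
  by rewrite /bfactor /=; ring.
rewrite (le_trans (ler_normB _ _)) // -natr1 [leRHS]mulrDl mul1r lerD ?bfactor_tail //.
have q1' : 0 <= 1 - q by rewrite subr_ge0.
rewrite ler0_norm; last by rewrite subr_le0 exprn_ile1 // gerBl.
rewrite opprB; elim: m.+2 => [|p IH]; first by rewrite expr0 subrr mul0r.
rewrite exprS -natr1; have := exprn_ge0 p q1'; have := exprn_ile1 p q1'.
have := IH; set z := (1 - q) ^+ p; set w := p%:R; nra.
Qed.

End ProductEstimates.

Section Collisions.
Variables (R : realFieldType) (I : finType) (N : nat).

Lemma card_collision (a b : I) : a != b ->
  (#|[set y : {ffun I -> 'I_N} | y a == y b]| * N = N ^ #|I|)%N.
Proof.
move=> ab.
have -> : #|[set y : {ffun I -> 'I_N} | y a == y b]| =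
    (\sum_(c : 'I_N) #|[set y : {ffun I -> 'I_N} | (y a == c) && (y b == c)]|)%N.
  rewrite -sum1_card (partition_big (fun y : {ffun I -> 'I_N} => y a) predT) //=.
  apply: eq_bigr => c _; rewrite -sum1_card; apply: eq_bigl => y; rewrite !inE.
  by apply/andP/andP => [[/eqP <- /eqP ->]|[/eqP -> /eqP ->]]; rewrite !eqxx.
have ab2 : #|[set a; b]| = 2%N by rewrite cards2 ab.
have NC : (#|~: [set a; b]| + 2 = #|I|)%N by rewrite -ab2 addnC cardsC.
rewrite (eq_bigr (fun=> N ^ #|~: [set a; b]|)%N) => [|c _].
  by rewrite sum_nat_const card_ord -expnS mulnC -expnS -NC addn2.
pose F i : {set 'I_N} := if i \in [set a; b] then [set c] else [set: 'I_N].
transitivity #|family F|.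
  apply: eq_card => y; rewrite inE; apply/andP/familyP => [[ya yb] i|yF].
    rewrite /F; case: ifP => [|_]; last by rewrite inE.
    by rewrite !inE => /orP[] /eqP ->.
  have := yF a; have := yF b.
  by rewrite /F !inE !eqxx orbT /= !inE => -> ->.
rewrite card_family foldrE big_map big_enum /= (bigID (fun i => i \in [set a; b])) /=.
rewrite big1 ?mul1n => [|i iab]; last by rewrite /F iab cards1.
rewrite (eq_bigr (fun=> N)) => [|i /negbTE iab]; last by rewrite /F iab cardsT card_ord.
by rewrite prod_nat_const; congr expn; apply: eq_card => i; rewrite inE.
Qed.

(** Union bound over the pairs that may collide, each collision having density 1/N. *)
Lemma card_noninjective (P : pred {ffun I -> 'I_N}) :
  (forall y, P y -> exists a b, a != b /\ y a = y b) ->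
  (#|P| * N <= #|I| * #|I| * N ^ #|I|)%N.
Proof.
move=> HP.
apply: (@leq_trans ((\sum_(p : I * I | p.1 != p.2)
   #|[set y : {ffun I -> 'I_N} | y p.1 == y p.2]|) * N)).
  rewrite leq_mul2r; apply/orP; right.
  rewrite -sum1_card; under [X in (_ <= X)%N]eq_bigr do rewrite -sum1_card.
  rewrite (exchange_big_dep predT) //= big_mkcond /=; apply: leq_sum => y _.
  case: ifP => // Py; have [a [b [ab yab]]] := HP y Py.
  by rewrite (bigD1 (a, b)) //= ab inE yab eqxx.
rewrite big_distrl /= (eq_bigr (fun=> N ^ #|I|)%N) => [|p pp]; last exact: card_collision.
rewrite sum_nat_const leq_mul2r -card_prod max_card.
by rewrite orbT.
Qed.

End Collisions.

(** * The spectral theorem for real symmetric matrices *)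

Section RealSpectral.
Variable R : rcfType.

(** Over the complex numbers the matrix is Hermitian, hence unitarily diagonalisable with real
    eigenvalues. Such an eigenvalue is a root of the characteristic polynomial, and this descends to
    [R]. *)
Lemma symmetric_eigenvalue n (A : 'M[R]_n) : (0 < n)%N -> A^T = A ->
  exists a, eigenvalue A a.
Proof.
move=> n0 AT; pose C := (complex R : numClosedFieldType).
pose toC : {rmorphism R -> C} := real_complex R.
pose AC : 'M[C]_n := map_mx toC A.
have AH : AC \is hermsymmx.
  apply: realsym_hermsym.
    apply/is_hermitianmxP; rewrite expr0 scale1r map_mx_id //.
    by apply/matrixP => i j; rewrite !mxE -[in LHS]AT mxE.
  by apply/mxOverP => i j; rewrite mxE; apply/complex_realP; exists (A i j).
have /hermitian_normalmx /orthomx_spectralP AE := AH.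
have Uu := spectral_unit AC.
pose i0 := Ordinal n0.
have /mxOverP/(_ 0 i0) := hermitian_spectral_diag_real AH.
move=> /complex_realP[a da]; exists a.
rewrite eigenvalue_root_char -(fmorph_root toC) map_char_poly -eigenvalue_root_char.
apply/eigenvalueP; exists (row i0 (spectralmx AC)).
  have UA : spectralmx AC *m AC = diag_mx (spectral_diag AC) *m spectralmx AC.
    by rewrite {2}AE -mulmxA mulKVmx.
  by apply/rowP => j; rewrite -row_mul UA mul_diag_mx !mxE da.
apply/negP => /eqP r0; have := congr1 (fun M => row i0 M) (mulmxV Uu).
rewrite row_mul r0 mul0mx => /matrixP/(_ 0 i0); rewrite !mxE eqxx => /eqP.
by rewrite eq_sym oner_eq0.
Qed.

Lemma sqr_sum_eq0 n (v : 'rV[R]_n) : (v *m v^T) 0 0 = 0 -> v = 0.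
Proof.
rewrite mxE => /eqP; rewrite psumr_eq0 => [/allP v0|i _]; last by rewrite mxE -expr2 sqr_ge0.
apply/rowP => i; rewrite mxE; have := v0 i (mem_index_enum _).
by rewrite mxE -expr2 sqrf_eq0 => /eqP.
Qed.

Lemma dot_ge0 n (v : 'rV[R]_n) : 0 <= (v *m v^T) 0 0.
Proof. by rewrite mxE sumr_ge0 // => i _; rewrite mxE -expr2 sqr_ge0. Qed.

(** Reflection in the hyperplane orthogonal to v - w, which exchanges the two unit vectors. *)
Lemma householder n (v : 'rV[R]_n) (w : 'rV[R]_n) :
  (v *m v^T) = 1%:M -> w *m w^T = 1%:M ->
  exists H : 'M[R]_n, [/\ H^T = H, H *m H = 1%:M & w *m H = v].
Proof.
move=> v1 w1; pose u := v - w; pose c : R := (u *m u^T) 0 0.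
have [u0|u0] := eqVneq u 0.
  exists 1%:M; split; rewrite ?trmx1 ?mulmx1 //.
  by apply/esym/eqP; rewrite -subr_eq0 -/u u0.
have c0 : c != 0 by apply: contraNneq u0 => /sqr_sum_eq0 ->.
have uu : u *m u^T = c%:M by rewrite [LHS]mx11_scalar.
pose H := 1%:M - (2 / c) *: (u^T *m u).
have uH : u *m H = - u.
  rewrite mulmxBr mulmx1 -scalemxAr mulmxA uu mul_scalar_mx scalerA divfK //.
  by rewrite scaler_nat mulr2n opprD addrA subrr sub0r.
exists H; split.
- by rewrite /H linearB linearZ /= trmx_mul trmxK trmx1.
- rewrite {1}/H mulmxBl mul1mx -scalemxAl -mulmxA uH mulmxN scalerN opprK.
  by rewrite /H subrK.
pose t := (w *m v^T) 0 0.
have wv : w *m v^T = t%:M by rewrite [LHS]mx11_scalar.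
have vw : v *m w^T = t%:M by rewrite -[LHS]trmxK trmx_mul trmxK wv tr_scalar_mx.
have cE : c = 2 - 2 * t.
  have : c%:M = 1%:M - t%:M - (t%:M - 1%:M) :> 'M[R]_1.
    by rewrite -uu /u linearB /= mulmxBl !mulmxBr v1 w1 vw wv.
  move/matrixP/(_ 0 0); rewrite !mxE eqxx !mulr1n => ->; ring.
have wu : w *m u^T = (- (c / 2))%:M.
  rewrite /u linearB /= mulmxBr wv w1 -raddfB /=; congr _%:M.
  by rewrite cE; field.
rewrite /H mulmxBr mulmx1 -scalemxAr mulmxA wu mul_scalar_mx scalerA.
have -> : 2 / c * - (c / 2) = -1 by field.
by rewrite scaleN1r opprK /u addrC subrK.
Qed.

Lemma unit_eigenvector n (A : 'M[R]_n) a : eigenvalue A a ->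
  exists v : 'rV[R]_n, v *m A = a *: v /\ v *m v^T = 1%:M.
Proof.
move=> /eigenvalueP[v vA v0]; pose c := (v *m v^T) 0 0.
have c0 : 0 < c.
  rewrite lt0r dot_ge0 andbT.
  by apply: contraNneq v0 => /sqr_sum_eq0 ->.
exists ((Num.sqrt c)^-1 *: v); split.
  by rewrite -scalemxAl vA !scalerA mulrC.
rewrite linearZ /= -scalemxAl -scalemxAr scalerA -invfM -expr2 sqr_sqrtr ?ltW //.
rewrite [v *m v^T]mx11_scalar -/c scale_scalar_mx mulVf // gt_eqF //.
Qed.

(** Deflation: a reflection takes a unit eigenvector to the first basis vector; symmetry then clears
    the first row and column off the diagonal, and the remaining block is smaller. *)
Lemma symmetric_spectral n (A : 'M[R]_n) : A^T = A ->
  exists P : 'M[R]_n, exists l : 'rV[R]_n,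
    P *m P^T = 1%:M /\ A = P^T *m diag_mx l *m P.
Proof.
elim: n A => [|n IH] A AT.
  by exists 1%:M, 0; split; apply/matrixP => [[]].
have [a /unit_eigenvector[v [vA v1]]] := symmetric_eigenvalue (ltn0Sn n) AT.
pose e0 : 'rV[R]_n.+1 := delta_mx 0 0.
have e01 : e0 *m e0^T = 1%:M.
  by rewrite trmx_delta mul_delta_mx; apply/matrixP => i j; rewrite !mxE !ord1.
have [H [HT HH eH]] := householder v1 e01.
pose B : 'M[R]_(1 + n) := H *m A *m H.
have BT : B^T = B by rewrite /B !trmx_mul HT AT mulmxA.
have eB : e0 *m B = a *: e0.
  by rewrite /B !mulmxA eH vA -scalemxAl -eH -mulmxA HH mulmx1.
have B0 j : B 0 j = a * (j == 0)%:R.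
  have := congr1 (fun M : 'rV[R]_n.+1 => M 0 j) eB.
  by rewrite /e0 -rowE !mxE eqxx.
have Bl i : B i 0 = a * (i == 0)%:R by rewrite -BT mxE B0.
have l0 (i : 'I_1) : lshift n i = 0 by apply/val_inj; rewrite /= (ord1 i).
have BE : B = block_mx a%:M 0 0 (drsubmx B).
  rewrite -[LHS]submxK; congr block_mx; apply/matrixP => i j.
  - by rewrite [LHS]mxE [LHS]mxE !l0 B0 eqxx mulr1 !mxE !ord1 eqxx.
  - by rewrite [LHS]mxE [LHS]mxE l0 B0 mulr0 mxE.
  - by rewrite [LHS]mxE [LHS]mxE l0 Bl mulr0 mxE.
have [|P [l [P1 BP]]] := IH (drsubmx B); first by rewrite trmx_drsub BT.
pose P' : 'M[R]_(1 + n) := block_mx 1%:M 0 0 P.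
have P'1 : P' *m P'^T = 1%:M.
  rewrite /P' tr_block_mx.
  rewrite mulmx_block !trmx1 !trmx0 !mul0mx !mulmx0 !mulmx1 !addr0 add0r P1.
  by rewrite -scalar_mx_block.
have P'B : B = P'^T *m diag_mx (row_mx a%:M l) *m P'.
  rewrite BE BP /P' tr_block_mx !trmx0 trmx1 diag_mx_row.
  rewrite !mulmx_block !(mul0mx, mulmx0, mul1mx, mulmx1) !(addr0, add0r, mul0mx, mulmx0).
  by congr block_mx; apply/matrixP => i j; rewrite !mxE !ord1.
exists (P' *m H), (row_mx a%:M l : 'rV[R]_(1 + n)); split.
  by rewrite trmx_mul HT mulmxA -(mulmxA P') HH mulmx1 P'1.
have -> : A = H *m B *m H by rewrite /B !mulmxA HH mul1mx -mulmxA HH mulmx1.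
by rewrite trmx_mul HT P'B !mulmxA.
Qed.

End RealSpectral.

(** * Spectral distributions and their perturbation *)

Section SpectralDistribution.
Variables (R : realType) (N : nat).
Implicit Types A B : 'M[R]_N.

Definition frob2 A : R := \sum_i \sum_j A i j ^+ 2.

Lemma orth_tr (P : 'M[R]_N) : P *m P^T = 1%:M -> P^T *m P = 1%:M.
Proof. exact: mulmx1C. Qed.

(** [eigs] is picked by choice, so only its multiset is known, by unique factorisation of the
    characteristic polynomial. *)
Lemma eigs_spectral A P (l : 'rV[R]_N) : P *m P^T = 1%:M ->
  A = P^T *m diag_mx l *m P -> perm_eq (eigs A) [seq l 0 i | i <- enum 'I_N].
Proof.
move=> P1 AE.
have As : is_eigseq A [seq l 0 i | i <- enum 'I_N].
  rewrite /is_eigseq big_map big_enum /= /char_poly /char_poly_mx.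
  pose Pp := map_mx (@polyC R) P.
  have Pp1 : Pp^T *m Pp = 1%:M.
    by rewrite /Pp map_trmx -map_mxM orth_tr // map_mx1.
  have -> : 'X%:M - map_mx polyC A = Pp^T *m ('X%:M - map_mx polyC (diag_mx l)) *m Pp.
    rewrite mulmxBr mulmxBl scalar_mxC -(mulmxA 'X%:M) Pp1 mulmx1; congr (_ - _).
    by rewrite AE !map_mxM map_trmx.
  rewrite !det_mulmx mulrAC -det_mulmx Pp1.
  rewrite det1 mul1r map_diag_mx -diag_const_mx -raddfB /= det_diag.
  by apply: eq_bigr => i _; rewrite !mxE.
rewrite /eigs; case: pselect => [h|[]]; last by exists [seq l 0 i | i <- enum 'I_N].
case: cid => s sE /=.
by apply: prod_XsubC_eq; rewrite -[LHS]sE [LHS]As.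
Qed.

Lemma esd_spectral A P (l : 'rV[R]_N) g : P *m P^T = 1%:M ->
  A = P^T *m diag_mx l *m P -> esd_int A g = N%:R^-1 * \sum_i g (l 0 i).
Proof.
move=> P1 AE; rewrite /esd_int (perm_big _ (eigs_spectral P1 AE)) /=.
by rewrite big_map big_enum.
Qed.

Lemma spectral_pow A P (l : 'rV[R]_N) k : P *m P^T = 1%:M ->
  A = P^T *m diag_mx l *m P -> A ^+ k = P^T *m diag_mx (map_mx (fun x => x ^+ k) l) *m P.
Proof.
move=> P1 AE; elim: k => [|k IH].
  have -> : map_mx (fun x => x ^+ 0) l = const_mx 1.
    by apply/rowP => i; rewrite !mxE.
  by rewrite diag_const_mx mulmx1 orth_tr.
rewrite exprS IH {1}AE -[_ * _]/(_ *m _) !mulmxA -(mulmxA _ P) P1 mulmx1.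
congr (_ *m _); rewrite -!mulmxA; congr (_ *m _); rewrite mulmx_diag.
by congr diag_mx; apply/rowP => i; rewrite !mxE exprS.
Qed.

Lemma esd_pow A k : A^T = A -> esd_int A (fun x => x ^+ k) = N%:R^-1 * \tr (A ^+ k).
Proof.
move=> /symmetric_spectral[P [l [P1 AE]]].
rewrite (esd_spectral _ P1 AE) (spectral_pow k P1 AE) mxtrace_mulC mulmxA P1 mul1mx.
by rewrite mxtrace_diag; congr (_ * _); apply: eq_bigr => i _; rewrite mxE.
Qed.

Lemma frob2E A : frob2 A = \tr (A *m A^T).
Proof.
by apply: eq_bigr => i _; rewrite mxE; apply: eq_bigr => j _; rewrite mxE expr2.
Qed.

Lemma frob2_orth A P Q : P *m P^T = 1%:M -> Q *m Q^T = 1%:M ->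
  frob2 (P *m A *m Q^T) = frob2 A.
Proof.
move=> P1 Q1; rewrite !frob2E !trmx_mul trmxK !mulmxA -(mulmxA _ Q^T) orth_tr // mulmx1.
by rewrite mxtrace_mulC !mulmxA orth_tr // mul1mx.
Qed.

(** With W = P Q^T and p the squares of its entries, P (A - B) Q^T has entries W_ij (l_i - m_j), and
    orthogonal invariance of [frob2] gives the fourth clause. In the last one, the j-th column sum
    is the j-th diagonal entry of Q (A - B) Q^T, that is c times the square of a coordinate of u
    Q^T. *)
Lemma spectral_coupling A B : A^T = A -> B^T = B ->
  exists l m : 'I_N -> R, exists p : 'I_N -> 'I_N -> R,
  [/\ forall i j, 0 <= p i j,
      (forall i, \sum_j p i j = 1) /\ (forall j, \sum_i p i j = 1),
      (forall g, esd_int A g = N%:R^-1 * \sum_i g (l i)) /\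
      (forall g, esd_int B g = N%:R^-1 * \sum_j g (m j)),
      \sum_i \sum_j p i j * (l i - m j) ^+ 2 = frob2 (A - B) &
      forall c (u : 'rV[R]_N), A - B = c *: (u^T *m u) ->
        \sum_j `|\sum_i p i j * (l i - m j)| = `|c| * \sum_a u 0 a ^+ 2].
Proof.
move=> /symmetric_spectral[P [l [P1 AE]]] /symmetric_spectral[Q [m [Q1 BE]]].
have [W WE] : exists W, W = P *m Q^T by exists (P *m Q^T).
have WW : W *m W^T = 1%:M.
  by rewrite WE trmx_mul trmxK mulmxA -(mulmxA P) orth_tr // mulmx1.
have XE i j : (P *m (A - B) *m Q^T) i j = W i j * (l 0 i - m 0 j).
  rewrite mulmxBr mulmxBl AE BE !mulmxA P1 mul1mx -!(mulmxA _ Q) Q1 mulmx1.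
  by rewrite -WE -mulmxA -WE mul_diag_mx mul_mx_diag !mxE; ring.
exists (l 0), (m 0), (fun i j => W i j ^+ 2); split.
- by move=> i j; rewrite sqr_ge0.
- split=> [i|j].
    transitivity ((W *m W^T) i i); last by rewrite WW mxE eqxx.
    by rewrite mxE; apply: eq_bigr => j _; rewrite mxE expr2.
  transitivity ((W^T *m W) j j); last by rewrite orth_tr // mxE eqxx.
  by rewrite mxE; apply: eq_bigr => i _; rewrite mxE expr2.
- by split=> g; [exact: esd_spectral AE|exact: esd_spectral BE].
- rewrite -(frob2_orth _ P1 Q1); apply: eq_bigr => i _; apply: eq_bigr => j _.
  by rewrite XE exprMn.
move=> c u ABE.
have colE j : \sum_i W i j ^+ 2 * (l 0 i - m 0 j) = c * (u *m Q^T) 0 j ^+ 2.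
  transitivity ((W^T *m (P *m (A - B) *m Q^T)) j j).
    by rewrite mxE; apply: eq_bigr => i _; rewrite XE mxE mulrA.
  rewrite WE trmx_mul trmxK !mulmxA -(mulmxA Q) orth_tr // mulmx1 ABE.
  rewrite -scalemxAr -scalemxAl mxE mulmxA -(mulmxA _ u) mxE big_ord1 expr2; congr (_ * (_ * _)).
  by rewrite -[Q *m u^T]trmxK trmx_mul trmxK mxE.
under eq_bigr do rewrite colE normrM.
rewrite -big_distrr; congr (_ * _).
transitivity ((u *m u^T) 0 0).
  have -> : u *m u^T = (u *m Q^T) *m (u *m Q^T)^T.
    by rewrite trmx_mul trmxK mulmxA -(mulmxA u) orth_tr // mulmx1.
  rewrite [RHS]mxE; apply: eq_bigr => j _.
  by rewrite [X in _ = _ * X]mxE ger0_norm ?sqr_ge0 // expr2.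
by rewrite mxE; apply: eq_bigr => a _; rewrite mxE expr2.
Qed.

End SpectralDistribution.

Section SpectralInequalities.
Variables (R : realType) (N : nat).
Hypothesis N0 : (0 < N)%N.
Implicit Types A B : 'M[R]_N.

Let Nr0 : 0 < (N%:R : R). Proof. by rewrite ltr0n. Qed.

(* Both perturbation bounds transport mass along the doubly stochastic matrix of squared
   overlaps of the eigenvectors of A and B; [eta] comes from |x| <= eta + x^2 / eta. *)
Lemma esd_lipschitz A B (g : R -> R) L eta : A^T = A -> B^T = B ->
  (forall x y, `|g x - g y| <= L * `|x - y|) -> 0 <= L -> 0 < eta ->
  `|esd_int A g - esd_int B g| <= L * (eta + eta^-1 * (N%:R^-1 * frob2 (A - B))).
Proof.
move=> AT BT gL L0 eta0.
have [l [m [p [p0 [pr pc] [eA eB] pF _]]]] := spectral_coupling AT BT.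
have -> : esd_int A g - esd_int B g =
    N%:R^-1 * \sum_i \sum_j p i j * (g (l i) - g (m j)).
  rewrite eA eB -mulrBr; congr (_ * _).
  have -> : \sum_i g (l i) = \sum_i \sum_j p i j * g (l i).
    by apply: eq_bigr => i _; rewrite -big_distrl /= pr mul1r.
  have -> : \sum_j g (m j) = \sum_i \sum_j p i j * g (m j).
    by rewrite exchange_big; apply: eq_bigr => j _; rewrite -big_distrl /= pc mul1r.
  rewrite -sumrB; apply: eq_bigr => i _; rewrite -sumrB.
  by apply: eq_bigr => j _; rewrite mulrBr.
rewrite normrM ger0_norm ?invr_ge0 ?(ltW Nr0) // mulrC ler_pdivrMr //.
have -> : L * (eta + eta^-1 * (N%:R^-1 * frob2 (A - B))) * N%:R =
    \sum_i \sum_j p i j * (L * (eta + eta^-1 * (l i - m j) ^+ 2)).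
  have -> : \sum_i \sum_j p i j * (L * (eta + eta^-1 * (l i - m j) ^+ 2)) =
    L * eta * (\sum_i \sum_j p i j) +
    L * eta^-1 * \sum_i \sum_j p i j * (l i - m j) ^+ 2.
    rewrite !big_distrr -big_split; apply: eq_bigr => i _ /=.
    rewrite !big_distrr -big_split; apply: eq_bigr => j _ /=; ring.
  rewrite pF; have -> : \sum_i \sum_j p i j = N%:R.
    under eq_bigr do rewrite pr.
    by rewrite sumr_const card_ord.
  by field; rewrite !gt_eqF.
rewrite (le_trans (ler_norm_sum _ _ _)) // ler_sum // => i _.
rewrite (le_trans (ler_norm_sum _ _ _)) // ler_sum // => j _.
rewrite normrM (ger0_norm (p0 i j)) ler_wpM2l // (le_trans (gL _ _)) //.
rewrite ler_wpM2l //; set x := l i - m j.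
rewrite -(ler_pM2l eta0) mulrDr mulrA mulfV ?gt_eqF // mul1r.
rewrite -(real_normK (num_real x)); have := normr_ge0 x; set y := `|x|; nra.
Qed.

(** The linear part of [g] is split off before absolute values are taken, so each column is summed
    with signs and rank one bounds the total by |c| |u|^2. Only the quadratic remainder is charged
    to [frob2]. *)
Lemma esd_rank_one A B (g g' : R -> R) L C c (u : 'rV[R]_N) :
  A^T = A -> B^T = B -> A - B = c *: (u^T *m u) ->
  (forall x, `|g' x| <= L) -> 0 <= C ->
  (forall x y, `|g x - g y - g' y * (x - y)| <= C * (x - y) ^+ 2) ->
  `|esd_int A g - esd_int B g| <= N%:R^-1 *
    (L * (`|c| * \sum_a u 0 a ^+ 2) + C * frob2 (A - B)).
Proof.
move=> AT BT AB g'L C0 gC.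
have [l [m [p [p0 [pr pc] [eA eB] pF p1]]]] := spectral_coupling AT BT.
have -> : esd_int A g - esd_int B g = N%:R^-1 *
    ((\sum_j g' (m j) * \sum_i p i j * (l i - m j)) +
     \sum_i \sum_j p i j * (g (l i) - g (m j) - g' (m j) * (l i - m j))).
  rewrite eA eB -mulrBr; congr (_ * _).
  have -> : \sum_i g (l i) = \sum_j \sum_i p i j * g (l i).
    rewrite exchange_big /=.
    by apply: eq_bigr => i _; rewrite -big_distrl /= pr mul1r.
  have -> : \sum_j g (m j) = \sum_j \sum_i p i j * g (m j).
    by apply: eq_bigr => j _; rewrite -big_distrl /= pc mul1r.
  rewrite [X in _ = _ + X]exchange_big /= -sumrB -big_split; apply: eq_bigr => j _ /=.
  rewrite -sumrB big_distrr -big_split; apply: eq_bigr => i _ /=; ring.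
rewrite normrM ger0_norm ?invr_ge0 ?(ltW Nr0) // ler_wpM2l ?invr_ge0 ?(ltW Nr0) //.
rewrite (le_trans (ler_normD _ _)) // lerD //.
  rewrite -(p1 _ _ AB) big_distrr /= (le_trans (ler_norm_sum _ _ _)) // ler_sum // => j _.
  by rewrite normrM ler_wpM2r.
rewrite -pF big_distrr /= (le_trans (ler_norm_sum _ _ _)) // ler_sum // => i _.
rewrite big_distrr /= (le_trans (ler_norm_sum _ _ _)) // ler_sum // => j _.
by rewrite normrM (ger0_norm (p0 i j)) mulrCA ler_wpM2l.
Qed.

Lemma esd_ramp_diag A T : A^T = A ->
  N%:R^-1 * \sum_a Num.max (A a a - T) 0 <= esd_int A (fun x => Num.max (x - T) 0).
Proof.
move=> /symmetric_spectral[P [l [P1 AE]]].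
rewrite (esd_spectral _ P1 AE) ler_wpM2l ?invr_ge0 ?(ltW Nr0) //.
have cE a : \sum_i P i a ^+ 2 = 1.
  transitivity ((P^T *m P) a a); last by rewrite orth_tr // mxE eqxx.
  by rewrite mxE; apply: eq_bigr => i _; rewrite mxE expr2.
have rE i : \sum_a P i a ^+ 2 = 1.
  transitivity ((P *m P^T) i i); last by rewrite P1 mxE eqxx.
  by rewrite mxE; apply: eq_bigr => a _; rewrite mxE expr2.
have -> : \sum_i Num.max (l 0 i - T) 0 = \sum_a \sum_i P i a ^+ 2 * Num.max (l 0 i - T) 0.
  by rewrite exchange_big; apply: eq_bigr => i _ /=; rewrite -big_distrl /= rE mul1r.
apply: ler_sum => a _; rewrite ge_max; apply/andP; split; last first.
  by apply: sumr_ge0 => i _; rewrite mulr_ge0 ?sqr_ge0 // le_max lexx orbT.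
(* A diagonal entry is the mean of the eigenvalues under the weights [P i a ^+ 2]. *)
have -> : A a a - T = \sum_i P i a ^+ 2 * (l 0 i - T).
  under [RHS]eq_bigr do rewrite mulrBr.
  rewrite sumrB -big_distrl /= cE mul1r; congr (_ - _).
  rewrite {1}AE -mulmxA mxE; apply: eq_bigr => i _.
  by rewrite mul_diag_mx !mxE expr2; ring.
by apply: ler_sum => i _; rewrite ler_wpM2l ?sqr_ge0 // le_max lexx.
Qed.

Lemma esd_cst A c : A^T = A -> esd_int A (fun=> c) = c.
Proof.
move=> /symmetric_spectral[P [l [P1 AE]]].
rewrite (esd_spectral _ P1 AE) sumr_const card_ord -[X in _ * X]mulr_natl mulrA mulVf ?mul1r //.
by rewrite gt_eqF.
Qed.

Lemma esdD A g h : esd_int A (fun x => g x + h x) = esd_int A g + esd_int A h.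
Proof. by rewrite /esd_int big_split mulrDr. Qed.

Lemma esdZ A c g : esd_int A (fun x => c * g x) = c * esd_int A g.
Proof. by rewrite /esd_int -big_distrr mulrCA. Qed.

Lemma ler_esd A g h : (forall x, g x <= h x) -> esd_int A g <= esd_int A h.
Proof.
by move=> gh; rewrite /esd_int ler_wpM2l ?invr_ge0 ?(ltW Nr0) // ler_sum.
Qed.

Lemma ler_norm_esd A g : `|esd_int A g| <= esd_int A (fun x => `|g x|).
Proof.
rewrite /esd_int normrM ger0_norm ?invr_ge0 ?(ltW Nr0) // ler_wpM2l ?invr_ge0 ?(ltW Nr0) //.
exact: ler_norm_sum.
Qed.

Lemma frob2D A B : frob2 (A + B) <= 2 * frob2 A + 2 * frob2 B.
Proof.
rewrite !big_distrr -big_split; apply: ler_sum => i _ /=.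
rewrite !big_distrr -big_split; apply: ler_sum => j _ /=.
by rewrite !mxE; have := sqr_ge0 (A i j - B i j); nra.
Qed.

End SpectralInequalities.

Local Open Scope classical_set_scope.
Local Open Scope ring_scope.

Lemma approx_cvgn (R : realType) (u : nat -> R) :
  (forall e : R, 0 < e -> exists x, \forall N \near \oo, `|u N - x| <= e) -> cvgn u.
Proof.
move=> H; apply/cauchy_cvgP/cauchy_exP => e e0.
have [x Hx] := H (e / 2) (divr_gt0 e0 (ltr0n _ 2)).
exists x; near=> N.
rewrite /ball /= distrC (le_lt_trans (_ : _ <= e / 2)) //.
  by near: N.
by rewrite ltr_pdivrMr // mulr_natr mulr2n ltrDl.
Unshelve. all: by end_near. Qed.

(** * Convergence of Riemann averages and of the moments *)

Section RiemannAverage.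
Variables (R : realType) (I : finType).

Definition grid_avg (G : (I -> R) -> R) (N : nat) : R :=
  N%:R ^- #|I| * \sum_(y : {ffun I -> 'I_N}) G (fun i => vpos R (y i)).

Lemma vpos_itv N (i : 'I_N) : 0 <= vpos R i <= 1.
Proof.
have N0 : (0 < N)%N by case: N i => [[]|].
by rewrite /vpos divr_ge0 //= ler_pdivrMr ?ltr0n // mul1r ler_nat.
Qed.

Lemma card_block N M (a : 'I_N) : (0 < M)%N ->
  #|[pred u : 'I_(N * M) | (u %/ M == a)%N]| = M.
Proof.
move=> M0; have lt (m : 'I_M) : (a * M + m < N * M)%N.
  by rewrite (leq_trans (_ : _ < a.+1 * M)%N) // ?leq_mul2r ?ltn_ord ?orbT // mulSn addnC ltn_add2r.
rewrite -[RHS]card_ord -(fintype.card_image (f := fun m => Ordinal (lt m))); last first.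
  by move=> m m' [/addnI/val_inj].
apply: eq_card => u; rewrite inE; apply/eqP/fintype.imageP => [ua|[m _ ->] /=].
  have um : (u %% M < M)%N by rewrite ltn_mod.
  by exists (Ordinal um) => //; apply/val_inj; rewrite /= -ua -divn_eq.
by rewrite divnMDl // divn_small // addn0.
Qed.

Lemma grid_sum_blocks N M (g : {ffun I -> 'I_N} -> R)
    (h : 'I_(N * M) -> 'I_N) : (0 < M)%N -> (forall u, h u = (u %/ M)%N :> nat) ->
  \sum_(z : {ffun I -> 'I_(N * M)}) g [ffun i => h (z i)] =
  M%:R ^+ #|I| * \sum_y g y.
Proof.
move=> M0 hE.
rewrite (partition_big (fun z : {ffun I -> 'I_(N * M)} => [ffun i => h (z i)]) predT) //.
rewrite big_distrr; apply: eq_bigr => y _.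
have fibre : #|[pred z : {ffun I -> 'I_(N * M)} | [ffun i => h (z i)] == y]| = (M ^ #|I|)%N.
  transitivity #|family (fun i => [pred u : 'I_(N * M) | (u %/ M == y i)%N])|.
    apply: eq_card => z; rewrite inE; apply/idP/familyP => [/eqP <- i|H].
      by rewrite inE ffunE hE.
    by apply/eqP/ffunP => i; rewrite ffunE; apply/val_inj; rewrite /= hE; apply/eqP/H.
  rewrite card_family foldrE big_map big_enum /= (eq_bigr (fun=> M)).
    by rewrite prod_nat_const.
  by move=> i _; rewrite card_block.
rewrite -[RHS]/(M%:R ^+ #|I| * g y) -natrX -fibre mulr_natl -sumr_const.
by apply: eq_bigr => z /eqP ->.
Qed.

Variable G : (I -> R) -> R.
Hypothesis Gu : forall e : R, 0 < e -> exists2 d : R, 0 < d & forall a b : I -> R,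
  (forall i, 0 <= a i <= 1) -> (forall i, 0 <= b i <= 1) ->
  (forall i, `|a i - b i| <= d) -> `|G a - G b| <= e.

(* Refining the grid N to N M shows that the averages form a Cauchy sequence. *)
Lemma grid_avg_refine e : 0 < e -> \forall N \near \oo, forall M, (0 < M)%N ->
  `|grid_avg G N - grid_avg G (N * M)| <= e.
Proof.
move=> e0; have [d d0 Gd] := Gu e0.
near=> N => M M0.
have N0 : (0 < N)%N by near: N; exact: nbhs_infty_gt.
have Nd : N%:R^-1 <= d.
  rewrite -[d]invrK lef_pV2 ?posrE ?invr_gt0 ?ltr0n //.
  by near: N; exact: nbhs_infty_ger.
have hlt (u : 'I_(N * M)) : (u %/ M < N)%N by rewrite ltn_divLR.
pose h (u : 'I_(N * M)) := Ordinal (hlt u).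
have NM0 : 0 < ((N * M)%:R : R) by rewrite ltr0n muln_gt0 N0.
have -> : grid_avg G N = (N * M)%:R ^- #|I| *
    \sum_(z : {ffun I -> 'I_(N * M)}) G (fun i => vpos R (h (z i))).
  have -> : \sum_(z : {ffun I -> 'I_(N * M)}) G (fun i => vpos R (h (z i))) =
      M%:R ^+ #|I| * \sum_(y : {ffun I -> 'I_N}) G (fun i => vpos R (y i)).
    etransitivity; last first.
      exact: (grid_sum_blocks (fun y : {ffun I -> 'I_N} => G (fun i => vpos R (y i)))
        (h := h) M0 (fun=> erefl)).
    apply: eq_bigr => z _; congr G; apply/funext => i.
    by rewrite ffunE.
  rewrite /grid_avg natrM exprMn mulrA.
  congr (_ * _); rewrite invfM -mulrA mulVf ?mulr1 //.
  by rewrite expf_neq0 // pnatr_eq0 -lt0n.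
rewrite /grid_avg -mulrBr -sumrB normrM ger0_norm ?invr_ge0 ?exprn_ge0 //.
rewrite mulrC ler_pdivrMr ?exprn_gt0 //.
apply: (le_trans (ler_norm_sum _ _ _)).
apply: (@le_trans _ _ (\sum_(z : {ffun I -> 'I_(N * M)}) e)); last first.
  by rewrite sumr_const card_ffun card_ord -natrX mulr_natr.
apply: ler_sum => z _; apply: Gd => i; rewrite ?vpos_itv //.
(* A fine grid point and the coarse point of its block are at most 1/N apart. *)
apply: le_trans Nd; rewrite /vpos /=; move: (z i) => u.
have -> : (u %/ M).+1%:R / N%:R - u.+1%:R / (N * M)%:R =
    ((u %/ M).+1%:R * M%:R - u.+1%:R) * M%:R^-1 * N%:R^-1 :> R.
  rewrite natrM; field.
  by rewrite !pnatr_eq0 -!lt0n M0 N0.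
rewrite normrM [X in _ * X]ger0_norm ?invr_ge0 // -[leRHS]mul1r ler_wpM2r ?invr_ge0 //.
rewrite normrM [X in _ * X]ger0_norm ?invr_ge0 // ler_pdivrMr ?ltr0n // mul1r.
rewrite [in X in _ - X](divn_eq u M) -natrM mulSn -addnS.
have um : (u %% M < M)%N by rewrite ltn_mod.
rewrite addnC [X in _ - X]natrD natrD.
have -> : (u %/ M * M)%:R + M%:R - ((u %/ M * M)%:R + (u %% M).+1%:R) =
  (M - (u %% M).+1)%:R :> R by rewrite natrB //; ring.
by rewrite normr_nat ler_nat leq_subr.
Unshelve. all: by end_near. Qed.

Lemma grid_avg_cvg : cvgn (grid_avg G).
Proof.
apply: approx_cvgn => e e0.
have e20 : 0 < e / 2 by rewrite divr_gt0.
have [N0 _ H] := grid_avg_refine e20.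
exists (grid_avg G N0.+1); near=> N.
(* Both grids are compared with their common refinement; [N0.+1] is positive even if [N0] is 0. *)
have -> : grid_avg G N - grid_avg G N0.+1 =
  (grid_avg G N - grid_avg G (N * N0.+1)) - (grid_avg G N0.+1 - grid_avg G (N0.+1 * N)).
  by rewrite mulnC; ring.
rewrite (le_trans (ler_normB _ _)) // [leRHS]splitr lerD //.
  by apply: H => //=; near: N; exact: nbhs_infty_ge.
by apply: H => //=; near: N; exact: nbhs_infty_gt.
Unshelve. all: by end_near. Qed.

End RiemannAverage.

Section PatternLimits.
Variables (R : realType) (f : R -> R -> R) (eps : nat -> R) (B : R).
Hypothesis B1 : 1 <= B.
Hypothesis fB : forall x y : R, 0 <= x <= 1 -> 0 <= y <= 1 -> 0 <= f x y <= B.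
Hypothesis fC : forall x y : R, 0 <= x <= 1 -> 0 <= y <= 1 -> f x y = f y x.
Hypothesis fu : forall e : R, 0 < e -> exists2 d : R, 0 < d &
  forall x y x' y' : R, 0 <= x <= 1 -> 0 <= y <= 1 -> 0 <= x' <= 1 -> 0 <= y' <= 1 ->
    `|x - x'| <= d -> `|y - y'| <= d -> `|f x y - f x' y'| <= e.
Hypothesis eps_gt0 : forall N, 0 < eps N.
Hypothesis eps0 : eps @ \oo --> 0.
Hypothesis Neps : (fun N => N%:R * eps N) @ \oo --> +oo.

(** Giving probability 0 to the pairs outside [upper] makes the law of the graph a product measure
    over all ordered pairs. *)
Definition edge_q (N : nat) (u : 'I_N * 'I_N) : R :=
  if (u.1 < u.2)%N then edge_prob f eps u.1 u.2 else 0.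

Definition scale (N : nat) : R := Num.sqrt (N%:R * eps N).

Lemma edge_q_ed N (i l : 'I_N) : i != l ->
  edge_q (ed i l) = eps N * f (vpos R i) (vpos R l).
Proof.
move=> il; rewrite /edge_q /ed; case: (ltnP i l) => /= [->//|li].
by rewrite ltn_neqAle li eq_sym il /edge_prob fC ?vpos_itv.
Qed.

Lemma edge_q_diag N (i : 'I_N) : edge_q (ed i i) = 0.
Proof. by rewrite /edge_q /ed ltnn /= ltnn. Qed.

Lemma near_edge_q : \forall N \near \oo, forall u, 0 <= edge_q (N := N) u <= 1.
Proof.
near=> N => u; rewrite /edge_q; case: ifP => _; last by rewrite lexx ler01.
have /andP[f0 f1] := fB (vpos_itv R u.1) (vpos_itv R u.2).
rewrite /edge_prob mulr_ge0 ?(ltW (eps_gt0 _)) //=.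
have eB : eps N <= B^-1.
  near: N; apply: (cvgr_le _ eps0); by rewrite invr_gt0 (lt_le_trans ltr01).
rewrite (le_trans (ler_pM _ _ eB f1)) ?(ltW (eps_gt0 _)) //.
by rewrite mulVf // gt_eqF // (lt_le_trans ltr01).
Unshelve. all: by end_near. Qed.

Lemma scale_gt0 N : (0 < N)%N -> 0 < scale N.
Proof. by move=> N0; rewrite sqrtr_gt0 mulr_gt0 ?ltr0n. Qed.

Lemma scaleV0 : (fun N => (scale N)^-1) @ \oo --> 0.
Proof.
apply/cvgrPdist_le => e e0; near=> N.
have N0 : (0 < N)%N by near: N; exact: nbhs_infty_gt.
rewrite sub0r normrN ger0_norm ?invr_ge0 ?(ltW (scale_gt0 _)) //.
rewrite -[e]invrK lef_pV2 ?posrE ?invr_gt0 ?scale_gt0 //.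
rewrite -[leLHS]ger0_norm ?invr_ge0 ?(ltW e0) // -sqrtr_sqr ler_wsqrtr //.
by near: N; move/cvgryPge: Neps; exact.
Unshelve. all: by end_near. Qed.

Lemma natV0 : (fun N => (N%:R : R)^-1) @ \oo --> 0.
Proof.
apply/cvgrPdist_le => e e0; near=> N.
have N0 : (0 < N)%N by near: N; exact: nbhs_infty_gt.
rewrite sub0r normrN ger0_norm ?invr_ge0 //.
rewrite -[e]invrK lef_pV2 ?posrE ?invr_gt0 ?ltr0n //.
by near: N; exact: nbhs_infty_ger.
Unshelve. all: by end_near. Qed.

Variable n : nat.
Local Notation k := n.+1.
Local Notation slot := (slot k).

Section OnePattern.
Variable r : {ffun slot -> slot}.
Hypothesis rE : pat r = r.

Lemma mult_gt0 t : (0 < mult r t)%N.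
Proof. by apply/card_gt0P; exists t; rewrite inE /same_edge !eqxx. Qed.

(** A loop has probability 0, so its centred indicator has zero moments. The earliest loop is taken,
    because only first uses occur in the product. *)
Lemma pattern_sum_loop N t : r (t, false) = r (t, true) ->
  pattern_sum (edge_q (N := N)) r = 0.
Proof.
move=> rt; rewrite /pattern_sum big1 // => y _.
case: (arg_minnP (fun t' => val t') (P := fun t' => r (t', false) == r (t', true)) (i0 := t)).
  by rewrite rt.
move=> u /eqP ru umin; rewrite (bigD1 u) /=.
  by rewrite ru edge_q_diag bmoment0 ?mult_gt0 // mul0r.
rewrite inE; apply/forallP => w; apply/implyP => wu; apply/negP => wE.
suff /umin : r (w, false) == r (w, true) by rewrite leqNgt wu.
by move: wE; rewrite /same_edge ru => /orP[] /andP[/eqP -> /eqP ->].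
Qed.

Lemma pattern_sum_simple N t : t \in first_edges r -> mult r t = 1%N ->
  pattern_sum (edge_q (N := N)) r = 0.
Proof.
move=> tf m1; rewrite /pattern_sum big1 // => y _.
by rewrite (bigD1 t) //= m1 bmoment1 mul0r.
Qed.

Definition pattern_fun (a : slot -> R) : R :=
  \prod_(t in first_edges r) f (a (r (t, false))) (a (r (t, true))).

Lemma norm_f_le x y : 0 <= x <= 1 -> 0 <= y <= 1 -> `|f x y| <= B.
Proof. by move=> /fB H /H /andP[f0 f1]; rewrite ger0_norm. Qed.

Lemma pattern_fun_unif (e : R) : 0 < e -> exists2 d : R, 0 < d & forall a b : slot -> R,
  (forall i, 0 <= a i <= 1) -> (forall i, 0 <= b i <= 1) ->
  (forall i, `|a i - b i| <= d) -> `|pattern_fun a - pattern_fun b| <= e.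
Proof.
move=> e0.
pose c := B ^+ count (mem (first_edges r)) (index_enum 'I_k) * k%:R.
have c0 : 0 < c by rewrite mulr_gt0 ?exprn_gt0 ?ltr0n // (lt_le_trans ltr01).
have [d d0 H] := fu (divr_gt0 e0 c0).
exists d => // a b a01 b01 ab.
rewrite (le_trans (ler_norm_prod_diff _ B1 _ _)) => [//|t _|t _|]; rewrite ?norm_f_le //.
have -> : e = B ^+ count (mem (first_edges r)) (index_enum 'I_k) * (k%:R * (e / c)).
  by rewrite mulrA -/c mulrC divfK ?gt_eqF.
rewrite ler_wpM2l ?exprn_ge0 ?(le_trans ler01) //.
rewrite (le_trans (_ : _ <= \sum_(t : 'I_k) e / c)) //; last first.
  by rewrite sumr_const card_ord mulr_natl.
rewrite [leLHS]big_mkcond /=; apply: ler_sum => t _; case: ifP => _.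
  exact: H.
by rewrite divr_ge0 ?ltW.
Qed.

Lemma pattern_fun_le a : (forall i, 0 <= a i <= 1) ->
  `|pattern_fun a| <= B ^+ #|first_edges r|.
Proof.
move=> a01; rewrite normr_prod -prodr_const.
by apply: ler_prod => t _; rewrite normr_ge0 norm_f_le.
Qed.

Hypothesis rloop : forall t, r (t, false) != r (t, true).
Hypothesis rmult : forall t, t \in first_edges r -> (1 < mult r t)%N.

(** The first error replaces each [bfactor] by 1; the second adds the non-injective assignments,
    which the Riemann average includes and [pattern_sum] omits. *)
Lemma pattern_sum_near : \forall N \near \oo,
  `|N%:R ^- #|{: slot}| * eps N ^- #|first_edges r| * pattern_sum (edge_q (N := N)) r
     - grid_avg pattern_fun N| <=
  B ^+ #|first_edges r| *
    (eps N * (B ^+ 2 * \sum_(t in first_edges r) (mult r t).+1%:R)) +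
  B ^+ #|first_edges r| * ((#|{: slot}| * #|{: slot}|)%:R * N%:R^-1).
Proof.
near=> N.
have N0 : (0 < N)%N by near: N; exact: nbhs_infty_gt.
have q01 : forall u, 0 <= edge_q (N := N) u <= 1 by near: N; exact: near_edge_q.
have eN := eps_gt0 N.
set m := #|{: slot}|; set ne := #|first_edges r|.
have B0 : 0 <= B by rewrite (le_trans ler01).
pose F (y : {ffun slot -> 'I_N}) (t : 'I_k) : R := f (vpos R (y (r (t, false)))) (vpos R (y (r (t, true)))).
pose Q (y : {ffun slot -> 'I_N}) (t : 'I_k) : R := edge_q (ed (y (r (t, false))) (y (r (t, true)))).
pose H (y : {ffun slot -> 'I_N}) t := bfactor (Q y t) (mult r t).
have QE (y : {ffun slot -> 'I_N}) t : inj_on_reps r y -> Q y t = eps N * F y t.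
  move=> /forallP yi; rewrite /Q edge_q_ed //.
  apply: contra (rloop t) => yy.
  by have /forallP/(_ (t, true))/implyP := yi (t, false); apply.
have -> : pattern_sum (edge_q (N := N)) r = eps N ^+ ne *
    \sum_(y : {ffun slot -> 'I_N} | inj_on_reps r y) \prod_(t in first_edges r) (F y t * H y t).
  rewrite big_distrr; apply: eq_bigr => y yi /=.
  rewrite -prodr_const -big_split; apply: eq_bigr => t tf /=.
  by rewrite bmomentE ?mult_gt0 // -/(Q y t) -/(H y t) (QE _ _ yi) mulrA.
rewrite [X in `|X - _|]mulrA mulfVK ?expf_neq0 ?gt_eqF // /grid_avg -/m.
rewrite -mulrBr (bigID (fun y : {ffun slot -> 'I_N} => inj_on_reps r y) predT) /=.
rewrite opprD addrA -sumrB mulrBr (le_trans (ler_normB _ _)) //.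
have Nm0 : 0 < (N%:R ^+ m : R) by rewrite exprn_gt0 ?ltr0n.
apply: lerD; rewrite normrM ger0_norm ?invr_ge0 ?(ltW Nm0) // mulrC ler_pdivrMr //.
  rewrite (le_trans (ler_norm_sum _ _ _)) //.
  have -> : N%:R ^+ m = \sum_(y : {ffun slot -> 'I_N}) (1 : R).
    by rewrite sumr_const card_ffun card_ord natrX.
  rewrite big_distrr /= [leLHS]big_mkcond /=; apply: ler_sum => y _; rewrite mulr1.
  have m0 : 0 <= B ^+ ne * (eps N * (B ^+ 2 * \sum_(t in first_edges r) (mult r t).+1%:R)).
    by rewrite !mulr_ge0 ?exprn_ge0 ?sumr_ge0 // ltW.
  case: ifP => // yi.
  have Fle t : `|F y t| <= B by rewrite norm_f_le ?vpos_itv.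
  rewrite (le_trans (ler_norm_prod_diff _ B1 _ _)) => [//|t tf|t _|]; rewrite ?Fle //.
    rewrite normrM -[leRHS]mulr1 ler_pM //.
    by rewrite /H bfactor_le1 ?rmult // q01.
  have -> : count (mem (first_edges r)) (index_enum 'I_k) = ne.
    by rewrite -sum1_count /ne -sum1_card.
  rewrite ler_wpM2l ?exprn_ge0 // !big_distrr /=; apply: ler_sum => t tf.
  have -> : F y t * H y t - F y t = F y t * (H y t - 1) by ring.
  rewrite normrM; have Hn := bfactor_near1 (q01 _) (rmult tf).
  rewrite (le_trans (ler_pM _ _ (Fle t) (Hn _))) // -/(Q y t) (QE _ _ yi).
  have -> : B * ((mult r t).+1%:R * (eps N * F y t)) =
    (eps N * B * (mult r t).+1%:R) * F y t by ring.
  have -> : eps N * (B ^+ 2 * (mult r t).+1%:R) = (eps N * B * (mult r t).+1%:R) * B by ring.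
  rewrite ler_wpM2l ?mulr_ge0 ?(ltW eN) //.
  by rewrite (le_trans (ler_norm _)).
rewrite (le_trans (ler_norm_sum _ _ _)) //.
apply: (@le_trans _ _ (\sum_(y : {ffun slot -> 'I_N} | ~~ inj_on_reps r y) B ^+ ne)).
  by apply: ler_sum => y _; apply: pattern_fun_le => i; exact: vpos_itv.
rewrite sumr_const -[leLHS]mulr_natr -mulrA ler_wpM2l ?exprn_ge0 //.
rewrite mulrAC ler_pdivlMr ?ltr0n // -natrX -!natrM ler_nat.
apply: card_noninjective => y /forallPn[a /forallPn[b]].
by rewrite negb_imply => /andP[/eqP ya ab]; exists (r a), (r b).
Unshelve. all: by end_near. Qed.

Definition pattern_bound : R :=
  if ~~ odd k && (r \in cyclic_patterns R n k./2) then B ^+ k./2 else 0.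

Lemma norm_links_le1 : `|links R r| <= 1.
Proof.
have -> : 1 = \prod_(t : 'I_k) (1 : R) by rewrite big1.
rewrite normr_prod.
apply: ler_prod => t _; rewrite normr_ge0 /link /=.
by case: eqP; case: eqP; rewrite ?subrr ?subr0 ?sub0r ?normrN ?normr1 ?normr0 ?ler01 ?lexx.
Qed.

(** Power counting with v = w + 1: the prefactors combine to N^-(e-w) scale^-(k-2e). Both exponents
    are nonnegative, and a positive one makes the limit vanish. *)
Lemma pattern_cvg_main : links R r != 0 -> exists2 L,
  (fun N => (N%:R)^-1 * (scale N)^-1 ^+ k * (links R r *
     (N%:R ^- #|~: reps r| * pattern_sum (edge_q (N := N)) r))) @ \oo --> L &
  `|L| <= pattern_bound.
Proof.
move=> rl.
have we : (#|news r| <= #|first_edges r|)%N by exact/subset_leq_card/news_first_edges.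
have ek := card_first_edges rmult.
set w := #|news r| in we *; set e := #|first_edges r| in we ek *.
pose X N := N%:R ^- #|{: slot}| * eps N ^- e * pattern_sum (edge_q (N := N)) r.
have Gcvg : cvgn (grid_avg pattern_fun) by exact: grid_avg_cvg pattern_fun_unif.
have X_cvg : X @ \oo --> limn (grid_avg pattern_fun).
  rewrite -[limn _]add0r -[X](subrK (grid_avg pattern_fun)).
  apply: cvgD Gcvg.
  pose err N := B ^+ e * (eps N * (B ^+ 2 * \sum_(t in first_edges r) (mult r t).+1%:R)) +
     B ^+ e * ((#|{: slot}| * #|{: slot}|)%:R * N%:R^-1).
  have err0 : err @ \oo --> 0.
    rewrite [X in _ --> X](_ : 0 =
      B ^+ e * (0 * (B ^+ 2 * \sum_(t in first_edges r) (mult r t).+1%:R)) +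
      B ^+ e * ((#|{: slot}| * #|{: slot}|)%:R * 0)); last by rewrite mul0r !mulr0 addr0.
    by apply: cvgD; apply: cvgMr; [apply: cvgMl|apply: cvgMr; exact: natV0].
  apply/cvgr0Pnorm_le => c c0; near=> N.
  have H : `|X N - grid_avg pattern_fun N| <= err N by near: N; exact: pattern_sum_near.
  rewrite (le_trans H) //; near: N; exact: (cvgr_le _ err0).
(* Since [0 ^+ 0] is 1, this expression covers the critical case and the vanishing ones alike. *)
exists (links R r * (0 ^+ (e - w) * 0 ^+ (k - e.*2) * limn (grid_avg pattern_fun))).
  pose Y N := links R r * (N%:R^-1 ^+ (e - w) * (scale N)^-1 ^+ (k - e.*2) * X N).
  apply: (@cvg_trans _ (Y @ \oo)).
    apply: near_eq_cvg; near=> N.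
    have N0 : (0 < N)%N by near: N; exact: nbhs_infty_gt.
    suff key : N%:R^-1 * (scale N)^-1 ^+ k * N%:R ^- #|~: reps r| =
        N%:R^-1 ^+ (e - w) * (scale N)^-1 ^+ (k - e.*2) * (N%:R ^- #|{: slot}| * eps N ^- e).
      transitivity (links R r * ((N%:R^-1 * (scale N)^-1 ^+ k * N%:R ^- #|~: reps r|) *
        pattern_sum (edge_q (N := N)) r)); last by ring.
      by rewrite key /Y /X !mulrA.
    have -> : #|{: slot}| = (#|~: reps r| + w + 1)%N.
      by rewrite -(cardsC (reps r)) (card_reps rE rl) -/w addn1 addSn addnC.
    have sk : scale N ^+ k = (N%:R * eps N) ^+ e * scale N ^+ (k - e.*2).
      rewrite -{1}(subnKC ek) exprD -mul2n exprM; congr (_ ^+ _ * _).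
      by rewrite sqr_sqrtr // mulr_ge0 // ltW.
    have s0 : scale N ^+ (k - e.*2) != 0 by rewrite expf_neq0 // gt_eqF // scale_gt0.
    have Nn0 : N%:R != 0 :> R by rewrite pnatr_eq0 -lt0n.
    have Ne : N%:R ^+ e = N%:R ^+ w * N%:R ^+ (e - w) :> R by rewrite -exprD subnKC.
    rewrite !exprVn sk exprMn Ne !exprD expr1.
    have := expf_neq0 (e - w) Nn0; have := expf_neq0 w Nn0.
    have := expf_neq0 #|~: reps r| Nn0.
    have := expf_neq0 e (lt0r_neq0 (eps_gt0 N)); move: s0 Nn0.
    set x1 : R := scale N ^+ _; set x2 : R := N%:R ^+ w; set x3 : R := N%:R ^+ (e - w).
    set x4 : R := N%:R ^+ #|~: reps r|; set x5 : R := eps N ^+ e; set x6 : R := N%:R.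
    move: x1 x2 x3 x4 x5 x6.
    move=> x1 x2 x3 x4 x5 x6 h1 h6 h5 h4 h2 h3; field.
    by rewrite h1 h2 h3 h4 h5 h6.
  apply: cvgMr; apply: cvgM => //; apply: cvgM.
    exact: (cvg_comp _ _ natV0 (@exprn_continuous R (e - w) 0)).
  exact: (cvg_comp _ _ scaleV0 (@exprn_continuous R (k - e.*2) 0)).
have Gle : `|limn (grid_avg pattern_fun)| <= B ^+ e.
  have B0 : 0 <= B ^+ e by rewrite exprn_ge0 // (le_trans ler01).
  apply: (cvgr_to_le (cvg_norm Gcvg)); near=> N.
  have N0 : 0 < (N%:R ^+ #|{: slot}| : R).
    by rewrite exprn_gt0 // ltr0n; near: N; exact: nbhs_infty_gt.
  rewrite /grid_avg normrM ger0_norm ?invr_ge0 ?(ltW N0) // mulrC ler_pdivrMr //.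
  rewrite (le_trans (ler_norm_sum _ _ _)) //.
  apply: (@le_trans _ _ (\sum_(y : {ffun slot -> 'I_N}) B ^+ e)).
    by apply: ler_sum => y _; apply: pattern_fun_le => i; exact: vpos_itv.
  by rewrite sumr_const card_ffun card_ord -natrX mulr_natr.
have pb0 : 0 <= pattern_bound.
  by rewrite /pattern_bound; case: ifP => // _; rewrite exprn_ge0 // (le_trans ler01).
have [d0|d0] := eqVneq (e - w)%N 0%N; last by rewrite expr0n (negbTE d0) !(mul0r, mulr0) normr0.
have [d1|d1] := eqVneq (k - e.*2)%N 0%N.
  rewrite d0 d1 !expr0 !mul1r normrM.
  have ew : e = w by lia.
  have ke : k = e.*2 by lia.
  have -> : pattern_bound = B ^+ e.
    have ok : ~~ odd k by rewrite ke odd_double.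
    have k2 : k./2 = e by rewrite [X in X./2]ke doubleK.
    by rewrite /pattern_bound ok k2 inE rE eqxx rl -/w ew eqxx.
  by rewrite -[leRHS]mul1r ler_pM // norm_links_le1.
by rewrite [0 ^+ (k - _)]expr0n (negbTE d1) !(mul0r, mulr0) normr0.
Unshelve. all: by end_near. Qed.

End OnePattern.

Lemma pattern_cvg (r : {ffun slot -> slot}) : pat r = r -> exists2 L,
  (fun N => (N%:R)^-1 * (scale N)^-1 ^+ k * (links R r *
     (N%:R ^- #|~: reps r| * pattern_sum (edge_q (N := N)) r))) @ \oo --> L &
  `|L| <= pattern_bound r.
Proof.
move=> rE.
have pb0 : 0 <= pattern_bound r.
  by rewrite /pattern_bound; case: ifP => // _; rewrite exprn_ge0 // (le_trans ler01).
have zero : (forall N, links R r * pattern_sum (edge_q (N := N)) r = 0) -> exists2 L,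
  (fun N => (N%:R)^-1 * (scale N)^-1 ^+ k * (links R r *
     (N%:R ^- #|~: reps r| * pattern_sum (edge_q (N := N)) r))) @ \oo --> L &
  `|L| <= pattern_bound r.
  move=> H; exists 0; last by rewrite normr0.
  rewrite [X in X @ _ --> _](_ : _ = fun=> 0); first exact: cvg_cst.
  by apply/funext => N; rewrite [links R r * _]mulrCA H !mulr0.
have [rl|rl] := eqVneq (links R r) 0; first by apply: zero => N; rewrite rl mul0r.
have [/forallP rloop|/forallPn[t /negPn/eqP rt]] :=
  boolP [forall t, r (t, false) != r (t, true)]; last first.
  by apply: zero => N; rewrite (pattern_sum_loop _ rt) mulr0.
have [/forallP rmult|/forallPn[t]] :=
  boolP [forall t, (t \in first_edges r) ==> (1 < mult r t)%N].
  by apply: pattern_cvg_main => // t tf; exact: (implyP (rmult t)).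
rewrite negb_imply -leqNgt => /andP[tf m1]; apply: zero => N.
by rewrite (pattern_sum_simple _ tf) ?mulr0 //; apply/eqP; rewrite eqn_leq m1 mult_gt0.
Qed.

Lemma lap_moment_cvg : exists2 mu,
  (fun N => bexp (edge_q (N := N)) (fun E =>
     N%:R^-1 * \tr (lapmx (edge_q (N := N)) (scale N) E ^+ k))) @ \oo --> mu &
  `|mu| <= (if odd k then 0 else
    (2 ^ k * (2 ^ k * (k./2).+1 ^ k./2))%:R * B ^+ k./2).
Proof.
have H (r : {ffun slot -> slot}) : exists L, pat r = r ->
  (fun N => (N%:R)^-1 * (scale N)^-1 ^+ k * (links R r *
     (N%:R ^- #|~: reps r| * pattern_sum (edge_q (N := N)) r))) @ \oo --> L /\
  `|L| <= pattern_bound r.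
  have [/pattern_cvg[L L1 L2]|rE] := pselect (pat r = r); first by exists L.
  by exists 0 => /rE.
have [L HL] := choice H.
exists (\sum_(r : {ffun slot -> slot} | pat r == r) L r).
  apply: (@cvg_trans _ ((fun N => \sum_(r : {ffun slot -> slot} | pat r == r)
    ((N%:R)^-1 * (scale N)^-1 ^+ k * (links R r *
     (N%:R ^- #|~: reps r| * pattern_sum (edge_q (N := N)) r)))) @ \oo)).
    apply: near_eq_cvg; near=> N.
    have N0 : (0 < N)%N by near: N; exact: nbhs_infty_gt.
    rewrite bexpZ bexp_tr_pattern mulrA -big_distrr; congr (_ * _).
    apply: eq_bigr => r /eqP rE; congr (_ * _).
    rewrite -(pattern_sumE _ rE) mulKf //.
    by rewrite expf_neq0 // pnatr_eq0 -lt0n.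
  by apply: cvg_big => [|r /eqP rE]; [exact: add_continuous|exact: (HL r rE).1].
have B0 : 0 <= B by rewrite (le_trans ler01).
rewrite (le_trans (ler_norm_sum _ _ _)) //.
apply: (@le_trans _ _ (\sum_(r : {ffun slot -> slot} | pat r == r) pattern_bound r)).
  by apply: ler_sum => r /eqP rE; exact: (HL r rE).2.
rewrite /pattern_bound; case: ifPn => /= [_|kodd]; first by rewrite big1.
rewrite -big_mkcondr /= sumr_const -[leLHS]mulr_natl ler_wpM2r ?exprn_ge0 //.
rewrite ler_nat (leq_trans _ (card_cyclic_patterns R (n := n) (K := k./2) _)) //.
  by apply/subset_leq_card/fintype.subsetP => r; rewrite unfold_in => /andP[].
have ok : odd k = false := negbTE kodd.
by rewrite -{1}(odd_double_half k) ok.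
Unshelve. all: by end_near. Qed.

End PatternLimits.

(** * The random graph as a product measure and its matrices *)

Section GraphModel.
Variables (R : realType) (f : R -> R -> R) (eps : nat -> R) (N : nat).
Local Notation q := (@edge_q R f eps N).

Lemma graph_weightE (E : {set 'I_N * 'I_N}) : graph_weight f eps E = bweight q E.
Proof.
rewrite /graph_weight /bweight; case: ifPn => [Eu|/fintype.subsetPn[t tE tu]].
  rewrite [RHS](bigID (fun t => t \in upper N)) /= [X in _ * X]big1 ?mulr1.
    by apply: eq_bigr => t; rewrite inE /edge_q => ->.
  move=> t tu; rewrite (negbTE (contra (fintype.subsetP Eu t) tu)).
  by move: tu; rewrite inE /edge_q => /negbTE ->; rewrite subr0.
rewrite (bigD1 t) //= tE; move: tu; rewrite inE /edge_q => /negbTE ->.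
by rewrite mul0r.
Qed.

Lemma gexpectE X : gexpect f eps X = bexp q X.
Proof. by apply: eq_bigr => E _; rewrite graph_weightE. Qed.

Lemma gprobE (P : pred {set 'I_N * 'I_N}) : gprob f eps P = bexp q (fun E => (P E)%:R).
Proof.
rewrite /gprob big_mkcond; apply: eq_bigr => E _; rewrite graph_weightE.
by case: (P E); rewrite ?mulr1 ?mulr0.
Qed.

Lemma bweight_upper (E : {set 'I_N * 'I_N}) : ~~ (E \subset upper N) -> bweight q E = 0.
Proof. by move=> /negbTE Eu; rewrite -graph_weightE /graph_weight Eu. Qed.

Lemma eq_bexp_upper (F G : {set 'I_N * 'I_N} -> R) :
  (forall E : {set 'I_N * 'I_N}, E \subset upper N -> F E = G E) -> bexp q F = bexp q G.
Proof.
move=> FG; apply: eq_bigr => E _; have [/FG ->//|/bweight_upper ->] := boolP (E \subset upper N).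
by rewrite !mul0r.
Qed.

Lemma ler_bexp_upper (F G : {set 'I_N * 'I_N} -> R) : (forall u, 0 <= q u <= 1) ->
  (forall E : {set 'I_N * 'I_N}, E \subset upper N -> F E <= G E) -> bexp q F <= bexp q G.
Proof.
move=> q01 FG; apply: ler_sum => E _.
have [/FG FGE|/bweight_upper ->] := boolP (E \subset upper N); last by rewrite !mul0r.
by rewrite ler_wpM2l ?bweight_ge0.
Qed.

Lemma adj_upper (E : {set 'I_N * 'I_N}) i l : E \subset upper N ->
  adj R E i l = (ed i l \in E)%:R.
Proof.
move=> /fintype.subsetP Eu; rewrite mxE.
have no (a b : 'I_N) : (b <= a)%N -> ((a, b) \in E) = false.
  by move=> ba; apply/negP => /Eu; rewrite inE /= ltnNge ba.
rewrite /ed; case: ltnP => il.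
  by rewrite (no l i) ?(ltnW il) // orbF; case: ifP.
by rewrite (no i l) //=; case: ifP.
Qed.

Lemma bexp_mem_edge (i l : 'I_N) : bexp q (fun E => (ed i l \in E)%:R) = q (ed i l).
Proof.
have := bexp_prod q (fun u b => if u == ed i l then b%:R else 1 : R).
rewrite (bigD1 (ed i l)) //= eqxx big1 => [|u /negbTE ->]; last by ring.
rewrite mulr1 mulr0 addr0 mulr1 => <-; apply: eq_bexp => E.
by rewrite (bigD1 (ed i l)) //= eqxx big1 ?mulr1 // => u /negbTE ->.
Qed.

Lemma lapmx_row_sum (E : {set 'I_N * 'I_N}) i j :
  \sum_l ((ed i l \in E)%:R - q (ed i l)) * ((l == j)%:R - (i == j)%:R) =
  ((ed i j \in E)%:R - q (ed i j)) - (i == j)%:R * \sum_l ((ed i l \in E)%:R - q (ed i l)).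
Proof.
under eq_bigr do rewrite mulrBr.
rewrite sumrB big_distrr /=; congr (_ - _); last by apply: eq_bigr => l _; rewrite mulrC.
rewrite (bigD1 j) //= eqxx mulr1 big1 ?addr0 // => l /negbTE ->.
by rewrite mulr0.
Qed.

(** [Dmat] removes the mean of the diagonal only, so the adjacency entries keep their means [q]; the
    last matrix collects them. *)
Lemma scaled_centeredE (E : {set 'I_N * 'I_N}) : E \subset upper N ->
  scaled_centered f eps E = lapmx q (scale eps N) E +
    (scale eps N)^-1 *: \matrix_(i, j) q (ed i j).
Proof.
move=> Eu; have noloop (F : {set 'I_N * 'I_N}) i : F \subset upper N -> (ed i i \in F) = false.
  move=> /fintype.subsetP Fu; apply/negP => /Fu.
  by rewrite inE /ed ltnn /= ltnn.
have adjE i l : (if ((i, l) \in E) || ((l, i) \in E) then 1 else 0 : R) = (ed i l \in E)%:R.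
  by rewrite -(adj_upper _ _ Eu) mxE.
apply/matrixP => i j; rewrite !mxE -mulrDr; congr (_ * _).
rewrite lapmx_row_sum.
have [<-|ij] := eqVneq i j; last first.
  by rewrite adjE mul0r; ring.
rewrite (noloop _ _ Eu) edge_q_diag gexpectE mul1r.
have -> : bexp q (fun F => laplacian R F i i) = - \sum_l q (ed i l).
  rewrite (@eq_bexp_upper _ (fun F : {set _} => - \sum_l (ed i l \in F)%:R)).
    by rewrite bexpN bexp_sum; congr (- _); apply: eq_bigr => l _; rewrite bexp_mem_edge.
  move=> F Fu; rewrite mxE eqxx; congr (- _).
  by apply: eq_bigr => l _; rewrite (adj_upper _ _ Fu).
rewrite sumrB; under [X in - X - _]eq_bigr do rewrite (adj_upper _ _ Eu).
rewrite /=; ring.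
Qed.

Lemma tr_lapmxE E s : (lapmx q s E)^T = lapmx q s E.
Proof.
apply/matrixP => i j; rewrite !mxE; congr (_ * _).
rewrite !lapmx_row_sum (edC j i); have [->//|ij] := eqVneq i j.
by rewrite !mul0r.
Qed.

Lemma tr_scaled_centered (E : {set 'I_N * 'I_N}) : (scaled_centered f eps E)^T = scaled_centered f eps E.
Proof.
apply/matrixP => i j; rewrite !mxE; have [->//|ij] := eqVneq i j.
by rewrite orbC.
Qed.

Lemma lapmx_diag E s i : lapmx q s E i i =
  - s^-1 * \sum_l ((ed i l \in E)%:R - q (ed i l)) * (l != i)%:R.
Proof.
rewrite mxE mulNr -mulrN -sumrN; congr (_ * _); apply: eq_bigr => l _.
by rewrite eqxx; case: eqVneq => _ /=; ring.
Qed.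

(** An edge {a, b} enters a Laplacian through (e_a - e_b)^T (e_a - e_b). A pair with t.1 >= t.2
    changes nothing: it is never an [ed i l], or it is a loop, whose two deltas cancel. *)
Lemma lapmx_flip E s (t : 'I_N * 'I_N) :
  lapmx q s (t |: E) - lapmx q s (E :\ t) =
  (if (t.1 < t.2)%N then - s^-1 else 0) *:
    ((delta_mx 0 t.1 - delta_mx 0 t.2)^T *m (delta_mx 0 t.1 - delta_mx 0 t.2 : 'rV_N)).
Proof.
apply/matrixP => i j; rewrite !mxE -mulrBr -sumrB big_ord1 !mxE eqxx /=.
have -> : \sum_l (((ed i l \in t |: E)%:R - q (ed i l)) * ((l == j)%:R - (i == j)%:R) -
    ((ed i l \in E :\ t)%:R - q (ed i l)) * ((l == j)%:R - (i == j)%:R)) =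
  \sum_l (ed i l == t)%:R * ((l == j)%:R - (i == j)%:R) :> R.
  apply: eq_bigr => l _; rewrite -mulrBl !inE.
  by case: (ed i l == t); case: (ed i l \in E) => /=; ring.
case: t => a b /=; case: ltnP => ab.
  have edE l : (ed i l == (a, b)) = ((i == a) && (l == b)) || ((i == b) && (l == a)).
    rewrite /ed; case: ltnP => il; rewrite xpair_eqE -!val_eqE /=; lia.
  rewrite mulNr -mulrN; congr (_ * _).
  have abF : (a == b) = false by apply/negbTE; rewrite -val_eqE /=; lia.
  have baF : (b == a) = false by rewrite eq_sym.
  under eq_bigr do rewrite edE.
  pose F l : R := ((l == j)%:R - (i == j)%:R).
  have sumE : \sum_l ((i == a) && (l == b) || (i == b) && (l == a))%:R * F l =
     (i == a)%:R * F b + (i == b)%:R * F a.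
    rewrite (bigD1 b) //= (bigD1 a) /= ?abF // big1 => [|l /andP[/negbTE lb /negbTE la]].
      by rewrite !eqxx ?baF ?abF !andbT !andbF ?orbF /= ?orbF addr0.
    by rewrite lb la !andbF mul0r.
  rewrite sumE /F; case: (eqVneq i a) => [ia|ia]; case: (eqVneq i b) => [ib|ib] //=.
  - by rewrite -ia -ib eqxx in abF.
  - by rewrite ia ![j == _]eq_sym; ring.
  - by rewrite ib ![j == _]eq_sym; ring.
  - ring.
rewrite mul0r big1 ?mulr0 // => l _.
have -> : (ed i l == (a, b)) = [&& a == b, i == a & l == a].
  rewrite /ed; case: ltnP => il; rewrite xpair_eqE -!val_eqE /=; lia.
by case: and3P => [[/eqP -> /eqP -> /eqP ->]|_]; rewrite ?mul0r // subrr mulr0.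
Qed.

Lemma frob2_outer c (u : 'rV[R]_N) :
  frob2 (c *: (u^T *m u)) = c ^+ 2 * (\sum_a u 0 a ^+ 2) ^+ 2.
Proof.
rewrite /frob2 [X in _ * X]expr2 big_distrl /= big_distrr; apply: eq_bigr => i _ /=.
rewrite big_distrr big_distrr; apply: eq_bigr => j _ /=.
by rewrite !mxE big_ord1 mxE !exprMn.
Qed.

Lemma sum_sqr_delta (a b : 'I_N) :
  \sum_x (delta_mx 0 a - delta_mx 0 b : 'rV[R]_N) 0 x ^+ 2 <= 2.
Proof.
apply: (@le_trans _ _ (\sum_x ((x == a)%:R + (x == b)%:R))).
  apply: ler_sum => x _; rewrite !mxE eqxx /=.
  by case: (x == a); case: (x == b) => /=; lra.
have one (c : 'I_N) : \sum_x (x == c)%:R = 1 :> R.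
  by rewrite (bigD1 c) //= eqxx big1 ?addr0 // => x /negbTE ->.
by rewrite big_split /= !one.
Qed.

End GraphModel.

(** * Taylor and Lipschitz bounds for sine and cosine *)

Section TaylorTrig.
Variable R : realType.
Implicit Types (x y : R) (n J : nat).

Definition divpow n x : R := x ^+ n / n`!%:R.

Lemma is_derive_divpow n x : is_derive x 1 (divpow n.+1) (divpow n x).
Proof.
have -> : divpow n.+1 = (n.+1`!%:R)^-1 \*: id ^+ n.+1.
  by apply/funext => y; rewrite /divpow /= exprfctE [RHS]mulrC.
apply: (is_derive_eq (is_deriveZ _ (is_deriveX n.+1 (is_derive_id x 1)))).
rewrite /= /divpow factS natrM -[_ *: _]/(_ * _) -[X in _ * X]/(_ * 1).
by field; rewrite ?pnatr_eq0 -?lt0n ?fact_gt0 ?[_ + _ != _]gt_eqF //=; rewrite ltr_wpDl.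
Qed.

Lemma is_derive_ge0_le (h h' : R -> R) a b : a <= b ->
  (forall x, is_derive x 1 h (h' x)) -> (forall x, a <= x -> 0 <= h' x) -> h a <= h b.
Proof.
rewrite le_eqVlt => /predU1P[->//|ab] hd h0.
have [c /[!in_itv]/= /andP[ac cb] e] := MVT ab (fun x _ => hd x)
  (derivable_within_continuous (fun x _ => @ex_derive _ _ _ _ _ _ _ (hd x))).
by rewrite -subr_ge0 e mulr_ge0 ?h0 ?subr_ge0 // ltW.
Qed.

(** One integration of a remainder bound: [divpow n.+1] minus or plus [h] is monotone on the
    nonnegative axis, and the negative axis follows by reflection. *)
Lemma is_derive_divpow_bound (h h' : R -> R) n : h 0 = 0 ->
  (forall x, is_derive x 1 h (h' x)) -> (forall x, `|h' x| <= divpow n `|x|) ->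
  forall x, `|h x| <= divpow n.+1 `|x|.
Proof.
have pos (k k' : R -> R) : k 0 = 0 ->
    (forall x, is_derive x 1 k (k' x)) -> (forall x, `|k' x| <= divpow n `|x|) ->
    forall x, 0 <= x -> k x <= divpow n.+1 x.
  move=> k0 kd kb x x0.
  rewrite -subr_ge0 (_ : 0 = divpow n.+1 0 - k 0); last first.
    by rewrite k0 /divpow expr0n mul0r subr0.
  apply: (@is_derive_ge0_le (divpow n.+1 - k) (fun y => divpow n y - k' y)) => // y.
    by apply: is_deriveB => //; exact: is_derive_divpow.
  move=> y0; rewrite subr_ge0 (le_trans (ler_norm _)) // (le_trans (kb y)) //.
  by rewrite ger0_norm.
move=> h0 hd hb x.
have posN (k k' : R -> R) : k 0 = 0 ->
    (forall x, is_derive x 1 k (k' x)) -> (forall x, `|k' x| <= divpow n `|x|) ->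
    forall x, 0 <= x -> `|k x| <= divpow n.+1 x.
  move=> k0 kd kb y y0; rewrite ler_norml (pos k k') // andbT lerNl.
  apply: (pos (- k) (fun z => - k' z)) => //.
    by rewrite /= -[LHS]/(- k 0) k0 oppr0.
  by move=> z; rewrite normrN.
have [x0|x0] := leP 0 x; first by rewrite (ger0_norm x0); exact: (posN h h').
rewrite (ltr0_norm x0).
have -> : h x = (h \o -%R) (- x) by rewrite /= opprK.
apply: (posN _ (fun z => - h' (- z))) => [|z|z|].
- by rewrite /= oppr0.
- have Nd : is_derive z 1 (-%R : R -> R) (-1) by exact: is_deriveN.
  have hN : is_derive (- z : R) 1 h (h' (- z)) := hd (- z).
  apply: (is_derive_eq (@is_derive1_comp _ h -%R z _ _ hN Nd)).
  by rewrite mulrN1.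
- by rewrite normrN -[X in _ <= divpow _ X]normrN.
- by rewrite oppr_ge0 ltW.
Qed.

Definition cosp J x : R := \sum_(j < J) (-1) ^+ j * divpow j.*2 x.
Definition sinp J x : R := \sum_(j < J) (-1) ^+ j * divpow j.*2.+1 x.

Lemma is_derive_sinp J x : is_derive x 1 (sinp J) (cosp J x).
Proof.
elim: J => [|J IH].
  rewrite (_ : sinp 0 = cst 0); last by apply/funext => y; rewrite /sinp big_ord0.
  by rewrite /cosp big_ord0; exact: is_derive_cst.
have -> : sinp J.+1 = sinp J + (-1) ^+ J \*: divpow J.*2.+1.
  by apply/funext => y; rewrite /sinp big_ord_recr.
rewrite /cosp big_ord_recr /=; apply: is_deriveD.
by apply: is_deriveZ; exact: is_derive_divpow.
Qed.

Lemma is_derive_cosp J x : is_derive x 1 (cosp J.+1) (- sinp J x).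
Proof.
elim: J => [|J IH].
  rewrite (_ : cosp 1 = cst 1); last first.
    by apply/funext => y; rewrite /cosp big_ord1 /divpow !expr0 mul1r divr1.
  by rewrite /sinp big_ord0 oppr0; exact: is_derive_cst.
have -> : cosp J.+2 = cosp J.+1 + (-1) ^+ J.+1 \*: divpow J.+1.*2.
  by apply/funext => y; rewrite /cosp big_ord_recr.
rewrite /sinp big_ord_recr /= opprD; apply: is_deriveD.
apply: (is_derive_eq (is_deriveZ _ (is_derive_divpow _ _))).
by rewrite -[_ *: _]/(_ * _) exprS mulN1r mulNr.
Qed.

Lemma cosp0 J : cosp J.+1 0 = 1.
Proof.
rewrite /cosp big_ord_recl big1 ?addr0; first by rewrite /divpow !expr0 mul1r divr1.
by move=> j _; rewrite /divpow expr0n mul0r mulr0.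
Qed.

Lemma sinp0 J : sinp J 0 = 0.
Proof. by rewrite /sinp big1 // => j _; rewrite /divpow expr0n mul0r mulr0. Qed.

Lemma sin_from_cos J n : (forall x, `|cos x - cosp J x| <= divpow n `|x|) ->
  forall x, `|sin x - sinp J x| <= divpow n.+1 `|x|.
Proof.
apply: (@is_derive_divpow_bound (sin - sinp J) (fun x => cos x - cosp J x)).
  by rewrite -[LHS]/(sin 0 - sinp J 0) sin0 sinp0 subr0.
by move=> x; apply: is_deriveB; exact: is_derive_sinp.
Qed.

Lemma cos_from_sin J n : (forall x, `|sin x - sinp J x| <= divpow n `|x|) ->
  forall x, `|cos x - cosp J.+1 x| <= divpow n.+1 `|x|.
Proof.
move=> H; apply: (@is_derive_divpow_bound (cos - cosp J.+1) (fun x => - (sin x - sinp J x))).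
- by rewrite -[LHS]/(cos 0 - cosp J.+1 0) cos0 cosp0 subrr.
- move=> x; apply: (is_derive_eq (is_deriveB (is_derive_cos x) (is_derive_cosp J x))).
  by rewrite opprB opprK addrC.
- by move=> x; rewrite normrN.
Qed.

(** Starting from |cos| <= 1, each passage through the sine and back raises the order by two. *)
Lemma cos_taylor J x : `|cos x - cosp J x| <= divpow J.*2 x.
Proof.
have -> : divpow J.*2 x = divpow J.*2 `|x|.
  by rewrite /divpow -mul2n exprM -[in LHS]real_normK ?num_real // -exprM.
elim: J x => [|J IH] x; last by rewrite doubleS; exact/cos_from_sin/sin_from_cos.
by rewrite /cosp big_ord0 subr0 /divpow expr0 divr1 cos_max.
Qed.

(** The even order, one below the natural one, makes the spectral integral of the remainder an even
    moment. *)
Lemma sin_taylor J x : `|sin x - sinp J x| <= divpow J.*2 x.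
Proof.
have -> : divpow J.*2 x = divpow J.*2 `|x|.
  by rewrite /divpow -mul2n exprM -[in LHS]real_normK ?num_real // -exprM.
elim: J x => [|J IH] x; last by rewrite doubleS; exact/sin_from_cos/cos_from_sin.
by rewrite /sinp big_ord0 subr0 /divpow expr0 divr1 sin_max.
Qed.

Lemma sin_linear x : `|sin x - x| <= x ^+ 2.
Proof.
have := sin_taylor 1 x; rewrite /sinp big_ord1 /divpow expr0 !mul1r expr1 divr1.
move=> /le_trans; apply; rewrite ler_pdivrMr // ler_peMr ?sqr_ge0 //.
by rewrite ler1n.
Qed.

Lemma cos_linear x : `|cos x - 1| <= x ^+ 2.
Proof.
have := cos_taylor 1 x; rewrite /cosp big_ord1 /divpow !expr0 mul1r divr1.
move=> /le_trans; apply; rewrite ler_pdivrMr // ler_peMr ?sqr_ge0 //.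
by rewrite ler1n.
Qed.

Lemma cos_second x y : `|cos x - cos y - (- sin y) * (x - y)| <= 2 * (x - y) ^+ 2.
Proof.
have {1}-> : x = y + (x - y) by ring.
set d := x - y; rewrite cosD.
have -> : cos y * cos d - sin y * sin d - cos y - - sin y * d =
  cos y * (cos d - 1) - sin y * (sin d - d) by ring.
rewrite (le_trans (ler_normB _ _)) // !normrM mulr_natl mulr2n.
by apply: lerD; rewrite -[leRHS]mul1r ler_pM // ?cos_max ?sin_max ?cos_linear ?sin_linear.
Qed.

Lemma sin_second x y : `|sin x - sin y - cos y * (x - y)| <= 2 * (x - y) ^+ 2.
Proof.
have {1}-> : x = y + (x - y) by ring.
set d := x - y; rewrite sinD.
have -> : sin y * cos d + cos y * sin d - sin y - cos y * d =
  sin y * (cos d - 1) + cos y * (sin d - d) by ring.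
rewrite (le_trans (ler_normD _ _)) // !normrM mulr_natl mulr2n.
by apply: lerD; rewrite -[leRHS]mul1r ler_pM // ?cos_max ?sin_max ?cos_linear ?sin_linear.
Qed.

Lemma is_derive_lip (h h' : R -> R) : (forall x, is_derive x 1 h (h' x)) ->
  (forall x, `|h' x| <= 1) -> forall x y, `|h x - h y| <= `|x - y|.
Proof.
move=> hd h1.
suff H x y : x <= y -> `|h y - h x| <= y - x.
  move=> x y; have [xy|yx] := leP x y.
    by rewrite distrC [leRHS]distrC [leRHS]ger0_norm ?subr_ge0 ?H.
  by rewrite [leRHS]ger0_norm ?subr_ge0 ?H ?(ltW yx).
move=> xy; have [c _ ->] := MVT_segment xy (fun x _ => hd x)
  (derivable_within_continuous (fun x _ => @ex_derive _ _ _ _ _ _ _ (hd x))).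
by rewrite normrM [X in _ * X]ger0_norm ?subr_ge0 // ler_piMl ?subr_ge0.
Qed.

Lemma cos_lip x y : `|cos x - cos y| <= `|x - y|.
Proof.
by apply: (is_derive_lip (fun z => is_derive_cos z)) => z; rewrite normrN sin_max.
Qed.

Lemma sin_lip x y : `|sin x - sin y| <= `|x - y|.
Proof. exact: (is_derive_lip (fun z => is_derive_sin z) (@cos_max R)). Qed.

End TaylorTrig.

Lemma approx_cvg0 (R : realType) (u : nat -> R) :
  (forall e : R, 0 < e -> \forall N \near \oo, `|u N| <= e) -> u @ \oo --> 0.
Proof. by move=> H; apply/cvgr0Pnorm_le. Qed.

(** The last J factors of (2J)! are at least J + 1. This is what absorbs the growth (J+1)^J of the
    moments and leaves 1/J!. *)
Lemma leq_fact_double J : (J`! * J.+1 ^ J <= (J.*2)`!)%N.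
Proof.
suff H m : (J`! * J.+1 ^ m <= (J + m)`!)%N by rewrite -addnn.
elim: m => [|m IH]; first by rewrite addn0 muln1.
by rewrite expnS mulnCA addnS factS leq_mul // ltnS leq_addr.
Qed.

(** * From moments to trigonometric integrals *)

Section MomentsToTrig.
Variables (R : realType) (e : nat -> (R -> R) -> R) (mu : nat -> R) (C : R).
Hypothesis eD : forall N g h, e N (fun x => g x + h x) = e N g + e N h.
Hypothesis eZ : forall N c g, e N (fun x => c * g x) = c * e N g.
Hypothesis ele : \forall N \near \oo, forall g h : R -> R,
  (forall x, g x <= h x) -> e N g <= e N h.
Hypothesis e_mu : forall k, (fun N => e N (fun x => x ^+ k)) @ \oo --> mu k.
Hypothesis mu_odd : forall k, odd k -> mu k = 0.
Hypothesis mu_le : forall J, `|mu J.*2| <= C ^+ J * J.+1%:R ^+ J.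

Lemma functional_sum N (I : Type) (r : seq I) (c : I -> R) (g : I -> R -> R) :
  e N (fun x => \sum_(i <- r) c i * g i x) = \sum_(i <- r) c i * e N (g i).
Proof.
elim: r => [|i r IH].
  rewrite big_nil (_ : (fun x => _) = fun x : R => 0 * 0).
    by rewrite eZ mul0r.
  by apply/funext => x; rewrite big_nil mul0r.
rewrite big_cons -eZ -IH -eD; congr (e N _); apply/funext => x.
by rewrite big_cons.
Qed.

(** By [leq_fact_double] the quantity is at most (t^2 C)^J / J!, a term of an exponential series. *)
Lemma moment_tail (t eta : R) : 0 < eta ->
  exists J, t ^+ J.*2 / (J.*2)`!%:R * mu J.*2 <= eta.
Proof.
move=> eta0; have [J _ /(_ J (leqnn J)) HJ] := cvgr_le _ (cvg_exp_coeff (t ^+ 2 * C)) _ eta0.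
exists J; apply: le_trans HJ; rewrite /exp_coeff /=.
have tJ : 0 <= t ^+ J.*2 by rewrite -mul2n exprM exprn_ge0 ?sqr_ge0.
rewrite (le_trans (ler_wpM2l _ (le_trans (ler_norm _) (mu_le J)))) ?divr_ge0 //.
have C0 : 0 <= C ^+ J.
  have := le_trans (normr_ge0 _) (mu_le J).
  by rewrite pmulr_lge0 // exprn_gt0 ?ltr0n.
rewrite exprMn -exprM mul2n.
have -> : t ^+ J.*2 / (J.*2)`!%:R * (C ^+ J * J.+1%:R ^+ J) =
  t ^+ J.*2 * C ^+ J * (J.+1%:R ^+ J / (J.*2)`!%:R) by ring.
rewrite ler_wpM2l ?mulr_ge0 // ler_pdivrMr ?ltr0n ?fact_gt0 //.
by rewrite mulrC ler_pdivlMr ?ltr0n ?fact_gt0 // mulrC -natrX -natrM ler_nat leq_fact_double.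
Qed.

Section OneFunction.
Variables (t : R) (g : R -> R) (d : nat -> nat) (p : nat -> R -> R).
Hypothesis gp : forall J x, `|g x - p J x| <= divpow J.*2 x.
Hypothesis pE : forall J x, p J x = \sum_(j < J) (-1) ^+ j * divpow (d j) x.

(** Monotonicity of [e N] turns the pointwise remainder into an even moment whose limit is below
    eta/4. The exponents [d] let one argument serve both sine and cosine. *)
Lemma functional_taylor eta : 0 < eta -> exists J, \forall N \near \oo,
  `|e N (fun x => g (t * x)) - \sum_(j < J) (-1) ^+ j * (t ^+ d j / (d j)`!%:R) * mu (d j)|
    <= eta.
Proof.
move=> eta0; have eta2 : 0 < eta / 4 by rewrite divr_gt0.
have [J HJ] := moment_tail t eta2; exists J.
pose q x := \sum_(j < J) ((-1) ^+ j * (t ^+ d j / (d j)`!%:R)) * x ^+ d j.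
have q_cvg : (fun N => e N q) @ \oo -->
    \sum_(j < J) (-1) ^+ j * (t ^+ d j / (d j)`!%:R) * mu (d j).
  under eq_fun do rewrite functional_sum.
  by apply: cvg_big => [|j _]; [exact: add_continuous|apply: cvgMr; exact: e_mu].
pose tau N := t ^+ J.*2 / (J.*2)`!%:R * e N (fun x => x ^+ J.*2).
have tau_cvg : tau @ \oo --> t ^+ J.*2 / (J.*2)`!%:R * mu J.*2.
  by apply: cvgMr; exact: e_mu.
near=> N.
have mono : forall g h : R -> R, (forall x, g x <= h x) -> e N g <= e N h by near: N.
have gq : `|e N (fun x => g (t * x)) - e N q| <= tau N.
  have b x : `|g (t * x) - q x| <= t ^+ J.*2 / (J.*2)`!%:R * x ^+ J.*2.
    have := gp J (t * x); rewrite pE /divpow exprMn mulrAC; apply: le_trans.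
    rewrite /q [X in _ <= `|_ - X|](eq_bigr (fun j : 'I_J =>
      (-1) ^+ j * (t ^+ d j / (d j)`!%:R) * x ^+ d j)) // => j _.
    by rewrite exprMn; ring.
  have H1 : e N q <= e N (fun x => g (t * x)) + tau N.
    rewrite /tau -eZ -eD; apply: mono => x.
    by have := b x; rewrite ler_norml; lra.
  have H2 : e N (fun x => g (t * x)) <= e N q + tau N.
    rewrite /tau -eZ -eD; apply: mono => x.
    by have := b x; rewrite ler_norml; lra.
  by rewrite ler_norml; lra.
have tN : tau N <= eta / 2.
  near: N; apply: (cvgr_le _ tau_cvg); lra.
have qN : `|\sum_(j < J) (-1) ^+ j * (t ^+ d j / (d j)`!%:R) * mu (d j) - e N q| <= eta / 4.
  by near: N; move/cvgrPdist_le: q_cvg; exact.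
move: gq qN; rewrite !ler_norml; lra.
Unshelve. all: by end_near. Qed.

End OneFunction.

Lemma functional_cos_cvg t : cvgn (fun N => e N (fun x => cos (t * x))).
Proof.
apply: approx_cvgn => eta eta0.
have [J H] := functional_taylor t (d := double) (@cos_taylor R) (fun J x => erefl) eta0.
by eexists; exact: H.
Qed.

Lemma functional_sin_cvg t : (fun N => e N (fun x => sin (t * x))) @ \oo --> 0.
Proof.
apply: approx_cvg0 => eta eta0.
have [J] := functional_taylor t (d := fun j => j.*2.+1) (@sin_taylor R)
  (fun J x => erefl) eta0.
rewrite big1 => [|j _]; last by rewrite mu_odd ?mulr0 //= odd_double.
by apply: filterS => N; rewrite subr0.
Qed.

End MomentsToTrig.

(** * Convergence in L^1 of the trigonometric integrals *)

Section TrigConvergence.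
Variables (R : realType) (f : R -> R -> R) (eps : nat -> R) (B : R).
Hypothesis B1 : 1 <= B.
Hypothesis fB : forall x y : R, 0 <= x <= 1 -> 0 <= y <= 1 -> 0 <= f x y <= B.
Hypothesis fC : forall x y : R, 0 <= x <= 1 -> 0 <= y <= 1 -> f x y = f y x.
Hypothesis fu : forall e : R, 0 < e -> exists2 d : R, 0 < d &
  forall x y x' y' : R, 0 <= x <= 1 -> 0 <= y <= 1 -> 0 <= x' <= 1 -> 0 <= y' <= 1 ->
    `|x - x'| <= d -> `|y - y'| <= d -> `|f x y - f x' y'| <= e.
Hypothesis eps_gt0 : forall N, 0 < eps N.
Hypothesis eps0 : eps @ \oo --> 0.
Hypothesis Neps : (fun N => N%:R * eps N) @ \oo --> +oo.

Local Notation q := (edge_q f eps).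
Local Notation sc := (scale eps).
Local Notation M0 N := (lapmx (@edge_q R f eps N) (scale eps N)).

Definition lap_functional N (g : R -> R) : R :=
  bexp (q (N := N)) (fun E => esd_int (M0 N E) g).

Definition esd_cvg (g : R -> R) (l : R) :=
  (fun N => bexp (q (N := N)) (fun E => `|esd_int (scaled_centered f eps E) g - l|))
    @ \oo --> 0.

Lemma edge_q_le N u : q (N := N) u <= eps N * B.
Proof.
rewrite /edge_q; case: ifP => _; last by rewrite mulr_ge0 ?(ltW (eps_gt0 _)) ?(le_trans ler01).
have /andP[_ fb] := fB (vpos_itv R u.1) (vpos_itv R u.2).
by rewrite /edge_prob ler_wpM2l // ltW.
Qed.

Lemma edge_q_ge0 N u : 0 <= q (N := N) u.
Proof.
rewrite /edge_q; case: ifP => _ //.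
have /andP[f0 _] := fB (vpos_itv R u.1) (vpos_itv R u.2).
by rewrite /edge_prob mulr_ge0 // ltW.
Qed.

Lemma sqr_scale N : sc N ^+ 2 = N%:R * eps N.
Proof. by rewrite sqr_sqrtr // mulr_ge0 // ltW. Qed.

(** There are N^2 entries with squares at most (eps B)^2 / (N eps), so the normalised norm vanishes
    with [eps N]. *)
Lemma frob2_mean N : (0 < N)%N ->
  N%:R^-1 * frob2 ((sc N)^-1 *: \matrix_(i, j) q (N := N) (ed i j)) <= eps N * B ^+ 2.
Proof.
move=> N0; have Nr : 0 < (N%:R : R) by rewrite ltr0n.
have e0 := eps_gt0 N.
rewrite mulrC ler_pdivrMr //.
apply: (@le_trans _ _ (\sum_(i < N) \sum_(j < N) (N%:R * eps N)^-1 * (eps N * B) ^+ 2)).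
  apply: ler_sum => i _; apply: ler_sum => j _; rewrite !mxE exprMn exprVn sqr_scale.
  rewrite ler_wpM2l ?invr_ge0 ?mulr_ge0 ?(ltW e0) //.
  by rewrite ler_pXn2r ?nnegrE ?edge_q_ge0 ?edge_q_le // mulr_ge0 ?(ltW e0) // (le_trans ler01).
rewrite !sumr_const !card_ord -[leLHS]mulr_natr -[X in X * _ <= _]mulr_natr.
have -> : (N%:R * eps N)^-1 * (eps N * B) ^+ 2 * N%:R * N%:R = eps N * B ^+ 2 * N%:R.
  by field; rewrite !gt_eqF.
by [].
Qed.

Lemma bexp_compare N (g : R -> R) L eta : (0 < N)%N -> (forall u, 0 <= q (N := N) u <= 1) ->
  (forall x y, `|g x - g y| <= L * `|x - y|) -> 0 <= L -> 0 < eta ->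
  bexp (q (N := N)) (fun E => `|esd_int (scaled_centered f eps E) g - esd_int (M0 N E) g|)
    <= L * (eta + eta^-1 * (eps N * B ^+ 2)).
Proof.
move=> N0 q01 gL L0 eta0; rewrite -[leRHS](bexp_cst (q (N := N))).
apply: ler_bexp_upper => // E Eu.
rewrite (le_trans (esd_lipschitz N0 (tr_scaled_centered _ _ _) (tr_lapmxE _ _ _ _) gL L0 eta0)) //.
rewrite ler_wpM2l // lerD2l ler_wpM2l ?invr_ge0 ?(ltW eta0) //.
by rewrite scaled_centeredE // [X in frob2 X]addrAC subrr add0r frob2_mean.
Qed.

Lemma esd_flip N (g g' : R -> R) L C t E : (0 < N)%N ->
  (forall x, `|g' x| <= L) -> 0 <= L -> 0 <= C ->
  (forall x y, `|g x - g y - g' y * (x - y)| <= C * (x - y) ^+ 2) ->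
  `|esd_int (M0 N (t |: E)) g - esd_int (M0 N (E :\ t)) g| <=
    N%:R^-1 * (L * ((sc N)^-1 * 2) + C * ((sc N)^-1 ^+ 2 * 2 ^+ 2)).
Proof.
move=> N0 g'L L0 C0 gC; have s0 := scale_gt0 eps_gt0 N0.
have sV0 : 0 <= (sc N)^-1 by rewrite invr_ge0 ltW.
rewrite (le_trans (esd_rank_one N0 (tr_lapmxE _ _ _ _) (tr_lapmxE _ _ _ _)
  (lapmx_flip _ _ _ _ _) g'L C0 gC)) //.
rewrite ler_wpM2l ?invr_ge0 // lapmx_flip frob2_outer.
set c : R := if _ then _ else _.
have cs : `|c| <= (sc N)^-1.
  by rewrite /c; case: ifP => _; rewrite ?normr0 // normrN ger0_norm.
have sq := sum_sqr_delta R t.1 t.2.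
have sq0 : 0 <= \sum_a (delta_mx 0 t.1 - delta_mx 0 t.2 : 'rV[R]_N) 0 a ^+ 2.
  by apply: sumr_ge0 => a _; rewrite sqr_ge0.
apply: lerD; rewrite ler_wpM2l // ler_pM ?sqr_ge0 //.
  by rewrite -real_normK ?num_real // ler_pXn2r ?nnegrE.
by rewrite ler_pXn2r ?nnegrE.
Qed.

(** In Efron-Stein the N^2 pairs cancel the squared factor 1/N of each influence, leaving [eps N]
    times a quantity that vanishes with 1/scale. *)
Lemma lap_variance N (g g' : R -> R) L C : (0 < N)%N ->
  (forall u, 0 <= q (N := N) u <= 1) ->
  (forall x, `|g' x| <= L) -> 0 <= L -> 0 <= C ->
  (forall x y, `|g x - g y - g' y * (x - y)| <= C * (x - y) ^+ 2) ->
  bexp (q (N := N)) (fun E => (esd_int (M0 N E) g - lap_functional N g) ^+ 2) <=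
    eps N * B * (L * ((sc N)^-1 * 2) + C * ((sc N)^-1 ^+ 2 * 2 ^+ 2)) ^+ 2.
Proof.
move=> N0 q01 g'L L0 C0 gC.
pose d := N%:R^-1 * (L * ((sc N)^-1 * 2) + C * ((sc N)^-1 ^+ 2 * 2 ^+ 2)).
have := @bexp_var _ _ (q (N := N)) q01 (fun E => esd_int (M0 N E) g) (fun=> d)
  (fun t E => esd_flip t E N0 g'L L0 C0 gC).
move=> /le_trans; apply.
apply: (@le_trans _ _ (\sum_(t : 'I_N * 'I_N) eps N * B * d ^+ 2)).
  by apply: ler_sum => t _; rewrite ler_wpM2r ?sqr_ge0 // edge_q_le.
rewrite sumr_const card_prod !card_ord -[leLHS]mulr_natr natrM /d.
set a := L * _ + _.
have -> : eps N * B * (N%:R^-1 * a) ^+ 2 * (N%:R * N%:R) = eps N * B * a ^+ 2.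
  by field; rewrite pnatr_eq0 -lt0n.
by [].
Qed.

(** Passes from a variance bound to an L^1 bound without square roots. *)
Lemma le_add_sqr (x eta : R) : 0 < eta -> `|x| <= eta + eta^-1 * x ^+ 2.
Proof.
move=> eta0; rewrite -(ler_pM2l eta0) mulrDr mulrA mulfV ?gt_eqF // mul1r.
by rewrite -(real_normK (num_real x)); have := normr_ge0 x; set y := `|x|; nra.
Qed.

Lemma esd_cvg_smooth (g g' : R -> R) L C l : 0 <= L -> 0 <= C ->
  (forall x y, `|g x - g y| <= L * `|x - y|) -> (forall x, `|g' x| <= L) ->
  (forall x y, `|g x - g y - g' y * (x - y)| <= C * (x - y) ^+ 2) ->
  (fun N => lap_functional N g) @ \oo --> l -> esd_cvg g l.
Proof.
move=> L0 C0 gL g'L gC gl; apply: approx_cvg0 => e e0.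
(* [L + 1] replaces [L] as a divisor, since [L] may be 0. *)
pose eta := e / (4 * (L + 1)).
have L1 : 0 < L + 1 by rewrite ltr_wpDl.
have eta0 : 0 < eta by rewrite divr_gt0 // mulr_gt0.
have eta4 : L * eta <= e / 4.
  have -> : e / 4 = (L + 1) * eta by rewrite /eta; field; rewrite gt_eqF.
  by rewrite ler_wpM2r ?(ltW eta0) // lerDl.
pose err N := L * (eta + eta^-1 * (eps N * B ^+ 2)) + (e / 4 + (e / 4)^-1 *
  (eps N * B * (L * ((sc N)^-1 * 2) + C * ((sc N)^-1 ^+ 2 * 2 ^+ 2)) ^+ 2)) + e / 8.
have err_cvg : err @ \oo --> L * (eta + eta^-1 * (0 * B ^+ 2)) + (e / 4 + (e / 4)^-1 *
  (0 * B * (L * (0 * 2) + C * (0 ^+ 2 * 2 ^+ 2)) ^+ 2)) + e / 8.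
  have sV := scaleV0 eps_gt0 Neps.
  apply: cvgD; last exact: cvg_cst.
  apply: cvgD.
    by apply: cvgMr; apply: cvgD; [exact: cvg_cst|apply: cvgMr; apply: cvgMl].
  apply: cvgD; first exact: cvg_cst.
  have sV2 : (fun N => (sc N)^-1 ^+ 2) @ \oo --> (0 ^+ 2 : R).
    exact: (cvg_comp _ _ sV (@exprn_continuous R 2 0)).
  have inner : (fun N => L * ((sc N)^-1 * 2) + C * ((sc N)^-1 ^+ 2 * 2 ^+ 2)) @ \oo -->
      (L * (0 * 2) + C * (0 ^+ 2 * 2 ^+ 2) : R).
    by apply: cvgD; apply: cvgMr; apply: cvgMl.
  apply: cvgMr; apply: cvgM; first exact: cvgMl.
  exact: (cvg_comp _ _ inner (@exprn_continuous R 2 _)).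
near=> N.
have N0 : (0 < N)%N by near: N; exact: nbhs_infty_gt.
have q01 : forall u, 0 <= q (N := N) u <= 1 by near: N; exact: (near_edge_q B1 fB).
have errN : err N <= e.
  near: N; apply: (cvgr_le _ err_cvg); move: eta4; rewrite !mul0r !mulr0 !addr0; lra.
rewrite ger0_norm; last by apply: bexp_ge0.
apply: le_trans errN; rewrite /err.
have lN : `|lap_functional N g - l| <= e / 8.
  rewrite distrC; near: N; move/cvgrPdist_le: gl; apply; lra.
have e4 : 0 < e / 4 by lra.
apply: (@le_trans _ _ (bexp (q (N := N)) (fun E =>
  `|esd_int (scaled_centered f eps E) g - esd_int (M0 N E) g| +
  (e / 4 + (e / 4)^-1 * (esd_int (M0 N E) g - lap_functional N g) ^+ 2) + e / 8))).
  apply: ler_bexp => // E.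
  set a := esd_int _ _; set b := esd_int _ _; set c := lap_functional _ _ in lN *.
  have -> : a - l = (a - b) + (b - c) + (c - l) by ring.
  rewrite (le_trans (ler_normD _ _)) // lerD // (le_trans (ler_normD _ _)) // lerD //.
  exact: le_add_sqr.
rewrite !bexpD !bexp_cst bexpZ lerD2r lerD //.
  exact: bexp_compare.
by rewrite lerD2l ler_wpM2l ?invr_ge0 ?(ltW e4) // (lap_variance (g' := g')).
Unshelve. all: by end_near. Qed.

Lemma lap_functionalD N g h :
  lap_functional N (fun x => g x + h x) = lap_functional N g + lap_functional N h.
Proof. by rewrite -bexpD; apply: eq_bexp => E; rewrite esdD. Qed.

Lemma lap_functionalZ N c g : lap_functional N (fun x => c * g x) = c * lap_functional N g.
Proof. by rewrite -bexpZ; apply: eq_bexp => E; rewrite esdZ. Qed.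

Lemma near_ler_lap_functional : \forall N \near \oo, forall g h : R -> R,
  (forall x, g x <= h x) -> lap_functional N g <= lap_functional N h.
Proof.
near=> N => g h gh.
have N0 : (0 < N)%N by near: N; exact: nbhs_infty_gt.
have q01 : forall u, 0 <= q (N := N) u <= 1 by near: N; exact: (near_edge_q B1 fB).
by apply: ler_bexp => // E; exact: ler_esd.
Unshelve. all: by end_near. Qed.

Lemma lap_functional_moments : exists mu : nat -> R,
  [/\ forall k, (fun N => lap_functional N (fun x => x ^+ k)) @ \oo --> mu k,
      forall k, odd k -> mu k = 0 &
      forall J, `|mu J.*2| <= (16 * B) ^+ J * J.+1%:R ^+ J].
Proof.
have powE N k : lap_functional N (fun x => x ^+ k) =
    bexp (q (N := N)) (fun E => N%:R^-1 * \tr (M0 N E ^+ k)).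
  by apply: eq_bexp => E; rewrite esd_pow // tr_lapmxE.
have [mu Hmu] := choice (fun n => let: ex_intro2 m P Q :=
  lap_moment_cvg B1 fB fC fu eps_gt0 eps0 Neps n in ex_intro (fun m => _ /\ _) m (conj P Q)).
(* The walk expansion covers positive exponents only: [mu n] belongs to the power n + 1, and the
   zeroth moment is 1. *)
exists (fun k => if k is n.+1 then mu n else 1); split.
- move=> [|n].
    apply: (@cvg_trans _ ((fun=> 1 : R) @ \oo)); last exact: cvg_cst.
    apply: near_eq_cvg; near=> N.
    have N0 : (0 < N)%N by near: N; exact: nbhs_infty_gt.
    rewrite powE -[LHS](bexp_cst (q (N := N))); apply: eq_bexp => E.
    by rewrite expr0 mxtrace1 mulVf // pnatr_eq0 -lt0n.
  by under eq_fun do rewrite powE; exact: (Hmu n).1.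
- move=> [//|n] odd_n; have := (Hmu n).2; rewrite odd_n normr_le0.
  by move=> /eqP.
move=> [|J]; first by rewrite normr1 !expr0 mulr1.
rewrite doubleS; have := (Hmu J.*2.+1).2.
rewrite -doubleS odd_double doubleK => /le_trans; apply.
(* The pattern count has two factors 2^k with k = 2 (J + 1); this is the origin of 16. *)
have -> : (2 ^ J.+1.*2 = 4 ^ J.+1)%N by rewrite -mul2n expnM.
have -> : 16 = 4 * 4 :> R by ring.
by rewrite !natrM !natrX !exprMn !mulrA [leRHS]mulrAC.
Unshelve. all: by end_near. Qed.

Lemma esd_cvg_cos t : exists l, esd_cvg (fun x => cos (t * x)) l.
Proof.
have [mu [m1 m2 m3]] := lap_functional_moments.
have := functional_cos_cvg lap_functionalD lap_functionalZ near_ler_lap_functional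
  m1 m3 (t := t).
set l := limn _ => lE; exists l.
apply: (@esd_cvg_smooth _ (fun x => t * - sin (t * x)) `|t| (2 * t ^+ 2)) => //.
- by rewrite mulr_ge0 ?sqr_ge0.
- by move=> x y; rewrite (le_trans (cos_lip _ _)) // -mulrBr normrM.
- by move=> x; rewrite normrM normrN ler_piMr // sin_max.
- move=> x y; have := cos_second (t * x) (t * y).
  have -> : - sin (t * y) * (t * x - t * y) = t * - sin (t * y) * (x - y) by ring.
  by have -> : 2 * (t * x - t * y) ^+ 2 = 2 * t ^+ 2 * (x - y) ^+ 2 by ring.
Qed.

Lemma esd_cvg_sin t : esd_cvg (fun x => sin (t * x)) 0.
Proof.
have [mu [m1 m2 m3]] := lap_functional_moments.
have lE := functional_sin_cvg lap_functionalD lap_functionalZ near_ler_lap_functional m1 m2 m3 t.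
apply: (@esd_cvg_smooth _ (fun x => t * cos (t * x)) `|t| (2 * t ^+ 2)) => //.
- by rewrite mulr_ge0 ?sqr_ge0.
- by move=> x y; rewrite (le_trans (sin_lip _ _)) // -mulrBr normrM.
- by move=> x; rewrite normrM ler_piMr // cos_max.
- move=> x y; have := sin_second (t * x) (t * y).
  have -> : cos (t * y) * (t * x - t * y) = t * cos (t * y) * (x - y) by ring.
  by have -> : 2 * (t * x - t * y) ^+ 2 = 2 * t ^+ 2 * (x - y) ^+ 2 by ring.
Qed.

(** The second moment is the normalised [frob2], so the bound passes from [lapmx] to the full matrix
    by [frob2D]. It supplies tightness throughout the rest. *)
Lemma esd_second_moment : exists K : R, \forall N \near \oo,
  bexp (q (N := N)) (fun E => esd_int (scaled_centered f eps E) (fun x => x ^+ 2)) <= K.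
Proof.
have [mu [m1 _ _]] := lap_functional_moments.
exists (2 * (mu 2%N + 1) + 2 * (1 * B ^+ 2)); near=> N.
have N0 : (0 < N)%N by near: N; exact: nbhs_infty_gt.
have q01 : forall u, 0 <= q (N := N) u <= 1 by near: N; exact: (near_edge_q B1 fB).
have m2 : lap_functional N (fun x => x ^+ 2) <= mu 2%N + 1.
  by near: N; apply: (cvgr_le _ (m1 2%N)); rewrite ltrDl.
have e1 : eps N <= 1 by near: N; apply: (cvgr_le _ eps0).
have frobE (A : 'M[R]_N) : A^T = A -> esd_int A (fun x => x ^+ 2) = N%:R^-1 * frob2 A.
  by move=> AT; rewrite esd_pow // frob2E AT expr2.
apply: (@le_trans _ _ (bexp (q (N := N)) (fun E =>
   2 * esd_int (M0 N E) (fun x => x ^+ 2) + 2 * (1 * B ^+ 2)))).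
  apply: ler_bexp_upper => // E Eu.
  rewrite !frobE ?tr_scaled_centered ?tr_lapmxE // scaled_centeredE //.
  rewrite (le_trans (ler_wpM2l _ (frob2D _ _))) ?invr_ge0 //.
  rewrite mulrDr ![N%:R^-1 * (2 * _)]mulrCA lerD2l ler_wpM2l //.
  by rewrite (le_trans (frob2_mean N0)) // ler_wpM2r ?sqr_ge0.
by rewrite bexpD bexpZ bexp_cst lerD2r ler_wpM2l.
Unshelve. all: by end_near. Qed.

End TrigConvergence.

(** * Uniform continuity and Bernstein polynomials *)

Section UniformContinuity.
Variable R : realType.

(** Heine-Cantor by the near-covering form of compactness: a local modulus valid near each point
    extends to one for the whole square. *)
Lemma continuous_square_uniform (h : R * R -> R) :
  {within [set p : R * R | p.1 \in `[0, 1] /\ p.2 \in `[0, 1]], continuous h} ->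
  forall e : R, 0 < e -> exists2 d : R, 0 < d &
    forall p p', 0 <= p.1 <= 1 -> 0 <= p.2 <= 1 -> 0 <= p'.1 <= 1 -> 0 <= p'.2 <= 1 ->
     `|p.1 - p'.1| <= d -> `|p.2 - p'.2| <= d -> `|h p - h p'| <= e.
Proof.
move=> hc e e0; set K := [set p : R * R | _] in hc.
have KE : K = `[0, 1] `*` `[0, 1] by [].
have cK : compact K.
  by rewrite KE; apply: compact_setX; exact: segment_compact.
pose P (d : R) (p : R * R) := forall p', K p' ->
  `|p.1 - p'.1| <= d -> `|p.2 - p'.2| <= d -> `|h p - h p'| <= e.
have HP : forall p, K p -> \forall p' \near p & d \near 0^'+, K p' -> P d p'.
  move=> p Kp.
  have e2 : 0 < e / 2 by rewrite divr_gt0.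
  have /subspace_continuousP/(_ p Kp)/cvgrPdist_le/(_ _ e2) := hc.
  rewrite near_withinE => /nbhs_ballP[r /= r0 Hr].
  have r2 : 0 < r / 2 by rewrite divr_gt0.
  near=> p' d => Kp' p'' Kp'' d1 d2.
  have bp : ball p (r / 2) p' by near: p'; exact: nbhsx_ballx.
  have dr : d <= r / 2 by near: d; exact: nbhs_right_le.
  have inball z z' z'' : ball (z : R) (r / 2) z' -> `|z' - z''| <= d -> ball z r z''.
    rewrite /ball /= => b1 b2.
    have -> : z - z'' = (z - z') + (z' - z'') by ring.
    by rewrite (le_lt_trans (ler_normD _ _)) // (splitr r) ltr_leD // (le_trans b2).
  have H1 : `|h p - h p'| <= e / 2.
    apply: Hr => //; apply: le_ball bp; rewrite ler_pdivrMr // ler_peMr ?(ltW r0) //.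
    by rewrite ler1n.
  have H2 : `|h p - h p''| <= e / 2.
    by apply: Hr => //; split; [apply: inball bp.1 d1|apply: inball bp.2 d2].
  have -> : h p' - h p'' = (h p - h p'') - (h p - h p') by ring.
  by rewrite (le_trans (ler_normB _ _)) // (splitr e) lerD.
have := (near_covering_withinP K).2 ((compact_near_coveringP K).1 cK) R (0^'+) P _ HP.
move=> /(_ (at_right_proper_filter 0)) near_d.
near (0 : R)^'+ => d.
exists d => // p p' p1 p2 p'1 p'2 d1 d2.
have KP : K `<=` P d by near: d; exact: near_d.
apply: (KP p _ p' _ d1 d2); rewrite /K /= !in_itv /=; first by rewrite p1 p2.
by rewrite p'1 p'2.
Unshelve. all: by end_near. Qed.

End UniformContinuity.

Section Bernstein.
Variable R : realType.

(** The binomial sum is indexed by success sets, so that the value at [v] is a [bexp] and [bexp_var]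
    bounds the deviation. *)
Definition bernstein n (h : R -> R) : {poly R} :=
  \sum_(E : {set 'I_n}) (\prod_(t : 'I_n) (if t \in E then 'X else 1 - 'X)) *
    (h (#|E|%:R / n%:R))%:P.

Lemma bernsteinE n h (v : R) : (bernstein n h).[v] =
  bexp (fun _ : 'I_n => v) (fun E => h (#|E|%:R / n%:R)).
Proof.
rewrite horner_sum; apply: eq_bigr => E _; rewrite hornerM hornerC horner_prod.
congr (_ * _); apply: eq_bigr => t _; case: ifP => _; first exact: hornerX.
by rewrite hornerD hornerN hornerX hornerC.
Qed.

Lemma bexp_card n (v : R) : bexp (fun _ : 'I_n => v) (fun E => #|E|%:R) = n%:R * v.
Proof.
transitivity (\sum_(t : 'I_n) bexp (fun _ : 'I_n => v) (fun E => (t \in E)%:R)).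
  rewrite -bexp_sum; apply: eq_bexp => E.
  by rewrite -sum1_card natr_sum big_mkcond; apply: eq_bigr => t _; case: (t \in E).
rewrite (eq_bigr (fun=> v)) => [|t _]; first by rewrite sumr_const card_ord mulr_natl.
have := bexp_prod (fun _ : 'I_n => v) (fun u b => if u == t then b%:R else 1 : R).
rewrite (bigD1 t) //= eqxx big1 => [|u /negbTE ->]; last by ring.
rewrite mulr1 mulr0 addr0 mulr1 => H; rewrite -[RHS]H; apply: eq_bexp => E.
by rewrite (bigD1 t) //= eqxx big1 ?mulr1 // => u /negbTE ->.
Qed.

Lemma bexp_card_var n (v : R) : (0 < n)%N -> 0 <= v <= 1 ->
  bexp (fun _ : 'I_n => v) (fun E => (#|E|%:R / n%:R - v) ^+ 2) <= n%:R^-1.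
Proof.
move=> n0 v01; have nr : 0 < (n%:R : R) by rewrite ltr0n.
pose F (E : {set 'I_n}) : R := #|E|%:R / n%:R.
have FE : bexp (fun _ : 'I_n => v) F = v.
  rewrite (_ : bexp _ _ = bexp (fun _ : 'I_n => v) (fun E => n%:R^-1 * #|E|%:R)).
    by rewrite bexpZ bexp_card mulKf // gt_eqF.
  by apply: eq_bexp => E; rewrite mulrC.
have := @bexp_var _ _ (fun _ : 'I_n => v) (fun=> v01) F (fun=> n%:R^-1).
rewrite FE => H; apply: le_trans (H _) _ => [t E|].
  have -> : F (t |: E) - F (E :\ t) = n%:R^-1.
    rewrite /F -mulrBl (_ : t |: E = t |: (E :\ t)).
      rewrite cardsU1 !inE eqxx /= add1n -natr1; ring.
    by apply/setP => u; rewrite !inE; case: (u == t).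
  by rewrite ger0_norm // invr_ge0.
rewrite sumr_const card_ord -[leLHS]mulr_natr.
have -> : v * n%:R^-1 ^+ 2 * n%:R = v * n%:R^-1 by field; rewrite gt_eqF.
by have /andP[_ v1] := v01; rewrite ler_piMl // invr_ge0.
Qed.

Lemma weierstrass (h : R -> R) K : continuous h -> (forall x, `|h x| <= K) ->
  forall e : R, 0 < e -> exists p : {poly R}, forall v, 0 <= v <= 1 -> `|h v - p.[v]| <= e.
Proof.
move=> hc hK e e0; have e2 : 0 < e / 2 by rewrite divr_gt0.
have hc2 : continuous (fun p : R * R => h p.1).
  by move=> p; apply: continuous_comp; [exact: cvg_fst|exact: hc].
have [d d0 hd] := continuous_square_uniform (continuous_subspaceT hc2) e2.
have K0 : 0 <= K by rewrite (le_trans _ (hK 0)).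
(* Chebyshev in pointwise form: beyond distance [d], the trivial bound 2 K lies below the parabola
   with this coefficient. *)
pose c := 2 * K / d ^+ 2.
have c0 : 0 <= c by rewrite divr_ge0 ?sqr_ge0 // mulr_ge0.
have [n n0 cn] : exists2 n, (0 < n)%N & c / n%:R <= e / 2.
  near \oo => n; exists n; first by near: n; exact: nbhs_infty_gt.
  rewrite ler_pdivrMr ?ltr0n; last by near: n; exact: nbhs_infty_gt.
  by rewrite mulrC -ler_pdivrMr //; near: n; exact: nbhs_infty_ger.
exists (bernstein n h) => v v01.
have nr : 0 < (n%:R : R) by rewrite ltr0n.
rewrite bernsteinE -[X in `|X - _|](bexp_cst (fun _ : 'I_n => v)) -bexpB.
rewrite (le_trans (ler_norm_bexp (fun=> v01) _)) //.
apply: (@le_trans _ _ (bexp (fun _ : 'I_n => v)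
    (fun E => e / 2 + c * (#|E|%:R / n%:R - v) ^+ 2))); last first.
  rewrite bexpD bexp_cst bexpZ [leRHS]splitr lerD2l.
  exact: le_trans (ler_wpM2l c0 (bexp_card_var n0 v01)) cn.
apply: ler_bexp => // E; set x := #|E|%:R / n%:R.
have x01 : 0 <= x <= 1.
  rewrite divr_ge0 //= ler_pdivrMr // mul1r ler_nat.
  by rewrite -[X in (_ <= X)%N]card_ord max_card.
have [xv|xv] := leP `|v - x| d.
  have := hd (v, 0) (x, 0) v01 _ x01 _ xv; rewrite /= subrr normr0 lexx ler01 => H.
  rewrite (le_trans (H _ _ _)) ?(ltW d0) // lerDl mulr_ge0 ?sqr_ge0 //.
have : 2 * K <= c * (x - v) ^+ 2.
  rewrite /c mulrAC ler_pdivlMr ?exprn_gt0 // ler_wpM2l ?mulr_ge0 //.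
  by rewrite -[(x - v) ^+ 2]real_normK ?num_real // distrC ler_pXn2r ?nnegrE ?(ltW d0) // ltW.
have := ler_normB (h v) (h x); have := hK v; have := hK x; lra.
Unshelve. all: by end_near. Qed.

End Bernstein.

Lemma cvg0_le (R : realType) (u v : nat -> R) :
  (\forall N \near \oo, 0 <= u N <= v N) -> v @ \oo --> 0 -> u @ \oo --> 0.
Proof.
move=> uv v0; apply: approx_cvg0 => e e0; near=> N.
have /andP[u0 u1] : 0 <= u N <= v N by near: N.
rewrite ger0_norm // (le_trans u1) //; near: N; exact: (cvgr_le _ v0).
Unshelve. all: by end_near. Qed.

(** * From trigonometric to bounded continuous functions *)

Section TrigToContinuous.
Variables (R : realType) (f : R -> R -> R) (eps : nat -> R).
Local Notation q := (edge_q f eps).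
Hypothesis q01 : \forall N \near \oo, forall u, 0 <= q (N := N) u <= 1.
Hypothesis moment2 : exists K : R, \forall N \near \oo,
  bexp (q (N := N)) (fun E => esd_int (scaled_centered f eps E) (fun x => x ^+ 2)) <= K.
Hypothesis cvg_cos : forall t, exists l, esd_cvg f eps (fun x => cos (t * x)) l.
Hypothesis cvg_sin : forall t, esd_cvg f eps (fun x => sin (t * x)) 0.

Local Notation A N E g := (esd_int (scaled_centered f eps (N := N) E) g).

Lemma esd_cvgD g h l m : esd_cvg f eps g l -> esd_cvg f eps h m ->
  esd_cvg f eps (fun x => g x + h x) (l + m).
Proof.
move=> gl hm; pose v N := bexp (q (N := N)) (fun E => `|A N E g - l|) +
            bexp (q (N := N)) (fun E => `|A N E h - m|).
apply: (@cvg0_le _ _ v); last by rewrite -[X in _ --> X](addr0 0); exact: cvgD.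
near=> N; have qN : forall u, 0 <= q (N := N) u <= 1 by near: N.
rewrite bexp_ge0 //= /v -bexpD; apply: ler_bexp => // E.
rewrite esdD; apply: le_trans (ler_normD _ _).
by rewrite le_eqVlt; apply/orP; left; apply/eqP; congr (`|_|); ring.
Unshelve. all: by end_near. Qed.

Lemma esd_cvgZ c g l : esd_cvg f eps g l -> esd_cvg f eps (fun x => c * g x) (c * l).
Proof.
move=> gl; rewrite /esd_cvg -(mulr0 `|c|).
rewrite [X in X @ _](_ : _ = (fun N => `|c| * bexp (q (N := N)) (fun E => `|A N E g - l|))).
  exact: cvgMr.
apply/funext => N; rewrite -bexpZ; apply: eq_bexp => E.
by rewrite esdZ -mulrBr normrM.
Qed.

Lemma esd_cvg_cst c : esd_cvg f eps (fun=> c) c.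
Proof.
apply: (@cvg_trans _ ((fun=> 0 : R) @ \oo)); last exact: cvg_cst.
apply: near_eq_cvg; near=> N.
have N0 : (0 < N)%N by near: N; exact: nbhs_infty_gt.
rewrite -[LHS](bexp_cst (q (N := N))); apply: eq_bexp => E.
by rewrite esd_cst ?tr_scaled_centered // subrr normr0.
Unshelve. all: by end_near. Qed.

Lemma esd_cvg_sub_le g h l m e : esd_cvg f eps g l -> esd_cvg f eps h m ->
  (\forall N \near \oo, bexp (q (N := N)) (fun E => `|A N E g - A N E h|) <= e) ->
  `|l - m| <= e.
Proof.
rewrite /esd_cvg => gl hm gh; apply/ler_addgt0Pr => d d0.
have d2 : 0 < d / 2 by rewrite divr_gt0.
near \oo => N; have qN : forall u, 0 <= q (N := N) u <= 1 by near: N.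
have glN : bexp (q (N := N)) (fun E => `|A N E g - l|) <= d / 2.
  by near: N; apply: (cvgr_le _ gl).
have hmN : bexp (q (N := N)) (fun E => `|A N E h - m|) <= d / 2.
  by near: N; apply: (cvgr_le _ hm).
have ghN : bexp (q (N := N)) (fun E => `|A N E g - A N E h|) <= e by near: N.
rewrite -(bexp_cst (q (N := N)) `|l - m|).
apply: (@le_trans _ _ (bexp (q (N := N)) (fun E => `|A N E g - l| +
   `|A N E h - m| + `|A N E g - A N E h|))).
  apply: ler_bexp => // E.
  have -> : l - m = (A N E g - A N E h) - (A N E g - l) + (A N E h - m) by ring.
  rewrite (le_trans (ler_normD _ _)) // [leRHS]addrC addrA lerD // addrC.
  by rewrite (le_trans (ler_normB _ _)) // addrC.
rewrite !bexpD; lra.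
Unshelve. all: by end_near. Qed.

(** Carrying the reflected function along with the same limit makes the symmetry of [nu] a
    by-product. *)
Definition sym_cvg g l := esd_cvg f eps g l /\ esd_cvg f eps (fun x => g (- x)) l.

Lemma sym_cvgD g h l m : sym_cvg g l -> sym_cvg h m -> sym_cvg (fun x => g x + h x) (l + m).
Proof. by move=> [g1 g2] [h1 h2]; split; exact: esd_cvgD. Qed.

Lemma sym_cvgZ c g l : sym_cvg g l -> sym_cvg (fun x => c * g x) (c * l).
Proof. by move=> [g1 g2]; split; exact: (esd_cvgZ c). Qed.

Lemma sym_cvg_cst c : sym_cvg (fun=> c) c.
Proof. by split; exact: esd_cvg_cst. Qed.

Lemma sym_cvg_cos t : exists l, sym_cvg (fun x => cos (t * x)) l.
Proof.
have [l H] := cvg_cos t; exists l; split => //.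
rewrite (_ : (fun x => _) = (fun x => cos (t * x))) //.
by apply/funext => x; rewrite mulrN cosN.
Qed.

Lemma sym_cvg_sin t : sym_cvg (fun x => sin (t * x)) 0.
Proof.
split => //; have := esd_cvgZ (-1) (cvg_sin t); rewrite mulr0.
rewrite (_ : (fun x => _) = (fun x => sin (t * - x))) //.
by apply/funext => x; rewrite mulrN sinN mulN1r.
Qed.

(** Product-to-sum formulas lower the power and shift the frequency by [w] either way; hence the
    induction handles both functions and every [t]. *)
Lemma sym_cvg_sin_pow w n t : (exists l, sym_cvg (fun x => sin (w * x) ^+ n * cos (t * x)) l) /\
  (exists l, sym_cvg (fun x => sin (w * x) ^+ n * sin (t * x)) l).
Proof.
elim: n t => [|n IH] t.
  have [l H] := sym_cvg_cos t; split; [exists l|exists 0].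
    rewrite (_ : (fun x => _) = (fun x => cos (t * x))) //.
    by apply/funext => x; rewrite expr0 mul1r.
  rewrite (_ : (fun x => _) = (fun x => sin (t * x))); first exact: sym_cvg_sin.
  by apply/funext => x; rewrite expr0 mul1r.
have [[c1 C1] [s1 S1]] := IH (t + w); have [[c2 C2] [s2 S2]] := IH (t - w); split.
- exists (1 / 2 * s1 + (- (1 / 2)) * s2).
  rewrite (_ : (fun x => _) = (fun x => 1 / 2 * (sin (w * x) ^+ n * sin ((t + w) * x)) +
    (- (1 / 2)) * (sin (w * x) ^+ n * sin ((t - w) * x)))).
    by apply: sym_cvgD; exact: sym_cvgZ.
  by apply/funext => x; rewrite mulrDl mulrBl sinD sinB exprS; field.
- exists (- (1 / 2) * c1 + 1 / 2 * c2).
  rewrite (_ : (fun x => _) = (fun x => - (1 / 2) * (sin (w * x) ^+ n * cos ((t + w) * x)) +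
    1 / 2 * (sin (w * x) ^+ n * cos ((t - w) * x)))).
    by apply: sym_cvgD; exact: sym_cvgZ.
  by apply/funext => x; rewrite mulrDl mulrBl cosD cosB exprS; field.
Qed.

Lemma sym_cvg_poly_sin w (p : {poly R}) : exists l, sym_cvg (fun x => p.[sin (w * x)]) l.
Proof.
have H n (c : nat -> R) : exists l, sym_cvg (fun x => \sum_(i < n) c i * sin (w * x) ^+ i) l.
  elim: n => [|n [l IH]].
    exists 0; rewrite (_ : (fun x => _) = fun=> 0); first exact: sym_cvg_cst.
    by apply/funext => x; rewrite big_ord0.
  have [[m Hm] _] := sym_cvg_sin_pow w n 0; exists (l + c n * m).
  have := sym_cvgD IH (sym_cvgZ (c n) Hm).
  rewrite (_ : (fun x => _) = (fun x => \sum_(i < n.+1) c i * sin (w * x) ^+ i)) //.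
  by apply/funext => x; rewrite big_ord_recr /= mul0r cos0 mulr1.
have [l Hl] := H (size p) (fun i => p`_i); exists l.
rewrite (_ : (fun x => _) = (fun x => \sum_(i < size p) p`_i * sin (w * x) ^+ i)) //.
by apply/funext => x; rewrite horner_coef.
Qed.

(** The limit is that of the expectations, which are Cauchy because each approximant confines them
    to a small interval. *)
Lemma esd_cvg_approx g : (forall e : R, 0 < e -> exists h m, esd_cvg f eps h m /\
   \forall N \near \oo, bexp (q (N := N)) (fun E => `|A N E g - A N E h|) <= e) ->
  exists l, esd_cvg f eps g l.
Proof.
move=> H; pose L N := bexp (q (N := N)) (fun E => A N E g).
have LH h m e : 0 < e -> esd_cvg f eps h m ->
   (\forall N \near \oo, bexp (q (N := N)) (fun E => `|A N E g - A N E h|) <= e) ->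
   \forall N \near \oo, bexp (q (N := N)) (fun E => `|A N E g - m|) <= e + e /\
     `|L N - m| <= e + e.
  move=> e0 hm gh; near=> N.
  have qN : forall u, 0 <= q (N := N) u <= 1 by near: N.
  have H1 : bexp (q (N := N)) (fun E => `|A N E g - m|) <= e + e.
    apply: (@le_trans _ _ (bexp (q (N := N)) (fun E => `|A N E g - A N E h| + `|A N E h - m|))).
      apply: ler_bexp => // E; apply: le_trans (ler_normD _ _).
      by rewrite le_eqVlt; apply/orP; left; apply/eqP; congr (`|_|); ring.
    rewrite bexpD lerD //; first by near: N.
    by near: N; apply: (cvgr_le _ hm).
  split => //; apply: le_trans H1.
  by rewrite /L -[X in `|_ - X|](bexp_cst (q (N := N))) -bexpB ler_norm_bexp.
have Lcvg : cvgn L.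
  apply: approx_cvgn => e e0; have e2 : 0 < e / 2 by rewrite divr_gt0.
  have [h [m [hm gh]]] := H _ e2; exists m.
  by apply: filterS (LH h m _ e2 hm gh) => N [_]; rewrite -splitr.
exists (limn L); apply: approx_cvg0 => e e0; have e4 : 0 < e / 8 by rewrite divr_gt0.
have [h [m [hm gh]]] := H _ e4; near=> N.
have qN : forall u, 0 <= q (N := N) u <= 1 by near: N.
have [H1 H2] : bexp (q (N := N)) (fun E => `|A N E g - m|) <= e / 8 + e / 8 /\
     `|L N - m| <= e / 8 + e / 8 by near: N; exact: LH hm gh.
have H3 : `|limn L - L N| <= e / 8 by near: N; move/cvgrPdist_le: Lcvg; exact.
rewrite ger0_norm ?bexp_ge0 //.
apply: (@le_trans _ _ (bexp (q (N := N)) (fun E => `|A N E g - m| + (`|L N - m| + `|limn L - L N|)))).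
  apply: ler_bexp => // E.
  have -> : A N E g - limn L = (A N E g - m) - ((L N - m) + (limn L - L N)) by ring.
  by rewrite (le_trans (ler_normB _ _)) // lerD // ler_normD.
rewrite bexpD bexp_cst; lra.
Unshelve. all: by end_near. Qed.

(* Substituting u = sin (x / 2K) turns a polynomial approximation on [-1, 1] of
   g (2K asin u) into a trigonometric one of g on [-K, K]; clamping u to
   [-sin (1/2), sin (1/2)] avoids the endpoints, where asin is not continuous. *)
Lemma trig_approx (g : R -> R) (M K e : R) : continuous g -> (forall x, `|g x| <= M) ->
  0 < K -> 0 < e -> exists p : {poly R},
    (forall x, `|x| <= K -> `|g x - p.[sin ((2 * K)^-1 * x)]| <= e) /\
    (forall x, `|p.[sin ((2 * K)^-1 * x)]| <= M + e).
Proof.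
move=> gc gM K0 e0.
have pi2 : (1 : R) <= pi / 2 by exact: pihalf_ge1.
have halfpi : 1 / 2 < pi / 2 :> R by lra.
pose s : R := sin (1 / 2).
have half_in : (1 / 2 : R) \in `[- (pi / 2), pi / 2] by rewrite in_itv /=; lra.
have s1 : s < 1.
  by rewrite -sin_pihalf ltr_sin //= in_itv /=; lra.
have s0 : 0 < s by rewrite -(@sin0 R) ltr_sin ?in_itv //=; lra.
pose clamp (u : R) := Num.min (Num.max u (- s)) s.
have clampP u : -1 < clamp u < 1.
  by rewrite /clamp lt_min gt_min lt_max; apply/andP; split; [apply/andP; split; [apply/orP; right|]|apply/orP; right]; lra.
have clampE u : - s <= u <= s -> clamp u = u.
  by move=> /andP[u1 u2]; rewrite /clamp max_l // min_l.
have clamp_cont : continuous clamp.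
  move=> u; apply: (@continuous_min _ _ (fun v => Num.max v (- s)) (cst s)).
    by apply: (@continuous_max _ _ id (cst (- s))); [exact: cvg_id|exact: cvg_cst].
  exact: cvg_cst.
pose h (v : R) := g (2 * K * asin (clamp (2 * v - 1))).
have asin_cont : continuous (fun v : R => asin (clamp (2 * v - 1))).
  move=> v; apply: (@continuous_comp _ _ _ (fun v : R => clamp (2 * v - 1)) (@asin R)); last first.
    by apply: continuous_asin; exact: clampP.
  apply: (@continuous_comp _ _ _ (fun v : R => 2 * v - 1) clamp); last exact: clamp_cont.
  by apply: cvgB; [apply: cvgMr|exact: cvg_cst].
have h_cont : continuous h.
  move=> v; apply: (@continuous_comp _ _ _ (fun v : R => 2 * K * asin (clamp (2 * v - 1))) g).
    by apply: cvgMr; exact: asin_cont.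
  exact: gc.
have [p1 p1E] := weierstrass h_cont (fun v => gM _) e0.
(* The affine substitution maps the range [-1, 1] of the sine to [0, 1], where [weierstrass]
   applies. *)
exists (p1 \Po ((2^-1)%:P * ('X + 1))).
have pE u : (p1 \Po ((2^-1)%:P * ('X + 1))).[u] = p1.[2^-1 * (u + 1)].
  by rewrite horner_comp hornerM hornerC hornerD hornerX hornerC.
have v01 (x : R) : 0 <= 2^-1 * (sin x + 1) <= 1 by have := sin_geN1 x; have := sin_le1 x; lra.
split=> x; last first.
  rewrite pE; have := p1E _ (v01 ((2 * K)^-1 * x)); have := gM (2 * K * asin (clamp (2 * (2^-1 * (sin ((2 * K)^-1 * x) + 1)) - 1))).
  rewrite -/(h _); set a := h _; set b := p1.[_] => H1 H2.
  have -> : b = a - (a - b) by ring.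
  by rewrite (le_trans (ler_normB _ _)) // lerD.
move=> xK; rewrite pE; have := p1E _ (v01 ((2 * K)^-1 * x)).
set y := (2 * K)^-1 * x.
have y2 : `|y| <= 1 / 2.
  rewrite /y normrM ger0_norm ?invr_ge0; last by rewrite mulr_ge0 // ltW.
  by rewrite mulrC ler_pdivrMr ?mulr_gt0 // [leRHS](_ : _ = K) //; field.
have y_in : y \in `[- (pi / 2), pi / 2].
  by rewrite in_itv /=; move: y2; rewrite ler_norml; lra.
have -> : h (2^-1 * (sin y + 1)) = g x; last by [].
rewrite /h; have -> : 2 * (2^-1 * (sin y + 1)) - 1 = sin y by field.
rewrite clampE; last first.
  rewrite /s -sinN; move: y2; rewrite ler_norml => /andP[y3 y4].
  have mono (a b : R) : a \in `[- (pi / 2), pi / 2] -> b \in `[- (pi / 2), pi / 2] ->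
      a <= b -> sin a <= sin b.
    move=> aI bI; rewrite le_eqVlt => /predU1P[->//|ab].
    by rewrite ltW // ltr_sin.
  have Nhalf_in : (- (1 / 2) : R) \in `[- (pi / 2), pi / 2] by rewrite in_itv /=; lra.
  by apply/andP; split; apply: mono.
by rewrite sinK // /y mulVKf // gt_eqF // mulr_gt0.
Qed.

(** Beyond [K] the error is at most D, hence at most D x^2 / K^2, and the second moment controls it.
    As this bound is even, the same [h] works for the reflection. *)
Lemma bounded_trig_approx (g : R -> R) (M e : R) : continuous g ->
  (forall x, `|g x| <= M) -> 0 < e -> exists h m, [/\ sym_cvg h m,
    \forall N \near \oo, bexp (q (N := N)) (fun E => `|A N E g - A N E h|) <= e &
    \forall N \near \oo, bexp (q (N := N)) (fun E =>
      `|A N E (fun x => g (- x)) - A N E (fun x => h (- x))|) <= e].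
Proof.
move=> gc gM e0; have e2 : 0 < e / 2 by rewrite divr_gt0.
have [C0 HC0] := moment2.
pose C := Num.max C0 1.
have C1 : 0 < C by rewrite lt_max ltr01 orbT.
have M0 : 0 <= M by rewrite (le_trans _ (gM 0)).
pose D := 2 * M + e / 2.
have D0 : 0 < D by rewrite /D; lra.
(* From K <= K^2 this choice gives D C / K^2 <= e / 2. *)
pose K := 1 + D * C / (e / 2).
have K1 : 1 <= K by rewrite lerDl divr_ge0 ?mulr_ge0 // ltW.
have K0 : 0 < K by rewrite (lt_le_trans ltr01).
have KD : D / K ^+ 2 * C <= e / 2.
  rewrite mulrAC ler_pdivrMr ?exprn_gt0 // -ler_pdivrMl //.
  rewrite (@le_trans _ _ K) //; last by rewrite expr2 ler_peMr // ltW.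
  by rewrite /K mulrC lerDr.
have [p [p1 p2]] := trig_approx gc gM K0 e2.
pose h x := p.[sin ((2 * K)^-1 * x)].
have [m hm] := sym_cvg_poly_sin (2 * K)^-1 p.
have gh x : `|g x - h x| <= e / 2 + D / K ^+ 2 * x ^+ 2.
  have xx : 0 <= D / K ^+ 2 * x ^+ 2 by rewrite mulr_ge0 ?sqr_ge0 // divr_ge0 ?sqr_ge0 // ltW.
  have [xK|xK] := leP `|x| K; first by rewrite (le_trans (p1 x xK)) // lerDl.
  rewrite (@le_trans _ _ D) //.
    by rewrite (le_trans (ler_normB _ _)) // /D mulr_natl mulr2n -addrA lerD // p2.
  have : D <= D / K ^+ 2 * x ^+ 2.
    rewrite mulrAC ler_pdivlMr ?exprn_gt0 // ler_wpM2l ?(ltW D0) //.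
    by rewrite -[leRHS]real_normK ?num_real // ler_pXn2r ?nnegrE ?(ltW K0) // ltW.
  lra.
have bound (k k' : R -> R) : (forall x, `|k x - k' x| <= e / 2 + D / K ^+ 2 * x ^+ 2) ->
    \forall N \near \oo, bexp (q (N := N)) (fun E => `|A N E k - A N E k'|) <= e.
  move=> kk; near=> N.
  have N0 : (0 < N)%N by near: N; exact: nbhs_infty_gt.
  have qN : forall u, 0 <= q (N := N) u <= 1 by near: N.
  have mN : bexp (q (N := N)) (fun E => A N E (fun x => x ^+ 2)) <= C0 by near: N.
  apply: (@le_trans _ _ (bexp (q (N := N)) (fun E => e / 2 + D / K ^+ 2 * A N E (fun x => x ^+ 2)))).
    apply: ler_bexp => // E.
    have -> : A N E k - A N E k' = A N E (fun x => k x + -1 * k' x).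
      by rewrite esdD esdZ mulN1r.
    rewrite (le_trans (ler_norm_esd N0 _ _)) //.
    rewrite -[X in _ <= X + _](esd_cst N0 _ (tr_scaled_centered f eps E)) -esdZ -esdD.
    by apply: ler_esd => // x; rewrite mulN1r.
  rewrite bexpD bexp_cst bexpZ [leRHS]splitr lerD2l; apply: le_trans KD.
  rewrite ler_wpM2l ?divr_ge0 ?sqr_ge0 ?(ltW D0) // (le_trans mN) //.
  by rewrite le_max lexx.
exists h, m; split => //; first exact: bound.
by apply: bound => x; rewrite (le_trans (gh _)) // sqrrN.
Unshelve. all: by end_near. Qed.

(** The limits for [g] and its reflection agree since both are approximated by one pair [h], [m]. *)
Lemma continuous_sym_cvg (g : R -> R) (M : R) : continuous g ->
  (forall x, `|g x| <= M) -> exists l, sym_cvg g l.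
Proof.
move=> gc gM.
have [l gl] : exists l, esd_cvg f eps g l.
  apply: esd_cvg_approx => e e0; have [h [m [[hm _] gh _]]] := bounded_trig_approx gc gM e0.
  by exists h, m.
have [l' gl'] : exists l, esd_cvg f eps (fun x => g (- x)) l.
  apply: esd_cvg_approx => e e0; have [h [m [[_ hm] _ gh]]] := bounded_trig_approx gc gM e0.
  by exists (fun x => h (- x)), m.
suff ll : l' = l by exists l; split => //; rewrite -ll.
apply/eqP; rewrite -subr_eq0 -normr_le0; apply/ler_addgt0Pr => e e0; rewrite add0r.
have [h [m [[hm hm'] gh gh']]] := bounded_trig_approx gc gM (divr_gt0 e0 (ltr0n _ 2)).
have -> : l' - l = (l' - m) - (l - m) by ring.
rewrite (le_trans (ler_normB _ _)) // (splitr e) lerD //.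
  exact: esd_cvg_sub_le gl' hm' gh'.
exact: esd_cvg_sub_le gl hm gh.
Qed.

End TrigToContinuous.

From mathcomp Require Import classical_sets.
Local Open Scope classical_set_scope.
Local Open Scope ring_scope.

(** * Riesz representation through distribution functions *)

Section CdfProbability.
Context {R : realType} (F : R -> R).
Hypothesis F_nd : nondecreasing F.
Hypothesis F_rc : right_continuous F.
Hypothesis F_Ny : F @ -oo --> (0 : R).
Hypothesis F_y : F @ +oo --> (1 : R).

#[local] HB.instance Definition _ := isCumulative.Build R _ R F F_nd F_rc.
#[local] HB.instance Definition _ := isCumulativeBounded.Build R 0 1 F F_Ny F_y.

Let idTR : measurableTypeR R -> R := idfun.

#[local] HB.instance Definition _ :=
  @isMeasurableFun.Build _ _ _ _ idTR (@measurable_id _ _ setT).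

Let lsF := lebesgue_stieltjes_measure F.

(** The law of the identity under the Lebesgue-Stieltjes measure of [F]; passing to the law also
    moves the measure from [measurableTypeR R] to [R]. *)
Lemma exists_probability_of_cdf :
  exists nu : probability R R, forall r, nu `]-oo, r]%classic = (F r)%:E.
Proof.
exists (distribution lsF (idTR : {RV lsF >-> R})) => r.
exact: cdf_lebesgue_stieltjes_id.
Qed.

End CdfProbability.

Section BoundedContinuous.
Variable R : realType.

Definition Cb (g : R -> R) := continuous g /\ exists M : R, forall x, `|g x| <= M.

Lemma Cb_cst c : Cb (fun=> c).
Proof. by split; [exact: cst_continuous|exists `|c|]. Qed.

Lemma CbD g h : Cb g -> Cb h -> Cb (fun x => g x + h x).
Proof.
move=> [gc [M gM]] [hc [M' hM]]; split; first by move=> x; apply: cvgD; [exact: gc|exact: hc].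
by exists (M + M') => x; rewrite (le_trans (ler_normD _ _)) // lerD.
Qed.

Lemma CbZ c g : Cb g -> Cb (fun x => c * g x).
Proof.
move=> [gc [M gM]]; split; first by move=> x; apply: cvgMr; exact: gc.
by exists (`|c| * M) => x; rewrite normrM ler_wpM2l.
Qed.

Lemma Cb_sum (I : Type) (r : seq I) (g : I -> R -> R) :
  (forall i, Cb (g i)) -> Cb (fun x => \sum_(i <- r) g i x).
Proof.
move=> gi; elim: r => [|i r IH].
  by under eq_fun do rewrite big_nil; exact: Cb_cst.
by under eq_fun do rewrite big_cons; exact: CbD.
Qed.

Variable nu : probability R R.

Lemma integrable_Cb g : Cb g -> nu.-integrable setT (EFin \o g).
Proof.
move=> [gc [M gM]]; apply: measurable_bounded_integrable => //.
- by apply: (le_lt_trans (_ : _ <= 1%E)%E); rewrite ?ltry // probability_le1.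
- exact: measurable_realfun.continuous_measurable_fun.
- exists M; split; rewrite ?num_real // => x Mx y _ /=.
  by rewrite (le_trans (gM y)) // ltW.
Qed.

Definition Int g : R := fine (\int[nu]_x (g x)%:E).

Lemma IntD g h : Cb g -> Cb h -> Int (fun x => g x + h x) = Int g + Int h.
Proof. by move=> gc hc; apply: RintegralD => //; exact: integrable_Cb. Qed.

Lemma IntZ c g : Cb g -> Int (fun x => c * g x) = c * Int g.
Proof. by move=> gc; apply: RintegralZl => //; exact: integrable_Cb. Qed.

Lemma ler_Int g h : Cb g -> Cb h -> (forall x, g x <= h x) -> Int g <= Int h.
Proof. by move=> gc hc gh; apply: le_Rintegral => //; exact: integrable_Cb. Qed.

Lemma Int_cst c : Int (fun=> c) = c.
Proof.
transitivity (c * fine (nu [set: R])); first exact: Rintegral_cst.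
rewrite (_ : fine _ = 1) ?mulr1 //; exact: (congr1 fine (probability_setT nu)).
Qed.

Lemma integrable_indic (A : set R) : measurable A -> nu.-integrable setT (EFin \o \1_A).
Proof.
move=> mA; apply: measurable_bounded_integrable => //.
- by apply: (le_lt_trans (_ : _ <= 1%E)%E); rewrite ?ltry // probability_le1.
- exists 1; split; rewrite ?num_real // => x x1 y _ /=.
  by rewrite (le_trans _ (ltW x1)) // indicE; case: (_ \in _); rewrite ?normr1 ?normr0.
Qed.

Lemma Int_indic (A : set R) r : measurable A -> nu A = r%:E -> Int \1_A = r.
Proof.
by move=> mA nA; rewrite /Int integral_indic // setIT; exact: (congr1 fine nA).
Qed.

Lemma Int_indic_le g (A : set R) r : measurable A -> nu A = r%:E -> Cb g ->
  (forall x, g x <= \1_A x) -> Int g <= r.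
Proof.
move=> mA nA gc gA; rewrite -(Int_indic mA nA).
by apply: le_Rintegral => //; [exact: integrable_Cb|exact: integrable_indic].
Qed.

Lemma Int_indic_ge g (A : set R) r : measurable A -> nu A = r%:E -> Cb g ->
  (forall x, \1_A x <= g x) -> r <= Int g.
Proof.
move=> mA nA gc gA; rewrite -(Int_indic mA nA).
by apply: le_Rintegral => //; [exact: integrable_indic|exact: integrable_Cb].
Qed.

Definition clamp01 (y : R) : R := Num.min (Num.max y 0) 1.
Definition ramp (a b x : R) : R := clamp01 ((b - x) / (b - a)).

Lemma clamp01_itv y : 0 <= clamp01 y <= 1.
Proof. by rewrite /clamp01 le_min le_max lexx orbT ler01 /= ge_min lexx orbT. Qed.

Lemma clamp01_ge1 y : 1 <= y -> clamp01 y = 1.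
Proof. by move=> y1; rewrite /clamp01 max_l ?min_r // (le_trans ler01). Qed.

Lemma clamp01_le0 y : y <= 0 -> clamp01 y = 0.
Proof. by move=> y0; rewrite /clamp01 max_r // min_l. Qed.

Lemma continuous_clamp01 : continuous clamp01.
Proof.
move=> u; apply: (@continuous_min _ _ (fun v : R => Num.max v 0) (cst (1 : R))).
  by apply: (@continuous_max _ _ id (cst (0 : R))); [exact: cvg_id|exact: cvg_cst].
exact: cvg_cst.
Qed.

Lemma ramp_itv a b x : 0 <= ramp a b x <= 1. Proof. exact: clamp01_itv. Qed.

Lemma ramp_left a b x : a < b -> x <= a -> ramp a b x = 1.
Proof.
by move=> ab xa; rewrite /ramp clamp01_ge1 // ler_pdivlMr ?subr_gt0 // mul1r lerB.
Qed.

Lemma ramp_right a b x : a < b -> b <= x -> ramp a b x = 0.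
Proof.
move=> ab bx; rewrite /ramp clamp01_le0 // mulr_le0_ge0 ?subr_le0 //.
by rewrite invr_ge0 subr_ge0 ltW.
Qed.

Lemma Cb_ramp a b : Cb (ramp a b).
Proof.
split; last by exists 1 => x; have /andP[r0 r1] := ramp_itv a b x; rewrite ger0_norm.
move=> x; apply: (@continuous_comp _ _ _ (fun x : R => (b - x) / (b - a)) clamp01).
  by apply: cvgMl; apply: cvgB; [exact: cvg_cst|exact: cvg_id].
exact: continuous_clamp01.
Qed.

Lemma sum_clamp01 n y : \sum_(j < n) clamp01 (y - j%:R) = Num.min (Num.max y 0) n%:R.
Proof.
elim: n => [|n IH]; first by rewrite big_ord0 min_r // le_max lexx orbT.
rewrite big_ord_recr IH /= -natr1; set m : R := n%:R.
have m0 : 0 <= m by rewrite /m.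
have [ym|my] := leP y m.
  have M : Num.max y 0 <= m by rewrite ge_max ym m0.
  by rewrite clamp01_le0 ?subr_le0 // addr0 !min_l // (le_trans M) // lerDl.
rewrite max_l; last by lra.
rewrite min_r; last by lra.
have [ym1|my1] := leP (y - m) 1; last by rewrite clamp01_ge1 ?min_r //; lra.
rewrite /clamp01 max_l ?min_l //; lra.
Qed.

(** The height is cut into n slices, each a steeper ramp on one of n equal subintervals, listed from
    right to left. This sharpens crude bounds on a single ramp. *)
Lemma ramp_split n a b x : (0 < n)%N -> a < b ->
  let w := (b - a) / n%:R in
  ramp a b x = n%:R^-1 * \sum_(j < n) ramp (b - (j.+1)%:R * w) (b - j%:R * w) x.
Proof.
move=> n0 ab w; have nr : 0 < (n%:R : R) by rewrite ltr0n.
have ba : 0 < b - a by rewrite subr_gt0.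
pose y := n%:R * ((b - x) / (b - a)).
have -> : \sum_(j < n) ramp (b - (j.+1)%:R * w) (b - j%:R * w) x =
    \sum_(j < n) clamp01 (y - j%:R).
  apply: eq_bigr => j _; rewrite /ramp; congr clamp01.
  rewrite /y /w -natr1; field.
  by rewrite !gt_eqF //= -[X in X * (b - a)](_ : _ = 1) ?mul1r //; ring.
rewrite sum_clamp01 /ramp /clamp01 minr_pMr ?invr_ge0 ?(ltW nr) //.
rewrite maxr_pMr ?invr_ge0 ?(ltW nr) // mulr0 /y mulKf ?gt_eqF //.
by rewrite mulVf ?gt_eqF.
Qed.

End BoundedContinuous.

Section Staircase.
Variable R : realType.

Lemma continuous_itv_uniform (g : R -> R) S e : continuous g -> 0 < S -> 0 < e ->
  exists2 d : R, 0 < d & forall x y, `|x| <= S -> `|y| <= S -> `|x - y| <= d ->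
    `|g x - g y| <= e.
Proof.
move=> gc S0 e0; have S2 : 0 < 2 * S by lra.
pose h (p : R * R) := g (2 * S * p.1 - S).
have hc : continuous h.
  move=> p; apply: (@continuous_comp _ _ _ (fun p : R * R => 2 * S * p.1 - S) g);
    last exact: gc.
  by apply: cvgB; [apply: cvgMr; exact: cvg_fst|exact: cvg_cst].
have [d d0 H] := continuous_square_uniform (continuous_subspaceT hc) e0.
exists (2 * S * d); first by rewrite mulr_gt0.
move=> x y xS yS xy; pose t z : R := (z + S) / (2 * S).
have t01 z : `|z| <= S -> 0 <= t z <= 1.
  rewrite ler_norml => /andP[z1 z2].
  by rewrite /t divr_ge0 ?(ltW S2) ?ler_pdivrMr //=; lra.
have := H (t x, 0) (t y, 0) (t01 x xS) _ (t01 y yS).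
rewrite /h /= !lexx ler01 subrr normr0 => /(_ isT isT).
have tE z : 2 * S * t z - S = z by rewrite /t; field; rewrite gt_eqF.
rewrite !tE; apply; last exact: ltW.
rewrite /t -mulrBl opprD addrACA subrr addr0 normrM (gtr0_norm (_ : 0 < (2 * S)^-1)) ?invr_gt0 //.
by rewrite ler_pdivrMr // mulrC.
Qed.

(** A continuous cut-off, 0 on [-K, K] and 1 outside [-K - 1, K + 1], shaped as successive additions
    of multiples of ramps. *)
Definition tail_ramp (K x : R) := (1 + -1 * ramp K (K + 1) x) + ramp (- (K + 1)) (- K) x.

Lemma tail_ramp_ge0 (K x : R) : 0 <= tail_ramp K x.
Proof.
have := ramp_itv K (K + 1) x; have := ramp_itv (- (K + 1)) (- K) x.
rewrite /tail_ramp; lra.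
Qed.

Lemma tail_ramp_le K x : 0 < K -> tail_ramp K x <= K ^- 2 * x ^+ 2.
Proof.
move=> K0; have := ramp_itv K (K + 1) x; have := ramp_itv (- (K + 1)) (- K) x.
have a1 : K < K + 1 by lra.
have a2 : - (K + 1) < - K by lra.
have K2 : 0 < K ^+ 2 by rewrite exprn_gt0.
move=> /andP[r0 r1] /andP[s0 s1]; rewrite /tail_ramp [leRHS]mulrC ler_pdivlMr //.
have [xK|Kx] := leP x K.
  rewrite (ramp_left a1 xK); have [xN|Nx] := leP x (- K); last first.
    by rewrite (ramp_right a2 (ltW Nx)); nra.
  by nra.
rewrite (ramp_right a2); last by lra.
by nra.
Qed.

Lemma tail_ramp_ge1 K x : 0 < K -> K + 1 < `|x| -> 1 <= tail_ramp K x.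
Proof.
move=> K0; have := ramp_itv K (K + 1) x; have := ramp_itv (- (K + 1)) (- K) x.
rewrite /tail_ramp => r s.
have a1 : K < K + 1 by lra.
have a2 : - (K + 1) < - K by lra.
rewrite ltr_normr => /orP[xK|xK].
  by rewrite (ramp_right a1 (ltW xK)); lra.
by rewrite (ramp_left a2 (_ : x <= - (K + 1))); lra.
Qed.

Lemma ramp_shift_le (a b c x : R) : a < b -> b < c -> ramp a b x <= ramp b c x.
Proof.
move=> ab bc; have [xb|bx] := leP x b.
  by rewrite (ramp_left bc xb); have /andP[] := ramp_itv a b x.
by rewrite (ramp_right ab (ltW bx)); have /andP[] := ramp_itv b c x.
Qed.

(* The hat functions [ramp (a i.+1) (a i.+2) - ramp (a i) (a i.+1)] form a
   partition of unity on [[a 1, a m]]. *)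
Lemma staircase_approx (P : (R -> R) -> Prop) (g : R -> R) (M e K : R) :
  P (fun=> 0) ->
  (forall h c a b, a < b -> P h -> P (fun x => h x + c * ramp a b x)) ->
  continuous g -> (forall x, `|g x| <= M) -> 0 < e -> 0 < K ->
  exists2 G, P G & forall x, `|g x - G x| <= e + 2 * M * tail_ramp K x.
Proof.
move=> P0 PD gc gM e0 K0.
have M0 : 0 <= M by rewrite (le_trans _ (gM 0)).
have [|d d0 Hd] := continuous_itv_uniform (S := K + 3) gc _ e0; first by lra.
pose w := Num.min d 1.
have w0 : 0 < w by rewrite lt_min d0 ltr01.
have w1 : w <= 1 by rewrite ge_min lexx orbT.
have wd : w <= d by rewrite ge_min lexx.
(* The grid starts one step below -T, so that [a 1] is -T and the hats sum to 1 on all of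
   [-T, T]. *)
pose T := K + 1; pose a (i : nat) := - (T + w) + i%:R * w.
have aS i : a i.+1 = a i + w by rewrite /a -natr1; ring.
have aSlt i : a i < a i.+1 by rewrite aS ltrDl.
have [m mT] : exists m, T <= a m.
  exists (Num.truncn ((2 * T + w) / w)).+1.
  have := truncnS_gt ((2 * T + w) / w); rewrite ltr_pdivrMr // /a; lra.
pose W i x := ramp (a i.+1) (a i.+2) x - ramp (a i) (a i.+1) x.
have W0 i x : 0 <= W i x by rewrite subr_ge0 ramp_shift_le.
pose G n x := \sum_(i < n) g (a i.+1) * W i x.
have sumW n x : \sum_(i < n) W i x = ramp (a n) (a n.+1) x - ramp (a 0%N) (a 1%N) x.
  elim: n => [|n IH]; first by rewrite big_ord0 subrr.
  by rewrite big_ord_recr /= IH /W; ring.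
have sumW01 n x : 0 <= \sum_(i < n) W i x <= 1.
  rewrite sumr_ge0 //= sumW.
  have := ramp_itv (a n) (a n.+1) x; have := ramp_itv (a 0%N) (a 1%N) x; lra.
exists (G m).
  rewrite /G; elim: m {mT} => [|n IH].
    by rewrite (_ : (fun x => _) = (fun=> 0)) //; apply/funext => x; rewrite big_ord0.
  have := PD _ (- g (a n.+1)) _ _ (aSlt n) (PD _ (g (a n.+1)) _ _ (aSlt n.+1) IH).
  by congr P; apply/funext => x; rewrite big_ord_recr /= /W; ring.
move=> x; have t0 := tail_ramp_ge0 K x.
have [xT|Tx] := leP `|x| T; last first.
  have t1 := tail_ramp_ge1 K0 Tx.
  apply: (@le_trans _ _ (2 * M)); last by nra.
  rewrite (le_trans (ler_normB _ _)) // mulr_natl mulr2n lerD //.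
  rewrite (le_trans (ler_norm_sum _ _ _)) //.
  apply: (@le_trans _ _ (\sum_(i < m) M * W i x)).
    by apply: ler_sum => i _; rewrite normrM (ger0_norm (W0 i x)) ler_wpM2r.
  rewrite -big_distrr /= ler_piMr //; by have /andP[] := sumW01 m x.
have := xT; rewrite ler_norml => /andP[x1 x2].
have sW1 : \sum_(i < m) W i x = 1.
  rewrite sumW (ramp_left (aSlt m)) ?(le_trans x2) //.
  by rewrite (ramp_right (aSlt 0%N)) ?subr0 //; rewrite /a; lra.
have -> : g x - G m x = \sum_(i < m) (g x - g (a i.+1)) * W i x.
  by under [RHS]eq_bigr do rewrite mulrBl; rewrite sumrB -big_distrr /= sW1 mulr1.
apply: (@le_trans _ _ (\sum_(i < m) e * W i x)); last first.
  by rewrite -big_distrr /= sW1 mulr1 lerDl mulr_ge0 // mulr_ge0.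
rewrite (le_trans (ler_norm_sum _ _ _)) //; apply: ler_sum => i _.
rewrite normrM (ger0_norm (W0 i x)).
have [xa|ax] := leP x (a i).
  by rewrite /W (ramp_left (aSlt i) xa) (ramp_left (aSlt _)) ?subrr ?mulr0 // (le_trans xa) // ltW.
have [bx|xb] := leP (a i.+2) x.
  by rewrite /W (ramp_right (aSlt i.+1) bx) (ramp_right (aSlt _)) ?subrr ?mulr0 // (le_trans _ bx) // ltW.
rewrite ler_wpM2r //; rewrite !aS in xb *.
have xw : `|x - (a i + w)| <= w by rewrite ler_norml; lra.
apply: Hd; last exact: le_trans wd.
- by rewrite (le_trans xT) // /T; lra.
- move: xw; rewrite /T in x1 x2; rewrite !ler_norml; lra.
Qed.

End Staircase.

Section Riesz.
Variables (R : realType) (L : (R -> R) -> R) (V : R).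
Hypothesis LD : forall g h, Cb g -> Cb h -> L (fun x => g x + h x) = L g + L h.
Hypothesis LZ : forall c g, Cb g -> L (fun x => c * g x) = c * L g.
Hypothesis L_ge0 : forall g, Cb g -> (forall x, 0 <= g x) -> 0 <= L g.
Hypothesis L_cst1 : L (fun=> 1) = 1.
Hypothesis L_moment : forall g c, Cb g -> 0 <= c ->
  (forall x, g x <= c * x ^+ 2) -> L g <= c * V.

Lemma ler_L g h : Cb g -> Cb h -> (forall x, g x <= h x) -> L g <= L h.
Proof.
move=> gc hc gh; rewrite -subr_ge0.
have -> : L h - L g = L (fun x => h x + -1 * g x).
  by rewrite LD //; [rewrite LZ // mulN1r|exact: CbZ].
apply: L_ge0 => [|x]; first by apply: CbD => //; exact: CbZ.
by rewrite mulN1r subr_ge0.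
Qed.

Lemma L_cst c : L (fun=> c) = c.
Proof.
by have := LZ c (Cb_cst 1); rewrite L_cst1 !mulr1.
Qed.

Lemma L_sum (I : Type) (r : seq I) (c : I -> R) (g : I -> R -> R) :
  (forall i, Cb (g i)) ->
  L (fun x => \sum_(i <- r) c i * g i x) = \sum_(i <- r) c i * L (g i).
Proof.
move=> gi; elim: r => [|i r IH].
  by rewrite big_nil -[RHS](L_cst 0); congr L; apply/funext => x; rewrite big_nil.
rewrite big_cons -IH -LZ // -LD; [|exact: CbZ|by apply: Cb_sum => j; exact: CbZ].
by congr L; apply/funext => x; rewrite big_cons.
Qed.

Let V_ge0 : 0 <= V.
Proof.
have := L_moment (Cb_cst 0) (ler01 : 0 <= (1 : R)).
by rewrite L_cst mul1r; apply => x; rewrite mul1r sqr_ge0.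
Qed.

(** Ramps must start strictly to the right of [x]; this makes the infimum right continuous. *)
Definition cdf_set x : set R := [set y | exists a b, [/\ x < a, a < b & y = L (ramp a b)]].
Definition cdf_of x : R := inf (cdf_set x).

Lemma L_ramp_itv a b : 0 <= L (ramp a b) <= 1.
Proof.
apply/andP; split.
  by apply: L_ge0 => [|x]; [exact: Cb_ramp|have /andP[] := ramp_itv a b x].
rewrite -L_cst1; apply: ler_L => [||x]; [exact: Cb_ramp|exact: Cb_cst|].
by have /andP[] := ramp_itv a b x.
Qed.

Lemma cdf_set_lb x : has_lbound (cdf_set x).
Proof.
exists 0 => _ [a [b [_ _ ->]]]; by have /andP[] := L_ramp_itv a b.
Qed.

Lemma cdf_set_neq0 x : cdf_set x !=set0.
Proof. by exists (L (ramp (x + 1) (x + 2))), (x + 1), (x + 2); split => //; lra. Qed.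

Lemma cdf_of_le x a b : x < a -> a < b -> cdf_of x <= L (ramp a b).
Proof. by move=> xa ab; apply: ge_inf; [exact: cdf_set_lb|exists a, b]. Qed.

Lemma cdf_of_ge x c : (forall a b, x < a -> a < b -> c <= L (ramp a b)) -> c <= cdf_of x.
Proof.
by move=> H; apply: lb_le_inf; [exact: cdf_set_neq0|move=> _ [a [b [xa ab ->]]]; exact: H].
Qed.

Lemma L_ramp_le_cdf a b : a < b -> L (ramp a b) <= cdf_of b.
Proof.
move=> ab; apply: cdf_of_ge => c d bc cd.
apply: ler_L => [||x]; [exact: Cb_ramp|exact: Cb_ramp|].
have [xb|bx] := leP x b.
  by rewrite (ramp_left cd) ?(le_trans xb) ?(ltW bc) //; have /andP[] := ramp_itv a b x.
by rewrite (ramp_right ab) ?(ltW bx) //; have /andP[] := ramp_itv c d x.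
Qed.

Lemma cdf_of_nd : nondecreasing cdf_of.
Proof.
move=> x y xy; apply: cdf_of_ge => a b ya ab.
by apply: cdf_of_le => //; exact: le_lt_trans ya.
Qed.

Lemma cdf_of_itv x : 0 <= cdf_of x <= 1.
Proof.
apply/andP; split; first by apply: cdf_of_ge => a b _ _; have /andP[] := L_ramp_itv a b.
apply: (@le_trans _ _ (L (ramp (x + 1) (x + 2)))); first by apply: cdf_of_le; lra.
by have /andP[] := L_ramp_itv (x + 1) (x + 2).
Qed.

Lemma cdf_of_rc : right_continuous cdf_of.
Proof.
move=> x; apply/cvgrPdist_le => e e0.
have [_ [a [b [xa ab ->]]] Le] := inf_adherent e0 (conj (cdf_set_neq0 x) (cdf_set_lb x)).
near=> y; have xy : x <= y by near: y; exact: nbhs_right_ge.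
have ya : y < a by near: y; exact: nbhs_right_lt.
have := cdf_of_nd xy; have := cdf_of_le ya ab; move: Le; rewrite -/(cdf_of x) ler_norml; lra.
Unshelve. all: by end_near. Qed.

Lemma cdf_of_Ny : cdf_of @ -oo --> (0 : R).
Proof.
apply/cvgrPdist_le => e e0; near=> x.
(* Then -(x + 2) exceeds 1 + V/e, whose square is at least V/e, as the Chebyshev bound requires. *)
have xe : x < - (3 + V / e) by near: x; apply: nbhs_ninfty_lt; rewrite num_real.
have Ve : 0 <= V / e by rewrite divr_ge0 // ltW.
have /andP[F0 _] := cdf_of_itv x.
rewrite sub0r normrN ger0_norm //.
have y0 : x + 2 < 0 by lra.
have ab : x + 1 < x + 2 by lra.
have y2 : 0 < (x + 2) ^+ 2 by rewrite exprn_even_gt0 //= lt_eqF.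
apply: (@le_trans _ _ (L (ramp (x + 1) (x + 2)))); first by apply: cdf_of_le; lra.
apply: (@le_trans _ _ ((x + 2) ^- 2 * V)).
  apply: L_moment => [||y]; [exact: Cb_ramp|by rewrite invr_ge0 ltW|].
  have [yx|xy] := leP y (x + 2); last by rewrite (ramp_right ab (ltW xy)) mulr_ge0 ?invr_ge0 ?sqr_ge0.
  apply: (@le_trans _ _ 1); first by have /andP[] := ramp_itv (x + 1) (x + 2) y.
  by rewrite mulrC ler_pdivlMr // mul1r; nra.
rewrite mulrC ler_pdivrMr // mulrC -ler_pdivrMr //.
have : 1 + V / e <= - (x + 2) by lra.
set v := V / e in Ve *; nra.
Unshelve. all: by end_near. Qed.

Lemma cdf_of_y : cdf_of @ +oo --> (1 : R).
Proof.
apply/cvgrPdist_le => e e0; near=> x.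
have xe : 1 + V / e < x by near: x; apply: nbhs_pinfty_gt; rewrite num_real.
have Ve : 0 <= V / e by rewrite divr_ge0 // ltW.
have /andP[_ F1] := cdf_of_itv x.
rewrite ger0_norm ?subr_ge0 //.
suff : 1 - e <= cdf_of x by lra.
apply: cdf_of_ge => a b xa ab.
have x2 : 0 < x ^+ 2 by rewrite exprn_even_gt0 //= gt_eqF //; lra.
have : L (fun y => 1 + -1 * ramp a b y) <= x ^- 2 * V.
  apply: L_moment => [||y]; [|by rewrite invr_ge0 ltW|].
    by apply: CbD; [exact: Cb_cst|apply: CbZ; exact: Cb_ramp].
  have [ya|ay] := leP y a.
    by rewrite ramp_left // mulr1 subrr mulr_ge0 ?invr_ge0 ?sqr_ge0.
  have /andP[r0 _] := ramp_itv a b y.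
  apply: (@le_trans _ _ 1); first by lra.
  by rewrite mulrC ler_pdivlMr // mul1r; nra.
rewrite LD ?LZ ?L_cst1; [|exact: Cb_ramp|exact: Cb_cst|by apply: CbZ; exact: Cb_ramp].
have : x ^- 2 * V <= e.
  rewrite mulrC ler_pdivrMr // mulrC -ler_pdivrMr //.
  by set v := V / e in Ve xe *; nra.
lra.
Unshelve. all: by end_near. Qed.

Section Measure.
Variable nu : probability R R.
Hypothesis nuE : forall r, nu `]-oo, r]%classic = (cdf_of r)%:E.

Lemma Int_ramp_itv a b : a < b -> cdf_of a <= Int nu (ramp a b) <= cdf_of b.
Proof.
move=> ab; apply/andP; split.
  apply: (Int_indic_ge _ (nuE a)) => [//||x]; first exact: Cb_ramp.
  rewrite indicE; have [xa|ax] := leP x a.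
    by rewrite mem_set /= ?in_itv //= ramp_left.
  rewrite memNset /= ?in_itv /=; last by apply/negP; rewrite -ltNge.
  by have /andP[] := ramp_itv a b x.
apply: (Int_indic_le _ (nuE b)) => [//||x]; first exact: Cb_ramp.
rewrite indicE; have [xa|ax] := leP x b.
  by rewrite mem_set /= ?in_itv //=; have /andP[] := ramp_itv a b x.
by rewrite (ramp_right ab (ltW ax)).
Qed.

Lemma telescope2 (u : nat -> R) n :
  \sum_(j < n) (u j - u j.+2) = u 0%N + u 1%N - u n - u n.+1.
Proof.
elim: n => [|n IH]; first by rewrite big_ord0; ring.
by rewrite big_ord_recr /= IH; ring.
Qed.

(** On each of n slices both sides lie between the values of [cdf_of] at [c j.+2] and [c j]. The
    gaps telescope to at most 2, so the average differs by at most 2/n. *)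
Lemma Int_ramp a b : a < b -> Int nu (ramp a b) = L (ramp a b).
Proof.
move=> ab; apply/eqP; rewrite -subr_eq0 -normr_le0.
suff H n : (0 < n)%N -> `|Int nu (ramp a b) - L (ramp a b)| <= 2 / n%:R.
  apply/ler_addgt0Pr => e e0; rewrite add0r; near \oo => n.
  have n0 : (0 < n)%N by near: n; exact: nbhs_infty_gt.
  rewrite (le_trans (H n n0)) // ler_pdivrMr ?ltr0n // mulrC -ler_pdivrMr //.
  by near: n; exact: nbhs_infty_ger.
move=> n0; have nr : 0 < (n%:R : R) by rewrite ltr0n.
pose w := (b - a) / n%:R; pose c (j : nat) := b - j%:R * w.
have w0 : 0 < w by rewrite divr_gt0 // subr_gt0.
have cS j : c j.+1 < c j by rewrite /c ltrD2l ltrN2 ltr_pM2r // ltr_nat.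
have rE : ramp a b = (fun x => \sum_(j < n) n%:R^-1 * ramp (c j.+1) (c j) x).
  by apply/funext => x; rewrite (ramp_split x n0 ab) big_distrr.
have IntE : Int nu (ramp a b) = \sum_(j < n) n%:R^-1 * Int nu (ramp (c j.+1) (c j)).
  rewrite rE; elim: (index_enum 'I_n) => [|j r IH].
    rewrite big_nil -[RHS](Int_cst nu 0); congr Int.
    by apply/funext => x; rewrite big_nil.
  rewrite big_cons -IH -IntZ; last exact: Cb_ramp.
  rewrite -IntD; [|by apply: CbZ; exact: Cb_ramp|by apply: Cb_sum => i; apply: CbZ; exact: Cb_ramp].
  by congr Int; apply/funext => x; rewrite big_cons.
have LE : L (ramp a b) = \sum_(j < n) n%:R^-1 * L (ramp (c j.+1) (c j)).
  by rewrite rE L_sum // => j; exact: Cb_ramp.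
rewrite IntE LE -sumrB; under eq_bigr do rewrite -mulrBr.
rewrite -big_distrr /= normrM ger0_norm ?invr_ge0 ?(ltW nr) // mulrC.
rewrite ler_wpM2r ?invr_ge0 ?(ltW nr) // (le_trans (ler_norm_sum _ _ _)) //.
apply: (@le_trans _ _ (\sum_(j < n) (cdf_of (c j) - cdf_of (c j.+2)))).
  apply: ler_sum => j _.
  have := Int_ramp_itv (cS j); have := L_ramp_le_cdf (cS j).
  have := cdf_of_le (cS j.+1) (cS j); have := cdf_of_nd (ltW (cS j.+1)).
  rewrite ler_norml; lra.
rewrite (telescope2 (fun j => cdf_of (c j))).
have := cdf_of_itv (c 0%N); have := cdf_of_itv (c 1%N).
have := cdf_of_itv (c n); have := cdf_of_itv (c n.+1); lra.
Unshelve. all: by end_near. Qed.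

Lemma Int_norm_le g h : Cb g -> Cb h -> (forall x, `|g x| <= h x) -> `|Int nu g| <= Int nu h.
Proof.
move=> gc hc gh; rewrite ler_norml; apply/andP; split.
  rewrite -mulN1r -IntZ //; apply: ler_Int => // [|x]; first exact: CbZ.
  by rewrite mulN1r; have := gh x; rewrite ler_norml => /andP[].
by apply: ler_Int => // x; rewrite (le_trans (ler_norm _)).
Qed.

Lemma L_norm_le g h : Cb g -> Cb h -> (forall x, `|g x| <= h x) -> `|L g| <= L h.
Proof.
move=> gc hc gh; rewrite ler_norml; apply/andP; split.
  rewrite -mulN1r -LZ //; apply: ler_L => // [|x]; first exact: CbZ.
  by rewrite mulN1r; have := gh x; rewrite ler_norml => /andP[].
by apply: ler_L => // x; rewrite (le_trans (ler_norm _)).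
Qed.

Lemma Int_eq_L g : Cb g -> Int nu g = L g.
Proof.
move=> gc; have [g1 [M gM]] := gc.
have M0 : 0 <= M by rewrite (le_trans _ (gM 0)).
pose P h := Cb h /\ Int nu h = L h.
have P0 : P (fun=> 0) by split; [exact: Cb_cst|rewrite Int_cst L_cst].
have PD h c a b : a < b -> P h -> P (fun x => h x + c * ramp a b x).
  move=> ab [hc hE]; have rc := CbZ c (Cb_ramp a b); split; first exact: CbD.
  by rewrite IntD // LD // hE IntZ ?LZ ?Int_ramp //; exact: Cb_ramp.
apply/eqP; rewrite -subr_eq0 -normr_le0; apply/ler_addgt0Pr => e e0; rewrite add0r.
(* Makes the tail contribution 2 M V / K^2 at most e/4, so each functional errs by at most e/2. *)
pose K := 1 + 8 * M * V / e.
have KV : 0 <= 8 * M * V / e by rewrite divr_ge0 ?(ltW e0) // !mulr_ge0.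
have K0 : 0 < K by rewrite /K; lra.
have e4 : 0 < e / 4 by rewrite divr_gt0.
have [G [Gc GE] gG] := staircase_approx P0 PD g1 gM e4 K0.
have [tc tE] : P (tail_ramp K).
  have Q1 : P (fun=> 1) by split; [exact: Cb_cst|rewrite Int_cst L_cst].
  have := PD _ (-1) K (K + 1) _ Q1; rewrite ltrDl ltr01 => /(_ isT) Q2.
  have := PD _ 1 (- (K + 1)) (- K) _ Q2; rewrite ltrN2 ltrDl ltr01 => /(_ isT) Q3.
  by congr P: Q3; apply/funext => x; rewrite mul1r.
have dc : Cb (fun x => g x + -1 * G x) by apply: CbD => //; exact: CbZ.
have hc : Cb (fun x => e / 4 + 2 * M * tail_ramp K x).
  by apply: CbD; [exact: Cb_cst|exact: CbZ].
have dh x : `|g x + -1 * G x| <= e / 4 + 2 * M * tail_ramp K x by rewrite mulN1r.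
have := Int_norm_le dc hc dh; have := L_norm_le dc hc dh.
have cc := Cb_cst (e / 4); have ztc := CbZ (2 * M) tc; have zGc := CbZ (-1) Gc.
rewrite (LD gc zGc) (LD cc ztc) (LZ _ Gc) (LZ _ tc) L_cst.
rewrite (IntD _ gc zGc) (IntD _ cc ztc) (IntZ _ _ Gc) (IntZ _ _ tc) Int_cst GE tE.
have LK : L (tail_ramp K) <= K ^- 2 * V.
  by apply: L_moment => // [|x]; [rewrite invr_ge0 sqr_ge0|exact: tail_ramp_le].
have LM : 2 * M * L (tail_ramp K) <= e / 4.
  apply: (@le_trans _ _ (2 * M * (K ^- 2 * V))); first by rewrite ler_wpM2l // mulr_ge0.
  rewrite mulrCA ler_pdivrMl ?exprn_gt0 //.
  have -> : 2 * M * V = 8 * M * V / e * (e / 4) by field; rewrite gt_eqF.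
  by rewrite ler_wpM2r ?(ltW e4) // /K; set u := _ / e in KV *; nra.
rewrite !ler_norml !mulN1r; lra.
Qed.

End Measure.

Theorem exists_representing_probability :
  exists nu : probability R R, forall g, Cb g -> Int nu g = L g.
Proof.
have [nu nuE] := exists_probability_of_cdf cdf_of_nd cdf_of_rc cdf_of_Ny cdf_of_y.
by exists nu => g; exact: Int_eq_L.
Qed.

End Riesz.

(** * Exponential moments of the diagonal entries *)

Section ExponentialBounds.
Variable R : realType.
Implicit Types x y q a : R.

Lemma expR_ge_quad y : -2 <= y -> 1 + y + y ^+ 2 / 4 <= expR y.
Proof.
move=> y2; have -> : expR y = expR (y / 2) ^+ 2.
  by rewrite -expRM_natl; congr expR; field.
have -> : 1 + y + y ^+ 2 / 4 = (1 + y / 2) ^+ 2 by field.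
by rewrite ler_pXn2r ?nnegrE ?expR_ge0 ?expR_ge1Dx //; lra.
Qed.

Lemma expR_le_quad y : y <= 1 / 2 -> expR y <= 1 + y + 2 * y ^+ 2.
Proof.
move=> y2; have h := expR_ge1Dx (- y).
have e0 := expR_gt0 y; have : expR y * expR (- y) = 1 by rewrite -expRD subrr expR0.
nra.
Qed.

Lemma bernoulli_exp_le q a : 0 <= q <= 1 -> `|a| <= 1 / 2 ->
  q * expR (a * (1 - q)) + (1 - q) * expR (a * (0 - q)) <= expR (2 * a ^+ 2 * q).
Proof.
move=> /andP[q0 q1]; rewrite ler_norml => /andP[a1 a2].
have h1 : expR (a * (1 - q)) <= 1 + a * (1 - q) + 2 * (a * (1 - q)) ^+ 2.
  by apply: expR_le_quad; nra.
have h2 : expR (a * (0 - q)) <= 1 + a * (0 - q) + 2 * (a * (0 - q)) ^+ 2.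
  by apply: expR_le_quad; nra.
apply: le_trans (expR_ge1Dx _).
apply: (@le_trans _ _ (q * (1 + a * (1 - q) + 2 * (a * (1 - q)) ^+ 2) +
   (1 - q) * (1 + a * (0 - q) + 2 * (a * (0 - q)) ^+ 2))).
  by rewrite lerD // ler_wpM2l // subr_ge0.
rewrite -subr_ge0 [X in 0 <= X](_ : _ = 2 * (a * q) ^+ 2); first by rewrite mulr_ge0 ?sqr_ge0.
ring.
Qed.

(** Centring cancels the linear terms and leaves 1 + a^2 q (1 - q) / 4. As 1 - q >= 1/2, the
    constant 16 leaves room to return to an exponential. *)
Lemma bernoulli_exp_ge q a : 0 <= q <= 1 / 2 -> `|a| <= 1 / 2 ->
  expR (a ^+ 2 * q / 16) <= q * expR (a * (1 - q)) + (1 - q) * expR (a * (0 - q)).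
Proof.
move=> /andP[q0 q1]; rewrite ler_norml => /andP[a1 a2].
have h1 : 1 + a * (1 - q) + (a * (1 - q)) ^+ 2 / 4 <= expR (a * (1 - q)).
  by apply: expR_ge_quad; nra.
have h2 : 1 + a * (0 - q) + (a * (0 - q)) ^+ 2 / 4 <= expR (a * (0 - q)).
  by apply: expR_ge_quad; nra.
apply: (@le_trans _ _ (q * (1 + a * (1 - q) + (a * (1 - q)) ^+ 2 / 4) +
   (1 - q) * (1 + a * (0 - q) + (a * (0 - q)) ^+ 2 / 4))); last first.
  by rewrite lerD // ler_wpM2l //; lra.
have a4 : 0 <= a ^+ 2 <= 1 / 4 by rewrite sqr_ge0; nra.
set b := a ^+ 2 in a4 *; have /andP[b0 b4] := a4.
have z0 : 0 <= b * q by rewrite mulr_ge0.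
have z1 : b * q / 16 <= 1 / 2 by nra.
rewrite (le_trans (expR_le_quad z1)) //.
have -> : q * (1 + a * (1 - q) + (a * (1 - q)) ^+ 2 / 4) +
   (1 - q) * (1 + a * (0 - q) + (a * (0 - q)) ^+ 2 / 4) = 1 + b * q * (1 - q) / 4.
  by rewrite /b; field.
set z := b * q in z0 z1 *; nra.
Qed.

(** With u = exp (t x), completing the square gives 4 eta (u - eta u^2) <= 1, so the left side is at
    most 1; it is nonpositive for x <= T + 1, and beyond that point the ramp exceeds 1. Two
    exponential moments thus suffice for a lower bound. *)
Lemma ramp_ge_exp (t T eta x : R) : 0 <= t -> 0 < eta ->
  4 * eta * (expR (t * x) - expR (t * (T + 1)) - eta * expR (2 * t * x)) <= Num.max (x - T) 0.
Proof.
move=> t0 eta0; have -> : expR (2 * t * x) = expR (t * x) ^+ 2.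
  by rewrite -expRM_natl; congr expR; ring.
have u0 := expR_gt0 (t * x); have w0 := expR_gt0 (t * (T + 1)).
rewrite le_max; have [xT|Tx] := leP x (T + 1); apply/orP; [right|left].
  have : expR (t * x) <= expR (t * (T + 1)) by rewrite ler_expR ler_wpM2l.
  set u := expR _ in u0 *; set w := expR _ in w0 * => uw.
  rewrite mulr_ge0_le0 //; [by rewrite mulr_ge0 // ltW|].
  have : 0 <= eta * u ^+ 2 by rewrite mulr_ge0 ?sqr_ge0 // ltW.
  lra.
set u := expR _ in u0 *; set w := expR _ in w0 *.
apply: (@le_trans _ _ 1); last by lra.
have := sqr_ge0 (2 * eta * u - 1).
have : 0 < eta * w by rewrite mulr_gt0.
nra.
Qed.

(** Averages the tangent inequality of the exponential at the mean. *)
Lemma expR_jensen (n : nat) (y : 'I_n -> R) : (0 < n)%N ->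
  expR (n%:R^-1 * \sum_i y i) <= n%:R^-1 * \sum_i expR (y i).
Proof.
move=> n0; have nr : 0 < (n%:R : R) by rewrite ltr0n.
set m := _ * \sum_i y i.
have -> : expR m = n%:R^-1 * \sum_(i < n) expR m * (1 + (y i - m)).
  rewrite -big_distrr /= big_split /= sumrB !sumr_const card_ord.
  have -> : \sum_i y i = n%:R * m by rewrite /m mulrA mulfV ?mul1r // gt_eqF.
  rewrite -[m *+ n]mulr_natl subrr addr0 mulrCA mulVf ?mulr1 // gt_eqF //.
rewrite ler_wpM2l ?invr_ge0 ?(ltW nr) // ler_sum // => i _.
have -> : expR (y i) = expR m * expR (y i - m) by rewrite -expRD addrC subrK.
by rewrite ler_wpM2l ?expR_ge0 // expR_ge1Dx.
Qed.

End ExponentialBounds.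

Lemma bexp_prod_inj (R : realFieldType) (T J : finType) (q : T -> R) (P : pred J)
    (k : J -> T) (g : T -> bool -> R) : {in P &, injective k} ->
  bexp q (fun E => \prod_(j | P j) g (k j) (k j \in E)) =
  \prod_(j | P j) (q (k j) * g (k j) true + (1 - q (k j)) * g (k j) false).
Proof.
move=> ki; pose A := [set k j | j in P]%SET.
have kE (F : T -> R) : \prod_(j | P j) F (k j) = \prod_u (if u \in A then F u else 1).
  by rewrite -(big_imset (h := k) F ki) /= big_mkcond.
rewrite (kE (fun u => q u * g u true + (1 - q u) * g u false)).
transitivity (\prod_u (q u * (if u \in A then g u true else 1) +
    (1 - q u) * (if u \in A then g u false else 1))).
  rewrite -(bexp_prod q (fun u b => if u \in A then g u b else 1)).
  by apply: eq_bexp => E; rewrite (kE (fun u => g u (u \in E))).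
by apply: eq_bigr => u _; case: (u \in A) => //; ring.
Qed.

Section DiagonalMoments.
Variables (R : realType) (f : R -> R -> R) (eps : nat -> R) (B : R).
Hypothesis B1 : 1 <= B.
Hypothesis fB : forall x y : R, 0 <= x <= 1 -> 0 <= y <= 1 -> 0 <= f x y <= B.
Hypothesis fC : forall x y : R, 0 <= x <= 1 -> 0 <= y <= 1 -> f x y = f y x.
Hypothesis eps_gt0 : forall N, 0 < eps N.
Hypothesis eps0 : eps @ \oo --> 0.
Hypothesis Neps : (fun N => N%:R * eps N) @ \oo --> +oo.

Local Notation q := (edge_q f eps).
Local Notation sc := (scale eps).

(** The variance of the i-th scaled diagonal entry, up to the factors 1 - q, which are close to
    1. *)
Definition degree_mean N (i : 'I_N) : R :=
  N%:R^-1 * \sum_(l | l != i) f (vpos R i) (vpos R l).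

Lemma ed_inj N (i : 'I_N) : injective (ed i).
Proof.
move=> l l'; rewrite /ed; case: (ltnP i l) => a; case: (ltnP i l') => b [] //.
  by move=> /(congr1 val) /= e1 /(congr1 val) /= e2; exfalso; lia.
by move=> /(congr1 val) /= e1 /(congr1 val) /= e2; exfalso; lia.
Qed.

Section Fixed.
Variables (N : nat) (N0 : (0 < N)%N).

Lemma scaled_centered_diag (E : {set 'I_N * 'I_N}) i : E \subset upper N ->
  scaled_centered f eps E i i =
  - (sc N)^-1 * \sum_(l | l != i) ((ed i l \in E)%:R - q (ed i l)).
Proof.
move=> Eu; rewrite scaled_centeredE // mxE lapmx_diag !mxE edge_q_diag mulr0 addr0.
congr (_ * _); rewrite [RHS]big_mkcond; apply: eq_bigr => l _.
by case: (l != i); rewrite ?mulr1 ?mulr0.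
Qed.

Lemma bexp_expR_diag t (i : 'I_N) :
  bexp (q (N := N)) (fun E => expR (t * scaled_centered f eps E i i)) =
  \prod_(l | l != i) (q (ed i l) * expR (- (t / sc N) * (1 - q (ed i l))) +
     (1 - q (ed i l)) * expR (- (t / sc N) * (0 - q (ed i l)))).
Proof.
rewrite -(bexp_prod_inj (q (N := N)) (fun u (b : bool) => expR (- (t / sc N) * (b%:R - q u))));
  last by move=> l l' _ _; exact: ed_inj.
apply: eq_bexp_upper => E Eu; rewrite scaled_centered_diag //.
rewrite -expR_sum; congr expR; rewrite mulrA big_distrr /=.
by apply: eq_bigr => l _; congr (_ * _); ring.
Qed.

Lemma sum_sqr_edge_q t (i : 'I_N) c :
  \sum_(l | l != i) (c * (- (t / sc N)) ^+ 2 * q (ed i l)) = c * t ^+ 2 * degree_mean i.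
Proof.
rewrite -big_distrr /= sqrrN exprMn exprVn (sqr_scale eps_gt0) /degree_mean.
have -> : \sum_(l | l != i) q (ed i l) = eps N * \sum_(l | l != i) f (vpos R i) (vpos R l).
  by rewrite big_distrr; apply: eq_bigr => l li; rewrite edge_q_ed // eq_sym.
by field; rewrite !gt_eqF // ltr0n.
Qed.

Lemma degree_mean_le i : degree_mean (N := N) i <= B.
Proof.
rewrite /degree_mean mulrC ler_pdivrMr ?ltr0n //.
apply: (@le_trans _ _ (\sum_(l < N) B)); last by rewrite sumr_const card_ord mulr_natr.
rewrite [leLHS]big_mkcond; apply: ler_sum => l _.
have /andP[_ fb] := fB (vpos_itv R i) (vpos_itv R l).
by case: ifP => // _; rewrite (le_trans ler01).
Qed.

Hypothesis q12 : forall u, 0 <= q (N := N) u <= 1 / 2.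

Lemma bexp_expR_diag_ge t (i : 'I_N) : `|t / sc N| <= 1 / 2 ->
  expR (t ^+ 2 / 16 * degree_mean i) <=
  bexp (q (N := N)) (fun E => expR (t * scaled_centered f eps E i i)).
Proof.
move=> ts; rewrite bexp_expR_diag.
have -> : t ^+ 2 / 16 * degree_mean i = 1 / 16 * t ^+ 2 * degree_mean i by field.
rewrite -sum_sqr_edge_q expR_sum; apply: ler_prod => l _; rewrite expR_ge0 /=.
have -> : 1 / 16 * (- (t / sc N)) ^+ 2 * q (ed i l) = (- (t / sc N)) ^+ 2 * q (ed i l) / 16.
  by ring.
by apply: bernoulli_exp_ge => //; rewrite normrN.
Qed.

Lemma bexp_expR_diag_le t (i : 'I_N) : `|t / sc N| <= 1 / 2 ->
  bexp (q (N := N)) (fun E => expR (t * scaled_centered f eps E i i)) <=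
  expR (2 * t ^+ 2 * B).
Proof.
move=> ts; rewrite bexp_expR_diag; apply: (@le_trans _ _ (expR (2 * t ^+ 2 * degree_mean i))).
  rewrite -sum_sqr_edge_q expR_sum; apply: ler_prod => l _.
  have /andP[q0 q1] := q12 (ed i l).
  rewrite bernoulli_exp_le ?q0 ?normrN //=; last by lra.
  by rewrite andbT addr_ge0 // mulr_ge0 ?expR_ge0 //; lra.
by rewrite ler_expR ler_wpM2l ?degree_mean_le // mulr_ge0 ?sqr_ge0.
Qed.

(** [ramp_ge_exp] averaged over the diagonal, with a lower bound at order t and an upper bound at
    order 2t; hence the condition on 2t and 8 t^2 = 2 (2t)^2. *)
Lemma esd_ramp_lower t T eta : 0 <= t -> 0 < eta -> 2 * t / sc N <= 1 / 2 ->
  4 * eta * (expR (t ^+ 2 / 16 * (N%:R^-1 * \sum_i degree_mean (N := N) i)) -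
    expR (t * (T + 1)) - eta * expR (8 * t ^+ 2 * B)) <=
  bexp (q (N := N)) (fun E => esd_int (scaled_centered f eps E) (fun x => Num.max (x - T) 0)).
Proof.
move=> t0 eta0 ts; have s0 := scale_gt0 eps_gt0 N0.
have q01 u : 0 <= q (N := N) u <= 1 by have /andP[-> h] := q12 u; lra.
have ts2 : `|2 * t / sc N| <= 1 / 2 by rewrite ger0_norm // divr_ge0 ?(ltW s0) ?mulr_ge0.
have ts1 : `|t / sc N| <= 1 / 2.
  have := ts2; rewrite -mulrA normrM ger0_norm //.
  by have := normr_ge0 (t / sc N); lra.
have nr : 0 < (N%:R : R) by rewrite ltr0n.
apply: (@le_trans _ _ (bexp (q (N := N)) (fun E => N%:R^-1 * \sum_i
    (4 * eta * (expR (t * scaled_centered f eps E i i) - expR (t * (T + 1)) -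
       eta * expR (2 * t * scaled_centered f eps E i i)))))); last first.
  apply: ler_bexp => // E.
  apply: le_trans (esd_ramp_diag N0 _ (tr_scaled_centered _ _ _)).
  by rewrite ler_wpM2l ?invr_ge0 ?(ltW nr) // ler_sum // => i _; exact: ramp_ge_exp.
rewrite bexpZ bexp_sum.
apply: (@le_trans _ _ (N%:R^-1 * \sum_(i < N) 4 * eta * (expR (t ^+ 2 / 16 * degree_mean i)
    - expR (t * (T + 1)) - eta * expR (8 * t ^+ 2 * B)))); last first.
  rewrite ler_wpM2l ?invr_ge0 ?(ltW nr) // ler_sum // => i _.
  rewrite bexpZ !bexpB bexp_cst bexpZ ler_wpM2l ?mulr_ge0 ?(ltW eta0) //.
  apply: lerB; first by apply: lerB => //; exact: bexp_expR_diag_ge.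
  apply: ler_wpM2l; first exact: ltW.
  have -> : 8 * t ^+ 2 * B = 2 * (2 * t) ^+ 2 * B by ring.
  exact: bexp_expR_diag_le.
rewrite -[X in _ <= _ * X]big_distrr /= [leRHS]mulrCA.
apply: ler_wpM2l; first by rewrite mulr_ge0 // ltW.
have avgE (F : 'I_N -> R) c d : N%:R^-1 * (\sum_i (F i - c - d)) = N%:R^-1 * (\sum_i F i) - c - d.
  rewrite !sumrB !sumr_const card_ord -[c *+ N]mulr_natl -[d *+ N]mulr_natl.
  by rewrite !mulrBr !mulKf ?gt_eqF.
rewrite avgE; apply: lerB => //; apply: lerB => //.
have -> : t ^+ 2 / 16 * (N%:R^-1 * \sum_i degree_mean (N := N) i) =
    N%:R^-1 * \sum_(i < N) (t ^+ 2 / 16 * degree_mean i).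
  by rewrite mulrCA [X in _ * X]big_distrr.
exact: expR_jensen.
Qed.

End Fixed.
(** As [x0] may be an end point of [0, 1], the count uses a one-sided window of length d' <= 1/2
    that has [x0] as an end and stays inside. *)
Lemma near_grid_count (x0 d : R) : 0 <= x0 <= 1 -> 0 < d -> exists2 rho : R, 0 < rho &
  \forall N \near \oo, rho * N%:R <= #|[set i : 'I_N | `|vpos R i - x0| <= d]%SET|%:R.
Proof.
move=> /andP[x00 x01] d0; pose d' := Num.min d (1 / 2).
have d'0 : 0 < d' by rewrite lt_min d0; lra.
have d'd : d' <= d by rewrite ge_min lexx.
have d'2 : d' <= 1 / 2 by rewrite ge_min lexx orbT.
have [x1 [x10 x11 xx0 xx1]] : exists x1, [/\ 0 <= x1, x1 + d' <= 1, x1 <= x0 & x0 <= x1 + d'].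
  by case: (leP x0 (1 / 2)) => h; [exists x0|exists (x0 - d')]; split; lra.
exists (d' / 2); first by rewrite divr_gt0.
near=> N.
have N0 : (0 < N)%N by near: N; exact: nbhs_infty_gt.
have nr : 0 < (N%:R : R) by rewrite ltr0n.
pose k := Num.truncn (N%:R * d'); pose a := Num.truncn (N%:R * x1).
have [ka ka'] : k%:R <= N%:R * d' /\ N%:R * d' < k.+1%:R.
  by apply/andP; apply: truncn_itv; rewrite mulr_ge0 // ltW.
have [aa aa'] : a%:R <= N%:R * x1 /\ N%:R * x1 < a.+1%:R.
  by apply/andP; apply: truncn_itv; rewrite mulr_ge0.
have akN : (a + k <= N)%N.
  rewrite -(ler_nat R) natrD (le_trans (lerD aa ka)) // -mulrDr ler_piMr //.
have lt (j : 'I_k) : (a + j < N)%N by rewrite (leq_trans _ akN) // ltn_add2l.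
pose h j := Ordinal (lt j).
have hi : injective h by move=> j j' /(congr1 val) /= /addnI /val_inj.
apply: (@le_trans _ _ k%:R).
  have : 2 / d' <= N%:R by near: N; exact: nbhs_infty_ger.
  by rewrite ler_pdivrMr // -natr1 in ka' *; lra.
rewrite ler_nat -[leqLHS](card_ord k) -cardsT -(card_imset _ hi); apply: subset_leq_card.
apply/fintype.subsetP => _ /imsetP[j _ ->]; rewrite inE /vpos /=.
have v1 : x1 < (a + j).+1%:R / N%:R.
  rewrite ltr_pdivlMr // mulrC (lt_le_trans aa') // ler_nat ltnS leq_addr //.
have v2 : (a + j).+1%:R / N%:R <= x1 + d'.
  rewrite ler_pdivrMr // mulrC mulrDr (le_trans _ (lerD aa ka)) //.
  by rewrite -natrD ler_nat -addnS leq_add2l.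
rewrite ler_norml; lra.
Unshelve. all: by end_near. Qed.

Hypothesis fu : forall e : R, 0 < e -> exists2 d : R, 0 < d &
  forall x y x' y' : R, 0 <= x <= 1 -> 0 <= y <= 1 -> 0 <= x' <= 1 -> 0 <= y' <= 1 ->
    `|x - x'| <= d -> `|y - y'| <= d -> `|f x y - f x' y'| <= e.

Lemma near_degree_mean x0 y0 : 0 <= x0 <= 1 -> 0 <= y0 <= 1 -> f x0 y0 != 0 ->
  exists2 v, 0 < v & \forall N \near \oo, v <= N%:R^-1 * \sum_i degree_mean (N := N) i.
Proof.
move=> hx hy f0; have m0 : 0 < f x0 y0 by rewrite lt_def f0; have /andP[] := fB hx hy.
set m := f x0 y0 in m0 f0.
have [|d d0 Hd] := fu (e := m / 2); first by rewrite divr_gt0.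
have [rho rho0 Hrho] := near_grid_count hx d0.
have [sig sig0 Hsig] := near_grid_count hy d0.
(* Near (x0, y0) the kernel is at least m/2; the other factor 1/2 pays for the excluded index l = i
   once sig N >= 2. *)
exists (rho * (sig * m / 4)); first by rewrite !mulr_gt0.
near=> N.
have N0 : (0 < N)%N by near: N; exact: nbhs_infty_gt.
have nr : 0 < (N%:R : R) by rewrite ltr0n.
have cI : rho * N%:R <= #|[set i : 'I_N | `|vpos R i - x0| <= d]%SET|%:R by near: N.
have cJ : sig * N%:R <= #|[set i : 'I_N | `|vpos R i - y0| <= d]%SET|%:R by near: N.
set I := finset _ in cI; set J := finset _ in cJ.
have N2 : 2 / sig <= N%:R by near: N; exact: nbhs_infty_ger.
have dm0 (i : 'I_N) : 0 <= degree_mean i.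
  rewrite mulr_ge0 ?invr_ge0 ?(ltW nr) // sumr_ge0 // => l _.
  by have /andP[] := fB (vpos_itv R i) (vpos_itv R l).
have dmI (i : 'I_N) : i \in I -> sig * m / 4 <= degree_mean i.
  rewrite inE => iI; rewrite /degree_mean [leRHS]mulrC ler_pdivlMr //.
  apply: (@le_trans _ _ (\sum_(l | l \in J :\ i) m / 2)).
    rewrite sumr_const -mulr_natr.
    have : (#|J|%:R : R) <= #|(J :\ i)%SET|%:R + 1.
      by rewrite natr1 ler_nat (cardsD1 i J) addnC -addn1 leq_add2l leq_b1.
    move: N2; rewrite ler_pdivrMr //; nra.
  rewrite [leLHS]big_mkcond [leRHS]big_mkcond; apply: ler_sum => l _.
  rewrite !inE; case: (l != i) => //=; case: ifP => [lJ|_]; last first.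
    by have /andP[] := fB (vpos_itv R i) (vpos_itv R l).
  have := Hd _ _ _ _ (vpos_itv R i) (vpos_itv R l) hx hy iI lJ.
  by rewrite -/m ler_norml; lra.
rewrite [leRHS]mulrC ler_pdivlMr //.
apply: (@le_trans _ _ (\sum_(i in I) sig * m / 4)).
  rewrite sumr_const -[_ *+ #|_|]mulr_natr [leRHS]mulrC mulrAC ler_wpM2r //.
  by rewrite divr_ge0 // mulr_ge0 // ltW.
rewrite [leLHS]big_mkcond; apply: ler_sum => i _; case: ifP => [/dmI //|_].
exact: dm0.
Unshelve. all: by end_near. Qed.

Lemma near_edge_q_half : \forall N \near \oo, forall u, 0 <= q (N := N) u <= 1 / 2.
Proof.
have B0 : 0 < B by rewrite (lt_le_trans ltr01).
near=> N => u; rewrite (edge_q_ge0 fB eps_gt0) /= (le_trans (edge_q_le B1 fB eps_gt0 u)) //.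
rewrite -ler_pdivlMr //.
by near: N; apply: (cvgr_le _ eps0); rewrite !divr_gt0.
Unshelve. all: by end_near. Qed.

Lemma esd_ramp_bounded_below x0 y0 T : 0 <= x0 <= 1 -> 0 <= y0 <= 1 -> f x0 y0 != 0 -> 0 <= T ->
  exists2 c, 0 < c & \forall N \near \oo, c <=
    bexp (q (N := N)) (fun E => esd_int (scaled_centered f eps E) (fun x => Num.max (x - T) 0)).
Proof.
move=> hx hy f0 T0; have [v v0 Hv] := near_degree_mean hx hy f0.
(* Chosen so that t^2 v / 16 = t (T + 1) + t: the lower bound beats exp (t (T + 1)) by a factor 1 +
   t. *)
pose t := 16 * (T + 2) / v.
have t0 : 0 < t by rewrite divr_gt0 // mulr_gt0 //; lra.
pose w := expR (t * (T + 1)); pose W := expR (8 * t ^+ 2 * B).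
have w0 : 0 < w by exact: expR_gt0.
have W0 : 0 < W by exact: expR_gt0.
pose u := expR (t ^+ 2 / 16 * v).
have uw : w * (1 + t) <= u.
  have expE : t ^+ 2 / 16 * v = t * (T + 1) + t by rewrite /t; field; rewrite gt_eqF.
  by rewrite /u expE expRD ler_wpM2l ?(ltW w0) // expR_ge1Dx.
(* The second-moment term then takes exactly half of the gain w t. *)
pose eta := w * t / (2 * W).
have eta0 : 0 < eta by apply: divr_gt0; apply: mulr_gt0.
have c0 : 0 < 2 * eta * w * t by apply: mulr_gt0 => //; apply: mulr_gt0 => //; apply: mulr_gt0.
exists (2 * eta * w * t) => //.
near=> N.
have N0 : (0 < N)%N by near: N; exact: nbhs_infty_gt.
have q12 : forall u, 0 <= q (N := N) u <= 1 / 2 by near: N; exact: near_edge_q_half.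
have vN : v <= N%:R^-1 * \sum_i degree_mean (N := N) i by near: N.
have ts : 2 * t / sc N <= 1 / 2.
  near: N; have : (fun N => 2 * t * (sc N)^-1) @ \oo --> 2 * t * 0.
    by apply: cvgMr; exact: scaleV0.
  by rewrite mulr0 => h; apply: (cvgr_le _ h); rewrite divr_gt0.
apply: le_trans (esd_ramp_lower N0 q12 T (ltW t0) eta0 ts).
have uN : u <= expR (t ^+ 2 / 16 * (N%:R^-1 * \sum_i degree_mean (N := N) i)).
  by rewrite ler_expR ler_wpM2l // divr_ge0 ?sqr_ge0.
set z := expR _ in uN *; rewrite -/w -/W.
have -> : 2 * eta * w * t = 4 * eta * (w * t / 2) by field.
apply: ler_wpM2l; first by rewrite mulr_ge0 // ltW.
have -> : eta * W = w * t / 2 by rewrite /eta; field; rewrite gt_eqF.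
lra.
Unshelve. all: by end_near. Qed.

Hypothesis moment2 : exists K : R, \forall N \near \oo,
  bexp (q (N := N)) (fun E => esd_int (scaled_centered f eps E) (fun x => x ^+ 2)) <= K.

(** The unbounded ramp is no admissible test function; capping it at [D] loses at most x^2 / D,
    which the second moment keeps below c/2. *)
Lemma esd_bounded_below_tail x0 y0 T : 0 <= x0 <= 1 -> 0 <= y0 <= 1 -> f x0 y0 != 0 -> 0 <= T ->
  exists2 h : R -> R, Cb h /\ (forall x, x <= T -> h x = 0) &
  exists2 c, 0 < c & \forall N \near \oo,
    c <= bexp (q (N := N)) (fun E => esd_int (scaled_centered f eps E) h).
Proof.
move=> hx hy f0 T0; have [c c0 Hc] := esd_ramp_bounded_below hx hy f0 T0.
have [K HK] := moment2.
pose D := 2 * `|K| / c + 1.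
have D0 : 0 < D by rewrite ltr_wpDl // divr_ge0 ?(ltW c0) ?mulr_ge0.
pose h x := Num.min (Num.max (x - T) 0) D.
have h_le x : Num.max (x - T) 0 <= h x + D^-1 * x ^+ 2.
  rewrite /h; have [|Dm] := leP (Num.max (x - T) 0) D.
    by rewrite lerDl mulr_ge0 ?sqr_ge0 ?invr_ge0 ?(ltW D0).
  have x2 : D < x - T by move: Dm; rewrite lt_max => /orP[//|]; lra.
  rewrite max_l; last by lra.
  apply: (@le_trans _ _ (D^-1 * x ^+ 2)); last by rewrite lerDr ltW.
  by rewrite mulrC ler_pdivlMr //; nra.
exists h; first split.
- split.
    move=> x; apply: (@continuous_min _ _ (fun v : R => Num.max (v - T) 0) (cst D)); last exact: cvg_cst.
    apply: (@continuous_max _ _ (fun v => v - T) (cst (0 : R))); last exact: cvg_cst.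
    by apply: cvgB; [exact: cvg_id|exact: cvg_cst].
  exists D => x; rewrite ger0_norm ?ge_min ?lexx ?orbT //.
  by rewrite le_min le_max lexx orbT ltW.
- by move=> x xT; rewrite /h max_r ?min_l ?subr_le0 // ltW.
exists (c / 2); first by rewrite divr_gt0.
near=> N.
have N0 : (0 < N)%N by near: N; exact: nbhs_infty_gt.
have q01 : forall u, 0 <= q (N := N) u <= 1 by near: N; exact: (near_edge_q B1 fB).
have cN : c <= bexp (q (N := N)) (fun E =>
    esd_int (scaled_centered f eps E) (fun x => Num.max (x - T) 0)) by near: N.
have KN : bexp (q (N := N)) (fun E =>
    esd_int (scaled_centered f eps E) (fun x => x ^+ 2)) <= K by near: N.
have : c <= bexp (q (N := N)) (fun E => esd_int (scaled_centered f eps E) h) + D^-1 * K.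
  rewrite (le_trans cN) //; apply: le_trans (lerD (lexx _) (ler_wpM2l _ KN)); last first.
    by rewrite invr_ge0 ltW.
  rewrite -bexpZ -bexpD; apply: ler_bexp => // E.
  by rewrite -esdZ -esdD; exact: ler_esd.
have : D^-1 * K <= c / 2; last lra.
rewrite mulrC ler_pdivrMr //.
have -> : c / 2 * D = `|K| + c / 2 by rewrite /D; field; rewrite gt_eqF.
by rewrite (le_trans (ler_norm K)) // lerDl divr_ge0 // ltW.
Unshelve. all: by end_near. Qed.

End DiagonalMoments.

(** * The limit measure: uniqueness, symmetry, support *)

Section ProbabilityEquality.
Variable R : realType.

Let idTR : R -> R := idfun.

Lemma probability_right_continuous (m : probability R R) :
  right_continuous (fun r => fine (m `]-oo, r]%classic)).
Proof.
pose X : {mfun R >-> R} := HB.pack idTR (@isMeasurableFun.Build _ _ R R idTR (@measurable_id _ _ setT)).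
move=> a; apply: fine_cvg; rewrite fineK ?fin_num_measure //.
exact: (@cdf_right_continuous _ _ _ m X a).
Qed.

Lemma eq_probability_cdf (m1 m2 : probability R R) :
  (forall r, m1 `]-oo, r]%classic = m2 `]-oo, r]%classic) ->
  forall A, measurable A -> m1 A = m2 A.
Proof.
move=> mE; apply: (measure_unique (@measurable_realfun.RGenOInfty.G R) (fun n => `]- n%:R, +oo[%classic)).
- exact: measurable_realfun.RGenOInfty.measurableE.
- move=> _ _ [x ->] [y ->]; exists (Num.max x y).
  by apply/seteqP; split=> z /=; rewrite !in_itv /= !andbT gt_max => /andP.
- by move=> n; exists (- n%:R).
- apply/seteqP; split=> // x _; exists (Num.truncn `|x|).+1 => //=.
  rewrite in_itv /= andbT ltrNl (le_lt_trans _ (truncnS_gt `|x|)) //.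
  by rewrite -normrN ler_norm.
- move=> _ [x ->]; rewrite -setCitvl.
  have mC (m : probability R R) : m (~` `]-oo, x]%classic) = (1 - m `]-oo, x]%classic)%E.
    exact: probability_setC.
  by have := mC m1; rewrite mE -mC.
- by move=> n; rewrite (le_lt_trans (probability_le1 _ _)) ?ltry.
Qed.

(** [ramp r s] lies between the indicators of two half lines, and right continuity lets [s] tend to
    [r]; exchanging the measures gives the other inequality. *)
Lemma eq_probability_Int (m1 m2 : probability R R) :
  (forall g, Cb g -> Int m1 g = Int m2 g) -> forall A, measurable A -> m1 A = m2 A.
Proof.
suff H (m1' m2' : probability R R) : (forall g, Cb g -> Int m1' g = Int m2' g) ->
    forall r, fine (m1' `]-oo, r]%classic) <= fine (m2' `]-oo, r]%classic).
  move=> mE; apply: eq_probability_cdf => r.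
  rewrite -[LHS]fineK ?fin_num_measure // -[RHS]fineK ?fin_num_measure //; congr EFin.
  by apply/eqP; rewrite eq_le !H // => g gc; rewrite mE.
move=> mE r; apply: (cvgr_to_ge (@probability_right_continuous m2' r)); near=> s.
have rs : r < s by near: s; exact: nbhs_right_gt.
have rc := Cb_ramp r s.
apply: (@le_trans _ _ (Int m1' (ramp r s))).
  apply: (Int_indic_ge (A := `]-oo, r]%classic)) => // [|x].
    by rewrite fineK ?fin_num_measure.
  rewrite indicE; have [xr|rx] := leP x r.
    by rewrite mem_set /= ?in_itv //= ramp_left.
  rewrite memNset /= ?in_itv /=; last by apply/negP; rewrite -ltNge.
  by have /andP[] := ramp_itv r s x.
rewrite mE //; apply: (Int_indic_le (A := `]-oo, s]%classic)) => // [|x].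
  by rewrite fineK ?fin_num_measure.
rewrite indicE; have [xs|sx] := leP x s.
  by rewrite mem_set /= ?in_itv //=; have /andP[] := ramp_itv r s x.
by rewrite (ramp_right rs (ltW sx)).
Unshelve. all: by end_near. Qed.

Lemma probability_symmetric (nu : probability R R) :
  (forall g, Cb g -> Int nu (fun x => g (- x)) = Int nu g) ->
  forall A : set R, measurable A -> nu [set - x | x in A] = nu A.
Proof.
move=> nuE A mA.
pose X : {mfun R >-> R} := HB.pack (fun x : R => - x)
  (@isMeasurableFun.Build _ _ R R (fun x : R => - x) (@measurable_realfun.oppr_measurable R setT)).
have -> : [set - x | x in A] = X @^-1` A.
  apply/seteqP; split=> [_ [x Ax <-]|x Ax] /=; first by rewrite opprK.
  by exists (- x); rewrite ?opprK.
apply: (eq_probability_Int (m1 := distribution nu (X : {RV nu >-> R}))) => // g gc.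
have gc' : Cb (fun x => g (- x)).
  have [gcont [M gM]] := gc; split; last by exists M.
  by move=> x; apply: (@continuous_comp _ _ _ -%R g); [exact: opp_continuous|exact: gcont].
rewrite -nuE //; congr fine; apply: (integral_distribution (X := X)).
  by apply/measurable_realfun.measurable_EFinP; apply: measurable_realfun.continuous_measurable_fun; case: gc.
exact: (integrable_Cb nu gc').
Qed.

(** Lindelof argument: each point beyond T lies in a null ball with rational centre and radius, and
    there are countably many, enumerated by [pickle]. *)
Lemma msupport_ray (nu : probability R R) T : (forall x, msupport nu x -> x <= T) ->
  nu `]T, +oo[%classic = 0%E.
Proof.
move=> nuT.
pose F (n : nat) : set R := if unpickle n is Some (a, b) then
   if nu (ball (ratr a : R) (ratr b)) == 0%E then ball (ratr a : R) (ratr b) else set0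
  else set0.
have mF n : measurable (F n).
  by rewrite /F; case: unpickle => [[a b]|] //; case: ifP => // _; exact: measurable_realfun.measurable_ball.
have F0 n : nu (F n) = 0%E.
  by rewrite /F; case: unpickle => [[a b]|]; rewrite ?measure0 //; case: ifP => [/eqP //|]; rewrite measure0.
have neg : nu.-negligible (\bigcup_n F n).
  apply: negligible_bigcup => n; exists (F n); split; [exact: mF|exact: F0|exact: subset_refl].
apply/eqP; rewrite eq_le measure_ge0 andbT.
have mU : measurable (\bigcup_n F n) by exact: bigcup_measurable.
have U0 : nu (\bigcup_n F n) = 0%E by apply/negligibleP.
rewrite -U0; apply: le_measure; rewrite ?inE //.
move=> x /=; rewrite in_itv /= andbT => Tx.
have [e e0 ne] : exists2 e, 0 < e & nu (ball x e) = 0%E.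
  apply: contrapT => H; move: Tx; apply/negP; rewrite -leNgt; apply: nuT => e e0.
  rewrite lt_def measure_ge0 andbT; apply/eqP => ne; apply: H; by exists e.
have xe : x - e / 4 < x + e / 4 by lra.
(* A centre within e/4 of [x] and a radius in (e/4, e/2) give a ball that contains [x] and stays
   inside [ball x e]. *)
have e42 : e / 4 < e / 2 by lra.
have [a] := rat_in_itvoo xe.
rewrite in_itv /= => /andP[a1 a2].
have [b] := rat_in_itvoo e42.
rewrite in_itv /= => /andP[b1 b2].
have sub : ball (ratr a : R) (ratr b) `<=` ball x e.
  by move=> y; rewrite /ball /= !ltr_norml => /andP[y1 y2]; apply/andP; split; lra.
have ab0 : nu (ball (ratr a : R) (ratr b)) = 0%E.
  apply/eqP; rewrite eq_le measure_ge0 andbT -ne.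
  by apply: le_measure; rewrite ?inE //; exact: measurable_realfun.measurable_ball.
have [n nE] : exists n, unpickle n = Some (a, b) by exists (pickle (a, b)); exact: pickleK.
exists n; first exact: I.
rewrite /F nE ab0 eqxx /ball /= ltr_norml.
by apply/andP; split; lra.
Qed.

End ProbabilityEquality.

Section LimitMeasure.
Variables (R : realType) (f : R -> R -> R) (eps : nat -> R).
Local Notation q := (edge_q f eps).
Hypothesis q01 : \forall N \near \oo, forall u, 0 <= q (N := N) u <= 1.
Hypothesis moment2 : exists K : R, \forall N \near \oo,
  bexp (q (N := N)) (fun E => esd_int (scaled_centered f eps E) (fun x => x ^+ 2)) <= K.
Hypothesis cvg_cos : forall t, exists l, esd_cvg f eps (fun x => cos (t * x)) l.
Hypothesis cvg_sin : forall t, esd_cvg f eps (fun x => sin (t * x)) 0.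

Local Notation A N E g := (esd_int (scaled_centered f eps (N := N) E) g).

Lemma esd_cvg_unique g l m : esd_cvg f eps g l -> esd_cvg f eps g m -> l = m.
Proof.
move=> gl gm; apply/eqP; rewrite -subr_eq0 -normr_le0.
apply: (esd_cvg_sub_le q01 gl gm); near=> N.
rewrite (@eq_bexp _ _ _ _ (fun=> 0)) ?bexp_cst // => E.
by rewrite subrr normr0.
Unshelve. all: by end_near. Qed.

Lemma esd_cvg_ge g l c : esd_cvg f eps g l ->
  (\forall N \near \oo, c <= bexp (q (N := N)) (fun E => A N E g)) -> c <= l.
Proof.
rewrite /esd_cvg => gl gc; apply/ler_addgt0Pr => d d0.
near \oo => N; have qN : forall u, 0 <= q (N := N) u <= 1 by near: N.
have glN : bexp (q (N := N)) (fun E => `|A N E g - l|) <= d by near: N; apply: (cvgr_le _ gl).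
have gcN : c <= bexp (q (N := N)) (fun E => A N E g) by near: N.
rewrite (le_trans gcN) // -lerBlDl; apply: le_trans glN.
rewrite -[X in _ - X](bexp_cst (q (N := N))) -bexpB.
by apply: ler_bexp => // E; exact: ler_norm.
Unshelve. all: by end_near. Qed.

Lemma exists_limit_measure : exists nu : probability R R,
  forall g, Cb g -> sym_cvg f eps g (Int nu g).
Proof.
have [K HK] := moment2.
(* The default 0 is returned only where no limit exists, which never happens on [Cb]. *)
pose L g := xget (0 : R) [set l | sym_cvg f eps g l].
have LP g : Cb g -> sym_cvg f eps g (L g).
  by move=> [gc [M gM]]; apply: xgetPex; exact: (continuous_sym_cvg q01 moment2 cvg_cos cvg_sin gc gM).
have LE g l : Cb g -> esd_cvg f eps g l -> L g = l.
  by move=> gc; apply: esd_cvg_unique; exact: (LP g gc).1.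
suff [nu nuE] : exists nu : probability R R, forall g, Cb g -> Int nu g = L g.
  by exists nu => g gc; rewrite nuE //; exact: LP.
apply: (@exists_representing_probability _ _ K).
- move=> g h gc hc; apply: LE; first exact: CbD.
  by apply: esd_cvgD; [exact: q01|exact: (LP _ gc).1|exact: (LP _ hc).1].
- by move=> c g gc; apply: LE; [exact: CbZ|apply: esd_cvgZ; exact: (LP _ gc).1].
- move=> g gc g0; apply: (esd_cvg_ge (LP _ gc).1); near=> N.
  have N0 : (0 < N)%N by near: N; exact: nbhs_infty_gt.
  have qN : forall u, 0 <= q (N := N) u <= 1 by near: N.
  apply: bexp_ge0 => // E; rewrite -(esd_cst N0 0 (tr_scaled_centered f eps E)).
  exact: ler_esd.
- by apply: LE; [exact: Cb_cst|exact: esd_cvg_cst].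
move=> g c gc c0 gx; rewrite -lerN2.
have := esd_cvgZ (-1) (LP _ gc).1; rewrite mulN1r => /esd_cvg_ge; apply; near=> N.
have N0 : (0 < N)%N by near: N; exact: nbhs_infty_gt.
have qN : forall u, 0 <= q (N := N) u <= 1 by near: N.
have KN : bexp (q (N := N)) (fun E => A N E (fun x => x ^+ 2)) <= K by near: N.
rewrite (@eq_bexp _ _ _ _ (fun E => - A N E g)); last by move=> E; rewrite esdZ mulN1r.
rewrite bexpN lerN2; apply: le_trans (ler_wpM2l c0 KN).
by rewrite -bexpZ; apply: ler_bexp => // E; rewrite -esdZ; exact: ler_esd.
Unshelve. all: by end_near. Qed.

(** Markov's inequality. *)
Lemma esd_cvg_gprob g l d : 0 < d -> esd_cvg f eps g l ->
  (fun N => @gprob R f eps N [pred E : {set 'I_N * 'I_N} | d < `|A N E g - l|]) @ \oo --> 0.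
Proof.
move=> d0 gl.
apply: (@cvg0_le _ _ (fun N => d^-1 * bexp (q (N := N)) (fun E => `|A N E g - l|))); last first.
  by rewrite -(mulr0 d^-1); exact: cvgMr.
near=> N; have qN : forall u, 0 <= q (N := N) u <= 1 by near: N.
rewrite gprobE bexp_ge0 //= -bexpZ; apply: ler_bexp => // E /=.
rewrite mulrC ler_pdivlMr //; case: ltP => h; first by rewrite mul1r ltW.
by rewrite mul0r.
Unshelve. all: by end_near. Qed.

Lemma limit_measure_symmetric (nu : probability R R) :
  (forall g, Cb g -> sym_cvg f eps g (Int nu g)) ->
  forall B : set R, measurable B -> nu [set - x | x in B] = nu B.
Proof.
move=> nuP; apply: probability_symmetric => g gc.
apply: (esd_cvg_unique (nuP _ _).1 (nuP _ gc).2).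
have [gcont [M gM]] := gc; split; last by exists M.
by move=> x; apply: (@continuous_comp _ _ _ -%R g); [exact: opp_continuous|exact: gcont].
Qed.

Lemma limit_measure_support (nu : probability R R) T (h : R -> R) c :
  (forall g, Cb g -> sym_cvg f eps g (Int nu g)) ->
  Cb h -> (forall x, x <= T -> h x = 0) -> 0 < c ->
  (\forall N \near \oo, c <= bexp (q (N := N)) (fun E => A N E h)) ->
  ~ forall x, msupport nu x -> x <= T.
Proof.
move=> nuP hc hT c0 Hc /msupport_ray nuT.
have hI : c <= Int nu h := esd_cvg_ge (nuP _ hc).1 Hc.
have [_ [M hM]] := hc.
have M1 : 0 < M + 1 by rewrite ltr_wpDl // (le_trans _ (hM 0)).
(* Rescaled, [h] lies below the indicator of the ray beyond T, which is null. *)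
have : Int nu (fun x => (M + 1)^-1 * h x) <= 0.
  apply: (Int_indic_le _ nuT) => [//||x]; first exact: CbZ.
  rewrite indicE; have [xT|Tx] := leP x T.
    by rewrite hT // mulr0.
  rewrite mem_set /= ?in_itv /= ?andbT // mulrC ler_pdivrMr // mul1r.
  by rewrite (le_trans (ler_norm _)) // (le_trans (hM x)) // lerDl.
rewrite IntZ // pmulr_rle0 ?invr_gt0 //; lra.
Qed.

End LimitMeasure.

Section KernelBounds.
Variables (R : realType) (f : R -> R -> R).
Hypothesis f_cont : {within [set p : R * R | p.1 \in `[0, 1] /\ p.2 \in `[0, 1]],
     continuous (fun p : R * R => f p.1 p.2)}.

Lemma kernel_uniform e : 0 < e -> exists2 d : R, 0 < d &
  forall x y x' y' : R, 0 <= x <= 1 -> 0 <= y <= 1 -> 0 <= x' <= 1 -> 0 <= y' <= 1 ->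
    `|x - x'| <= d -> `|y - y'| <= d -> `|f x y - f x' y'| <= e.
Proof.
move=> e0; have [d d0 H] := continuous_square_uniform f_cont e0.
by exists d => // x y x' y' *; apply: (H (x, y) (x', y')).
Qed.

(** Clipping both coordinates at k/n leads from the origin to any point in n steps of length at most
    1/n, each changing [f] by at most 1. *)
Lemma kernel_bounded : exists2 B, 1 <= B &
  forall x y, 0 <= x <= 1 -> 0 <= y <= 1 -> `|f x y| <= B.
Proof.
have [d d0 H] := kernel_uniform ltr01.
pose n := (Num.truncn d^-1).+1.
have n0 : 0 < (n%:R : R) by rewrite ltr0n.
have nd : n%:R^-1 <= d by rewrite -[d]invrK lef_pV2 ?posrE ?invr_gt0 // ltW // truncnS_gt.
have step k : (k <= n)%N -> forall x y, 0 <= x <= k%:R / n%:R -> 0 <= y <= k%:R / n%:R ->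
    `|f x y| <= `|f 0 0| + k%:R.
  elim: k => [|k IH] kn x y.
    by rewrite mul0r => /le_anti <- /le_anti <-; rewrite addr0.
  have k1 : k.+1%:R / n%:R <= 1 :> R by rewrite ler_pdivrMr // mul1r ler_nat.
  have kS : k.+1%:R / n%:R = k%:R / n%:R + n%:R^-1 :> R by rewrite -natr1 mulrDl mul1r.
  have k0 : 0 <= k%:R / n%:R :> R by rewrite divr_ge0 // ltW.
  have ni : 0 < n%:R^-1 :> R by rewrite invr_gt0.
  pose u z : R := Num.min z (k%:R / n%:R).
  have uP z : 0 <= z <= k.+1%:R / n%:R -> [/\ 0 <= u z <= k%:R / n%:R, 0 <= z <= 1,
      0 <= u z <= 1 & `|z - u z| <= d].
    move=> /andP[z0 z1]; rewrite /u; have [zk|kz] := leP z (k%:R / n%:R).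
      by rewrite subrr normr0 z0 zk (ltW d0) /=; split => //; lra.
    by rewrite ger0_norm ?subr_ge0 ?(ltW kz) //; split; lra.
  move=> /uP[ux x01 ux01 dx] /uP[uy y01 uy01 dy].
  have := H _ _ _ _ x01 y01 ux01 uy01 dx dy; have := IH (ltnW kn) _ _ ux uy.
  have := ler_normD (f (u x) (u y)) (f x y - f (u x) (u y)); rewrite addrC subrK -natr1; lra.
exists (`|f 0 0| + n%:R) => [|x y x01 y01]; first by rewrite ler_wpDl // ler1n.
by apply: step; rewrite ?divff ?gt_eqF.
Qed.

End KernelBounds.

Theorem theorem1p2 (R : realType) (f : R -> R -> R) (eps : nat -> R) :
  {within [set p : R * R | p.1 \in `[0, 1] /\ p.2 \in `[0, 1]],
     continuous (fun p : R * R => f p.1 p.2)} ->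
  (forall x y, x \in `[0, 1] -> y \in `[0, 1] -> 0 <= f x y) ->
  (forall x y, x \in `[0, 1] -> y \in `[0, 1] -> f x y = f y x) ->
  (forall N, 0 < eps N) ->
  eps @ \oo --> 0 ->
  (fun N => N%:R * eps N) @ \oo --> +oo ->
  exists nu : probability R R,
    (forall A : set R, measurable A -> nu [set - x | x in A] = nu A) /\
    (forall g : R -> R, continuous g -> (exists M : R, forall x, `|g x| <= M) ->
       forall delta : R, 0 < delta ->
         (fun N : nat => @gprob R f eps N
            [pred E : {set 'I_N * 'I_N} | delta < `|esd_int (scaled_centered f eps E) g
                               - fine (\int[nu]_x (g x)%:E)|]) @ \oo --> 0) /\
    ((exists x y, x \in `[0, 1] /\ y \in `[0, 1] /\ f x y != 0) ->
       ~ (exists M : R, forall x, msupport nu x -> `|x| <= M)).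
Proof.
move=> f_cont f_ge0 f_sym eps_gt0 eps0 Neps.
have in01 z : 0 <= z <= 1 -> z \in `[0, 1] by rewrite in_itv.
have [B B1 HB] := kernel_bounded f_cont.
have fB (x y : R) : 0 <= x <= 1 -> 0 <= y <= 1 -> 0 <= f x y <= B.
  move=> hx hy; rewrite f_ge0 ?in01 //=.
  by rewrite (le_trans (ler_norm _)) ?HB.
have fC (x y : R) : 0 <= x <= 1 -> 0 <= y <= 1 -> f x y = f y x.
  by move=> hx hy; rewrite f_sym ?in01.
have fu := @kernel_uniform R f f_cont.
have q01 := near_edge_q B1 fB eps_gt0 eps0.
have moment2 := esd_second_moment B1 fB fC fu eps_gt0 eps0 Neps.
have cvg_cos := esd_cvg_cos B1 fB fC fu eps_gt0 eps0 Neps.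
have cvg_sin := esd_cvg_sin B1 fB fC fu eps_gt0 eps0 Neps.
have [nu nuP] := exists_limit_measure q01 moment2 cvg_cos cvg_sin.
exists nu; split; first exact: limit_measure_symmetric nuP.
split=> [g gc gM delta delta0|[x [y [hx [hy fxy]]]] [M suppM]].
  exact: (esd_cvg_gprob q01 delta0 (nuP g (conj gc gM)).1).
rewrite in_itv /= in hx; rewrite in_itv /= in hy.
(* The threshold is |M|, as the tail bound asks for a nonnegative one; mass on the positive side
   alone gives the contradiction. *)
have [h [hc hT] [c c0 Hc]] := esd_bounded_below_tail B1 fB fC eps_gt0 eps0 Neps fu moment2
  hx hy fxy (normr_ge0 M).
apply: (limit_measure_support q01 nuP hc hT c0 Hc) => z /suppM zM.
by rewrite (le_trans (ler_norm z)) // (le_trans zM) // ler_norm.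
Qed.
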